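(* Let $p$ be an even positive integer and let $q=p/(p-1)$. Let $k\in A^q$ be not identically $0$, with Taylor expansion $k(z)=\sum_{n=0}^\infty c_n z^n$, and let $F$ be the $A^p$ extremal function for $k$. If $c_n=O(n^{-\alpha})$ as $n \to \infty$ for some $\alpha>3/2$, then $F\in H^\infty$.
   Context: $\mathbb{D}$ is the open unit disc and $\sigma$ is area measure on $\mathbb{D}$ normalized so that $\sigma(\mathbb{D})=1$. For $1<p<\infty$, the Bergman space $A^p$ consists of the analytic functions $f$ on $\mathbb{D}$ with $\|f\|_{A^p}=\left(\int_{\mathbb{D}}|f|^p\,d\sigma\right)^{1/p}<\infty$. $H^\infty$ is the space of bounded analytic functions on $\mathbb{D}$. With $q=p/(p-1)$, each bounded linear functional $\phi$ on $A^p$ has a unique representation $\phi(f)=\int_{\mathbb{D}} f\,\overline{k}\,d\sigma$ with $k\in A^q$; $k$ is called the kernel of $\phi$. For $k\in A^q$ not identically $0$, the $A^p$ extremal function for $k$ is the (existing and unique) function $F\in A^p$ with $\|F\|_{A^p}=1$ and $\operatorname{Re}\phi(F)=\sup_{\|g\|_{A^p}=1}\operatorname{Re}\phi(g)=\|\phi\|$, where $\phi$ is the functional with kernel $k$. *)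

(* Defs.v *)
From HB Require Import structures.
From mathcomp Require Import all_boot all_order all_algebra complex.
From mathcomp Require Import all_classical all_reals all_analysis.

Set Implicit Arguments.
Unset Strict Implicit.
Unset Printing Implicit Defensive.

Import Order.TTheory GRing.Theory Num.Theory.
Import numFieldNormedType.Exports.

Local Open Scope classical_set_scope.
Local Open Scope ring_scope.
Local Open Scope complex_scope.

Section Bergman.
Context {R : realType}.
Implicit Types (p : R) (f g k : R[i] -> R[i]) (z : R[i]) (w : measurableTypeR R * measurableTypeR R).

(* The library norm [`|z|] on R[i] takes its values in R[i]; this is its real
   counterpart. *)
Definition modulus z : R := complex.Re `|z|.

Definition disc : set R[i] := [set z | modulus z < 1].

(* [^o] selects the normed space structure of R[i] over the field R[i] itself,
   so that [derivable _ z 1] is complex differentiability at z. *)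
Definition analytic_on_disc f : Prop :=
  forall z, disc z -> derivable (f : R[i]^o -> R[i]^o) z 1.

Definition point w : R[i] := w.1 +i* w.2.

Lemma pi_inv_ge0 : 0 <= pi^-1 :> R.
Proof. by rewrite invr_ge0 pi_ge0. Qed.

(* Normalized area measure is defined on the whole plane R * R; it is only ever
   integrated over the unit disc, whose area is pi. *)
Definition sigma : {measure set (measurableTypeR R * measurableTypeR R) -> \bar R} :=
  mscale (NngNum pi_inv_ge0) (lebesgue_measure \x lebesgue_measure)%E.

Definition bergman_norm p f : \bar R :=
  ((\int[sigma]_(w in point @^-1` disc) (modulus (f (point w)) `^ p)%:E) `^ p^-1)%E.

Definition bergman p : set (R[i] -> R[i]) :=
  [set f | analytic_on_disc f /\ (bergman_norm p f < +oo)%E].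

Definition hardy_infty : set (R[i] -> R[i]) :=
  [set f | analytic_on_disc f /\
           exists M : R, forall z, disc z -> modulus (f z) <= M].

Definition disc_integral f : R[i] :=
  (\int[sigma]_(w in point @^-1` disc) complex.Re (f (point w))) +i*
  (\int[sigma]_(w in point @^-1` disc) complex.Im (f (point w))).

Definition functional_of_kernel k f : R[i] :=
  disc_integral (fun z => f z * conjc (k z)).

Definition extremal_function p k f : Prop :=
  [/\ bergman p f, bergman_norm p f = 1%E &
      (complex.Re (functional_of_kernel k f))%:E =
        ereal_sup [set (complex.Re (functional_of_kernel k g))%:E
                  | g in [set g | bergman p g /\ bergman_norm p g = 1%E]]].

Definition taylor_expansion k (c : nat -> R[i]) : Prop :=
  forall z, disc z -> series (fun n => c n * z ^+ n : R[i]^o) @ \oo --> (k z : R[i]^o).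

End Bergman.

(* Main.v *)
Require Import Defs.
From mathcomp Require Import all_boot all_order all_algebra complex.
From mathcomp Require Import all_classical all_reals all_analysis.
From mathcomp Require Import measurable_realfun.
From mathcomp Require Import ring lra.

(** Let [p = 2 n] and [G = F ^+ n], so that [|F|^p = |G|^2], and let [a], [g] and
    [c] be the Taylor coefficients of [F], [G] and [k]. Since the monomials are
    orthogonal on the disc, all norms and pairings of square integrable analytic
    functions become sums over coefficients with weights [1 / (l + 1)]
    ([square_integrableP], [parseval]); Taylor expansions exist by Cauchy's
    formula ([goursat], [cauchy_formula], [analytic_taylor]).

    By extremality, the functional [phi] of [k] satisfies the Euler-Lagrange
    equation [phi h = N * int (conjc (F ^+ n) * F ^+ n.-1 * h)], where
    [N = Re (phi F)] is its norm ([euler_lagrange]). The regularity of [F] is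
    extracted by comparing [F] with its dilations [F_lam z = F (lam * z)]. The
    convexity defect of [|z|^p] between [F] and [F_lam] is the Bregman
    divergence, and its integral equals
    [|F_lam|^p - 1 + (2 n / N) Re phi (F - F_lam)].

    For [lam = r < 1] this integral being nonnegative gives, after division by
    [1 - r], a bound for the sum of the [|g_l|^2], because the sum of the
    [|a_l c_l|] converges ([power_coef_square_summable]); a bound for the sum of
    the [|a_l|^2] follows ([coef_square_summable]).

    For [|lam| = 1] the norm is unchanged, and adding the identities for [lam]
    and its conjugate cancels the first-order terms: the divergence is
    [o(|lam - 1|)] ([bregman_rotation_small]). As it bounds the error in
    [G_lam - G ~ n F ^+ n.-1 (F_lam - F)] ([remainder_le_bregman]), the
    Euler-Lagrange equation can be differentiated along rotations. Together with
    the equation tested on [z ^+ m * F], this yields, in the limit,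
    [sum_l g_l conjc(g_(l+m)) =
     (1/N) sum_l (n l + m + 1) / (l + m + 1) a_l conjc(c_(l+m))],
    whence a bound by [(n / N) sum_l |a_l| |c_(l+m)|] ([autocorrelation_le]).

    If [c_l = O(l^(-alpha))] with [alpha > 3/2], then this bound is summable over
    [m] ([cross_correlation_decay]). The sums on the left are the Fourier
    coefficients of [|G|^2] on the unit circle; a reproducing kernel argument
    turns their absolute summability into a bound for [|G|] on the disc
    ([bounded_of_autocorrelation]), and [|F|^n = |G|]. *)

Import Order.TTheory GRing.Theory Num.Theory.
Import numFieldNormedType.Exports.

Local Open Scope classical_set_scope.
Local Open Scope ring_scope.
Local Open Scope complex_scope.

Set Implicit Arguments.
Unset Strict Implicit.
Unset Printing Implicit Defensive.

(** * The real-valued modulus *)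
Section Modulus.
Context {R : realType}.
Implicit Types (x y z : R[i]) (a b : R).

Lemma normE z : `|z| = (modulus z)%:C.
Proof. by []. Qed.

Lemma modulus_normc z : modulus z = Normc.normc z.
Proof. by []. Qed.

Lemma modulusM x y : modulus (x * y) = modulus x * modulus y.
Proof. by rewrite !modulus_normc Normc.normcM. Qed.

Lemma modulusV x : modulus x^-1 = (modulus x)^-1.
Proof. by rewrite !modulus_normc Normc.normcV. Qed.

Lemma modulusN x : modulus (- x) = modulus x.
Proof. by rewrite /modulus normrN. Qed.

Lemma modulusB x y : modulus (x - y) = modulus (y - x).
Proof. by rewrite -modulusN opprB. Qed.

Lemma modulus0 : modulus (0 : R[i]) = 0.
Proof. by rewrite /modulus normr0. Qed.

Lemma modulus1 : modulus (1 : R[i]) = 1.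
Proof. by rewrite /modulus normr1. Qed.

Lemma modulusX x n : modulus (x ^+ n) = modulus x ^+ n.
Proof.
by elim: n => [|n IH]; rewrite ?expr0 ?modulus1// !exprS modulusM IH.
Qed.

Lemma modulus_ge0 z : 0 <= modulus z.
Proof. by rewrite -ler0c -normE. Qed.

Lemma modulus_eq0 z : (modulus z == 0) = (z == 0).
Proof. by rewrite -(inj_eq (@complexI R)) -normE normr_eq0. Qed.

Lemma modulus_gt0 z : (0 < modulus z) = (z != 0).
Proof. by rewrite lt0r modulus_eq0 modulus_ge0 andbT. Qed.

Lemma modulusD x y : modulus (x + y) <= modulus x + modulus y.
Proof. by rewrite -lecR rmorphD/= -!normE ler_normD. Qed.

Lemma modulusD_le x y a b :
  modulus x <= a -> modulus y <= b -> modulus (x + y) <= a + b.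
Proof. by move=> xa yb; apply: le_trans (modulusD x y) (lerD xa yb). Qed.

Lemma modulusBD x y : modulus (x - y) <= modulus x + modulus y.
Proof. by rewrite -[modulus y]modulusN modulusD. Qed.

Lemma modulus_sum (I : Type) (r : seq I) (P : pred I) (f : I -> R[i]) :
  modulus (\sum_(i <- r | P i) f i) <= \sum_(i <- r | P i) modulus (f i).
Proof.
elim/big_rec2: _ => [|i a z _ IH]; first by rewrite modulus0.
exact: le_trans (modulusD _ _) (lerD (lexx _) IH).
Qed.

Lemma modulus_real a : modulus a%:C = `|a|.
Proof. by rewrite modulus_normc /= expr0n /= addr0 sqrtr_sqr. Qed.

Lemma modulus_i : modulus ('i : R[i]) = 1.
Proof. by rewrite modulus_normc /= expr0n /= add0r expr1n sqrtr1. Qed.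

Lemma modulus_conj z : modulus (conjc z) = modulus z.
Proof. by rewrite /modulus normcJ. Qed.

Lemma sqr_modulus z : modulus z ^+ 2 = complex.Re z ^+ 2 + complex.Im z ^+ 2.
Proof. by apply: (@complexI R); rewrite add_Re2_Im2 normE rmorphXn. Qed.

Lemma mulc_conj z : z * conjc z = (modulus z ^+ 2)%:C.
Proof. by rewrite -sqr_normc normE rmorphXn. Qed.

Lemma normr_Re_le z : `|complex.Re z| <= modulus z.
Proof.
rewrite -[leRHS]ger0_norm ?modulus_ge0// -ler_sqr ?nnegrE//.
by rewrite !real_normK ?num_real// sqr_modulus lerDl sqr_ge0.
Qed.

Lemma Re_le_modulus z : complex.Re z <= modulus z.
Proof. exact: le_trans (ler_norm _) (normr_Re_le z). Qed.

Lemma normr_Im_le z : `|complex.Im z| <= modulus z.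
Proof.
rewrite -[leRHS]ger0_norm ?modulus_ge0// -ler_sqr ?nnegrE//.
by rewrite !real_normK ?num_real// sqr_modulus lerDr sqr_ge0.
Qed.

Lemma Re_realM a z : complex.Re (a%:C * z) = a * complex.Re z.
Proof. by case: z => u v /=; rewrite mul0r subr0. Qed.

Lemma Im_realM a z : complex.Im (a%:C * z) = a * complex.Im z.
Proof. by case: z => u v /=; rewrite mul0r addr0. Qed.

Lemma Re_mul x y : complex.Re (x * y) =
  complex.Re x * complex.Re y - complex.Im x * complex.Im y.
Proof. by case: x => ? ?; case: y. Qed.

Lemma Im_mul x y : complex.Im (x * y) =
  complex.Re x * complex.Im y + complex.Im x * complex.Re y.
Proof. by case: x => ? ?; case: y. Qed.

Lemma Re_add x y : complex.Re (x + y) = complex.Re x + complex.Re y.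
Proof. by case: x => ? ?; case: y. Qed.

Lemma Im_add x y : complex.Im (x + y) = complex.Im x + complex.Im y.
Proof. by case: x => ? ?; case: y. Qed.

Lemma Re_opp x : complex.Re (- x) = - complex.Re x.
Proof. by case: x. Qed.

Lemma Im_opp x : complex.Im (- x) = - complex.Im x.
Proof. by case: x. Qed.

Lemma Re_conjc x : complex.Re (conjc x) = complex.Re x.
Proof. by case: x. Qed.

Lemma Im_conjc x : complex.Im (conjc x) = - complex.Im x.
Proof. by case: x. Qed.

Lemma complex_eqP x y :
  complex.Re x = complex.Re y -> complex.Im x = complex.Im y -> x = y.
Proof. by case: x => ? ?; case: y => ? ? /= -> ->. Qed.

Lemma sqr_modulusD x y : modulus (x + y) ^+ 2 =
  modulus x ^+ 2 + 2 * complex.Re (conjc x * y) + modulus y ^+ 2.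
Proof.
rewrite !sqr_modulus Re_add Im_add Re_mul Re_conjc Im_conjc; ring.
Qed.

End Modulus.

(** * Integrals of complex-valued functions *)

Section ComplexIntegral.
Context d (T : measurableType d) {R : realType}.
Variable mu : {measure set T -> \bar R}.
Implicit Types (D : set T) (u v : T -> R[i]) (h : T -> R).

Definition cmeasurable D u :=
  measurable_fun D (fun x => complex.Re (u x)) /\
  measurable_fun D (fun x => complex.Im (u x)).

Definition cintegrable D u :=
  mu.-integrable D (EFin \o (fun x => complex.Re (u x))) /\
  mu.-integrable D (EFin \o (fun x => complex.Im (u x))).

Definition cint D u : R[i] :=
  (\int[mu]_(x in D) complex.Re (u x)) +i*
  (\int[mu]_(x in D) complex.Im (u x)).

Lemma cmeasurableD D u v :
  cmeasurable D u -> cmeasurable D v -> cmeasurable D (fun x => u x + v x).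
Proof.
move=> [u1 u2] [v1 v2]; split.
  by under eq_fun do rewrite Re_add; exact: measurable_funD.
by under eq_fun do rewrite Im_add; exact: measurable_funD.
Qed.

Lemma cmeasurableM D u v :
  cmeasurable D u -> cmeasurable D v -> cmeasurable D (fun x => u x * v x).
Proof.
move=> [u1 u2] [v1 v2]; split.
  by under eq_fun do rewrite Re_mul; apply: measurable_funB; exact: measurable_funM.
by under eq_fun do rewrite Im_mul; apply: measurable_funD; exact: measurable_funM.
Qed.

Lemma cmeasurable_cst D (c : R[i]) : cmeasurable D (fun=> c).
Proof. by split; exact: measurable_cst. Qed.

Lemma cmeasurable_conj D u :
  cmeasurable D u -> cmeasurable D (fun x => conjc (u x)).
Proof.
move=> [u1 u2]; split; first by under eq_fun do rewrite Re_conjc.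
by under eq_fun do rewrite Im_conjc; exact: measurableT_comp.
Qed.

Lemma cmeasurableX D u n : cmeasurable D u -> cmeasurable D (fun x => u x ^+ n).
Proof.
move=> mu1; elim: n => [|n IH]; first exact: cmeasurable_cst.
by under eq_fun do rewrite exprS; exact: cmeasurableM.
Qed.

Lemma measurable_modulus D u :
  cmeasurable D u -> measurable_fun D (fun x => modulus (u x)).
Proof.
move=> [u1 u2].
rewrite (_ : (fun x => modulus (u x)) = (fun x => @Num.sqrt R
    (complex.Re (u x) ^+ 2 + complex.Im (u x) ^+ 2))); last first.
  by apply/funext => x; rewrite -sqr_modulus sqrtr_sqr ger0_norm ?modulus_ge0.
apply: (@measurableT_comp _ _ _ _ _ _ (@Num.sqrt R)) => //.
  exact: continuous_measurable_fun (@sqrt_continuous R).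
by apply: measurable_funD; exact: measurable_funX.
Qed.

Lemma cintegrable_le D u h : measurable D -> cmeasurable D u ->
  mu.-integrable D (EFin \o h) ->
  (forall x, D x -> modulus (u x) <= h x) -> cintegrable D u.
Proof.
move=> mD [mu1 mu2] ih uh.
split; apply: (le_integrable mD _ _ ih); rewrite /comp.
- exact/measurable_EFinP.
- move=> x Dx /=; rewrite lee_fin (le_trans (normr_Re_le _))//.
  by rewrite (le_trans (uh _ Dx))// ler_norm.
- exact/measurable_EFinP.
- move=> x Dx /=; rewrite lee_fin (le_trans (normr_Im_le _))//.
  by rewrite (le_trans (uh _ Dx))// ler_norm.
Qed.

Lemma cintegrableD D u v : measurable D -> cintegrable D u -> cintegrable D v ->
  cintegrable D (fun x => u x + v x).
Proof.
move=> mD [u1 u2] [v1 v2]; split.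
  by have := integrableD mD u1 v1; apply: eq_integrable => //= x _; rewrite Re_add.
by have := integrableD mD u2 v2; apply: eq_integrable => //= x _; rewrite Im_add.
Qed.

Lemma cintegrableZ D c u : measurable D -> cintegrable D u ->
  cintegrable D (fun x => c * u x).
Proof.
move=> mD [u1 u2]; split.
  have := integrableB mD (integrableZl mD (complex.Re c) u1)
                         (integrableZl mD (complex.Im c) u2).
  by apply: eq_integrable => //= x _; rewrite Re_mul EFinB !EFinM.
have := integrableD mD (integrableZl mD (complex.Re c) u2)
                       (integrableZl mD (complex.Im c) u1).
by apply: eq_integrable => //= x _; rewrite Im_mul EFinD !EFinM.
Qed.

Lemma cintegrableN D u : measurable D -> cintegrable D u ->
  cintegrable D (fun x => - u x).
Proof.
move=> mD iu; have := cintegrableZ (-1) mD iu.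
by under eq_fun do rewrite mulN1r.
Qed.

Lemma cintegrableB D u v : measurable D -> cintegrable D u -> cintegrable D v ->
  cintegrable D (fun x => u x - v x).
Proof.
by move=> mD iu iv; exact: cintegrableD mD iu (cintegrableN mD iv).
Qed.

Lemma eq_cint D u v : (forall x, D x -> u x = v x) -> cint D u = cint D v.
Proof.
move=> uv; rewrite /cint; congr (_ +i* _);
  by apply: eq_Rintegral => x /[!inE] Dx; rewrite uv.
Qed.

Lemma cintD D u v : measurable D -> cintegrable D u -> cintegrable D v ->
  cint D (fun x => u x + v x) = cint D u + cint D v.
Proof.
move=> mD [u1 u2] [v1 v2]; apply: complex_eqP.
  by rewrite Re_add /= -RintegralD//; apply: eq_Rintegral => x _; rewrite Re_add.
by rewrite Im_add /= -RintegralD//; apply: eq_Rintegral => x _; rewrite Im_add.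
Qed.

Lemma cintZ D c u : measurable D -> cintegrable D u ->
  cint D (fun x => c * u x) = c * cint D u.
Proof.
move=> mD [u1 u2]; apply: complex_eqP; rewrite ?Re_mul ?Im_mul /=.
  rewrite -!RintegralZl// -RintegralB//; first last.
  - by apply: eq_integrable (integrableZl mD (complex.Im c) u2).
  - by apply: eq_integrable (integrableZl mD (complex.Re c) u1).
  by apply: eq_Rintegral => x _; rewrite Re_mul.
rewrite -!RintegralZl// -RintegralD//; first last.
- by apply: eq_integrable (integrableZl mD (complex.Im c) u1).
- by apply: eq_integrable (integrableZl mD (complex.Re c) u2).
by apply: eq_Rintegral => x _; rewrite Im_mul.
Qed.

Lemma cintN D u : measurable D -> cintegrable D u ->
  cint D (fun x => - u x) = - cint D u.
Proof.
move=> mD iu; rewrite -mulN1r -cintZ//.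
by apply: eq_cint => x _; rewrite mulN1r.
Qed.

Lemma cintB D u v : measurable D -> cintegrable D u -> cintegrable D v ->
  cint D (fun x => u x - v x) = cint D u - cint D v.
Proof.
by move=> mD iu iv; rewrite cintD ?cintN//; exact: cintegrableN.
Qed.

Lemma cint_conj D u : measurable D -> cintegrable D u ->
  cint D (fun x => conjc (u x)) = conjc (cint D u).
Proof.
move=> mD [u1 u2]; apply: complex_eqP => /=.
  by apply: eq_Rintegral => x _; rewrite Re_conjc.
rewrite -mulN1r -RintegralZl//; apply: eq_Rintegral => x _.
by rewrite Im_conjc mulN1r.
Qed.

(** Multiplying by a unimodular constant makes the integral real and
    nonnegative, so the modulus bound reduces to monotonicity of the integral
    of a real part. *)
Lemma modulus_cint_le D u h : measurable D -> cintegrable D u ->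
  mu.-integrable D (EFin \o h) ->
  (forall x, D x -> modulus (u x) <= h x) ->
  modulus (cint D u) <= \int[mu]_(x in D) h x.
Proof.
move=> mD iu ih uh; set I := cint D u.
have [->|I0] := eqVneq I 0.
  rewrite modulus0; apply: Rintegral_ge0 => x Dx.
  exact: le_trans (modulus_ge0 _) (uh _ Dx).
pose c := conjc I / (modulus I)%:C.
have mc : modulus c = 1.
  by rewrite modulusM modulus_conj modulusV modulus_real ger0_norm
    ?modulus_ge0// divff// modulus_eq0.
have cI : c * I = (modulus I)%:C.
  rewrite mulrAC [conjc I * I]mulrC mulc_conj expr2 rmorphM /= mulfK//.
  by rewrite (inj_eq (@complexI R)) modulus_eq0.
have -> : modulus I = complex.Re (cint D (fun x => c * u x)).
  by rewrite cintZ// cI.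
apply: le_Rintegral => //; first by case: (cintegrableZ c mD iu).
move=> x Dx; apply: le_trans (Re_le_modulus _) _.
by rewrite modulusM mc mul1r uh.
Qed.

End ComplexIntegral.
Arguments cintegrable {d T R} mu D u.
Arguments cint {d T R} mu D u.

(** * Limits and derivatives in terms of the real-valued modulus *)

Section ComplexLimits.
Context {R : realType}.
Implicit Types (z w : R[i]) (e : R).

Lemma cvg_modulusP (u : nat -> R[i]) z :
  (u : nat -> R[i]^o) @ \oo --> (z : R[i]^o) <->
  forall e, 0 < e -> exists n0, forall n, (n0 <= n)%N -> modulus (u n - z) <= e.
Proof.
split=> [/cvgrPdist_le uz e e0|uz].
  have /uz[n0 _ H] : (0 : R[i]) < e%:C by rewrite ltcR.
  exists n0 => n nn0; rewrite modulusB -lecR -normE.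
  exact: (H n nn0).
apply/cvgrPdist_le => -[e i]; rewrite ltcE /= => /andP[/eqP -> e0].
have [n0 H] := uz _ e0; exists n0 => // n /= nn0.
by rewrite normE modulusB lecR H.
Qed.

Lemma derivable_modulusP (f : R[i] -> R[i]) z :
  derivable (f : R[i]^o -> R[i]^o) z 1 <->
  exists d, forall e, 0 < e -> exists2 del, 0 < del & forall w,
    modulus (w - z) < del ->
    modulus (f w - f z - d * (w - z)) <= e * modulus (w - z).
Proof.
split.
  move=> /cvg_ex[d /cvgrPdist_le Hd]; exists d => e e0.
  have /Hd : (0 : R[i]) < e%:C by rewrite ltcR.
  rewrite near_withinE => /nbhs_ballP[[del i] /=]; rewrite ltcE /=.
  move=> /andP[/eqP -> del0] H; exists del => // w wz.
  have [->|w0] := eqVneq w z.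
    by rewrite !subrr mulr0 subr0 modulus0 mulr0.
  have wz0 : w - z != 0 by rewrite subr_eq0.
  have /H : ball (0 : R[i]^o) del%:C (w - z).
    by rewrite -ball_normE /= sub0r normrN normE ltcR.
  move=> /(_ wz0); rewrite normE lecR scaler1 subrK.
  rewrite -ler_pdivrMr ?modulus_gt0// -modulusV -modulusM -modulusN.
  by congr (modulus _ <= e); rewrite /GRing.scale /=; field.
move=> [d Hd]; apply/cvg_ex; exists d; apply/cvgrPdist_le => -[e i].
rewrite ltcE /= => /andP[/eqP -> e0]; have [del del0 H] := Hd _ e0.
rewrite near_withinE; apply/nbhs_ballP.
exists del%:C; first by rewrite /= ltcR.
move=> h; rewrite -ball_normE /= sub0r normrN normE ltcR => hdel h0.
have := H (h + z); rewrite addrK => /(_ hdel).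
rewrite -ler_pdivrMr ?modulus_gt0// -modulusV -modulusM -modulusN => {}H.
rewrite normE lecR scaler1; move: H.
by congr (modulus _ <= e); rewrite /GRing.scale /=; field.
Qed.

End ComplexLimits.

(** * Integrals of continuous complex functions over segments *)

Section SegmentIntegral.
Context {R : realType}.
Implicit Types (a b c x y e M : R) (u v : R -> R[i]).
Local Notation mu := (@lebesgue_measure R).

Definition seg_continuous a b u := forall x, a <= x <= b ->
  forall e, 0 < e -> exists2 d, 0 < d &
    forall y, a <= y <= b -> `|y - x| < d -> modulus (u y - u x) <= e.

Definition seg a b u : R[i] := cint mu `[a, b] u.

Lemma seg_continuous_within (P : R[i] -> R) a b u :
  (forall z w, `|P z - P w| <= modulus (z - w)) ->
  seg_continuous a b u -> {within `[a, b], continuous (P \o u)}.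
Proof.
move=> PL cu; apply/subspace_continuousP => x; rewrite /= in_itv/= => xab.
apply/cvgrPdist_le => e e0; have [d d0 H] := cu _ xab _ e0.
rewrite near_withinE; apply/nbhs_ballP; exists d => // y.
rewrite -ball_normE /= distrC => yx; rewrite in_itv/= => yab.
by rewrite distrC (le_trans (PL _ _))// H.
Qed.

Lemma seg_continuous_integrable a b u :
  seg_continuous a b u -> cintegrable mu `[a, b] u.
Proof.
move=> cu; split; apply: continuous_compact_integrable.
- exact: segment_compact.
- apply: (seg_continuous_within _ cu) => z w.
  by rewrite -Re_opp -Re_add normr_Re_le.
- exact: segment_compact.
- apply: (seg_continuous_within _ cu) => z w.
  by rewrite -Im_opp -Im_add normr_Im_le.
Qed.

Lemma seg_continuousS a b c d u : a <= c -> d <= b ->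
  seg_continuous a b u -> seg_continuous c d u.
Proof.
move=> ac db cu x /andP[cx xd] e e0.
have xab : a <= x <= b by rewrite (le_trans ac)//= (le_trans xd).
have [del del0 H] := cu _ xab _ e0; exists del => // y /andP[cy yd] yx.
by apply: H => //; rewrite (le_trans ac)//= (le_trans yd).
Qed.

Lemma seg_continuousD a b u v : seg_continuous a b u -> seg_continuous a b v ->
  seg_continuous a b (fun x => u x + v x).
Proof.
move=> cu cv x xab e e0; have e20 : 0 < e / 2 by rewrite divr_gt0.
have [d1 d10 H1] := cu _ xab _ e20; have [d2 d20 H2] := cv _ xab _ e20.
exists (Num.min d1 d2); first by rewrite lt_min d10 d20.
move=> y yab; rewrite lt_min => /andP[/(H1 _ yab) y1 /(H2 _ yab) y2].
by rewrite opprD addrACA [leRHS](splitr e) modulusD_le.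
Qed.

Lemma seg_continuous_cst a b (z : R[i]) : seg_continuous a b (fun=> z).
Proof.
by move=> x _ e e0; exists 1 => // y _ _; rewrite subrr modulus0 ltW.
Qed.

Lemma seg_continuousM a b u v : seg_continuous a b u -> seg_continuous a b v ->
  seg_continuous a b (fun x => u x * v x).
Proof.
move=> cu cv x xab e e0.
set A := modulus (u x) + 1; set B := modulus (v x) + 1.
have A0 : 0 < A by rewrite ltr_wpDl ?modulus_ge0.
have B0 : 0 < B by rewrite ltr_wpDl ?modulus_ge0.
have eA : 0 < Num.min 1 (e / 2 / B) by rewrite lt_min ltr01 !divr_gt0.
have eB : 0 < e / 2 / A by rewrite !divr_gt0.
have [d1 d10 H1] := cu _ xab _ eA; have [d2 d20 H2] := cv _ xab _ eB.
exists (Num.min d1 d2); first by rewrite lt_min d10 d20.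
move=> y yab; rewrite lt_min => /andP[/(H1 _ yab) y1 /(H2 _ yab) y2].
move: y1; rewrite le_min => /andP[y1 y1'].
have -> : u y * v y - u x * v x = u y * (v y - v x) + (u y - u x) * v x by ring.
have uyA : modulus (u y) <= A.
  rewrite -[u y](subrK (u x)) /A addrC; apply: modulusD_le.
    by [].
  by [].
rewrite [leRHS](splitr e) modulusD_le// modulusM.
  apply: le_trans (ler_pM (modulus_ge0 _) (modulus_ge0 _) uyA y2) _.
  by rewrite mulrC divfK// gt_eqF.
apply: (@le_trans _ _ (e / 2 / B * B)); last by rewrite divfK// gt_eqF.
by rewrite ler_pM ?modulus_ge0// /B lerDl.
Qed.

Lemma seg_continuous_lipschitz a b u M :
  (forall x y, a <= x <= b -> a <= y <= b ->
     modulus (u y - u x) <= M * `|y - x|) -> seg_continuous a b u.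
Proof.
move=> uM x xab e e0; exists (e / (`|M| + 1)).
  by rewrite divr_gt0// ltr_wpDl.
move=> y yab; rewrite ltr_pdivlMr ?ltr_wpDl// => /ltW; apply: le_trans.
rewrite (le_trans (uM _ _ xab yab))// mulrC ler_wpM2l//.
by rewrite (le_trans (ler_norm _))// lerDl.
Qed.

Lemma seg_continuous_bounded a b u : seg_continuous a b u ->
  exists2 M, 0 <= M & forall x, a <= x <= b -> modulus (u x) <= M.
Proof.
move=> cu; have [ab|ba] := leP a b; last first.
  by exists 0 => // x /andP[ax xb]; have := le_lt_trans (le_trans ax xb) ba; rewrite ltxx.
have [|c _ cM] := @EVT_max R (fun x => modulus (u x)) a b ab.
  apply: (seg_continuous_within _ cu) => z w.
  have h1 := modulusD (z - w) w; have h2 := modulusD (w - z) z.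
  move: h1 h2; rewrite !subrK (modulusB w z) ler_norml => h1 h2.
  by apply/andP; split; lra.
by exists (modulus (u c)); [exact: modulus_ge0|move=> x xab; apply: cM; rewrite in_itv].
Qed.

Lemma seg_split a b c u : a <= b -> b <= c -> seg_continuous a c u ->
  seg a c u = seg a b u + seg b c u.
Proof.
move=> ab bc cu.
have [i1 i2] := seg_continuous_integrable cu.
have [j1 j2] := seg_continuous_integrable (seg_continuousS ab (lexx c) cu).
have K (g : R -> R) : mu.-integrable `[a, c] (EFin \o g) ->
    mu.-integrable `[b, c] (EFin \o g) ->
    \int[mu]_(x in `[a, c]) g x =
    \int[mu]_(x in `[a, b]) g x + \int[mu]_(x in `[b, c]) g x.
  move=> ig jg; rewrite -[X in _ = _ + X]Rintegral_itv_obnd_cbnd; last first.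
    by apply: integrableS jg => //; apply: subset_itv; rewrite bnd_simp.
  have <- := @Rintegral_itvB _ g (BLeft a) (BRight c) b ig.
  - by rewrite addrC subrK.
  - by rewrite bnd_simp.
  - by rewrite bnd_simp.
apply: complex_eqP; rewrite ?Re_add ?Im_add; exact: K.
Qed.

Lemma seg_le a b u M : a <= b -> seg_continuous a b u ->
  (forall x, a <= x <= b -> modulus (u x) <= M) ->
  modulus (seg a b u) <= M * (b - a).
Proof.
move=> ab cu uM.
have iM : mu.-integrable `[a, b] (EFin \o (fun=> M)).
  apply: continuous_compact_integrable; first exact: segment_compact.
  by apply: continuous_subspaceT => x; exact: cvg_cst.
apply: le_trans.
  apply: (modulus_cint_le _ (seg_continuous_integrable cu) iM) => //.
rewrite Rintegral_cst//= lebesgue_measure_itv/= lte_fin.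
by case: ltP => //= ba; rewrite (le_anti (introT andP (conj ab ba))) subrr.
Qed.

Lemma eq_seg a b u v : (forall x, a <= x <= b -> u x = v x) ->
  seg a b u = seg a b v.
Proof. by move=> uv; apply: eq_cint => x /=; rewrite in_itv/=; exact: uv. Qed.

Lemma segD a b u v : seg_continuous a b u -> seg_continuous a b v ->
  seg a b (fun x => u x + v x) = seg a b u + seg a b v.
Proof. by move=> cu cv; apply: cintD => //; exact: seg_continuous_integrable. Qed.

Lemma segZ a b (c : R[i]) u : seg_continuous a b u ->
  seg a b (fun x => c * u x) = c * seg a b u.
Proof. by move=> cu; apply: cintZ => //; exact: seg_continuous_integrable. Qed.

Lemma seg_cst a b (c : R[i]) : a <= b -> seg a b (fun=> c) = (b - a)%:C * c.
Proof.
move=> ab; have K (r : R) : \int[mu]_(x in `[a, b]) r = r * (b - a).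
  rewrite Rintegral_cst//= lebesgue_measure_itv/= lte_fin.
  by case: ltP => //= ba; rewrite (le_anti (introT andP (conj ab ba))) subrr.
by apply: complex_eqP; rewrite /= K ?Re_realM ?Im_realM mulrC.
Qed.

Lemma Rintegral_FTC (g g' : R -> R) a b : a <= b ->
  (forall x, is_derive x 1 g (g' x)) -> continuous g' ->
  \int[mu]_(x in `[a, b]) g' x = g b - g a.
Proof.
rewrite le_eqVlt => /predU1P[<- _ _|ab dg cg].
  by rewrite set_itv1 Rintegral_set1 subrr.
have cg0 : continuous g.
  by move=> x; apply: differentiable_continuous; apply/derivable1_diffP.
rewrite /Rintegral (@continuous_FTC2 _ g' g)//=.
- by apply: continuous_subspaceT.
- split => //.
  + by apply: cvg_at_right_filter; exact: cg0.
  + by apply: cvg_at_left_filter; exact: cg0.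
- by move=> x _; rewrite derive1E; exact: derive_val.
Qed.

End SegmentIntegral.

(** * Goursat's lemma *)

(** [Lam x1 x2 y1 y2] stands for any function of rectangles that is additive
    under subdivision and, at each point, small compared with the square of the
    diameter. It is kept abstract because the rectangles of interest lie in the
    parameter space of a contraction rather than in the plane. *)
Section Goursat.
Context {R : realType}.
Variables (Lam : R -> R -> R -> R -> R[i]) (A1 A2 B1 B2 : R).
Hypotheses (A12 : A1 <= A2) (B12 : B1 <= B2).

Let inside x1 x2 y1 y2 := [/\ A1 <= x1, x1 <= x2, x2 <= A2 &
  [/\ B1 <= y1, y1 <= y2 & y2 <= B2]].

Hypothesis Lam_split : forall x1 x x2 y1 y y2,
  x1 <= x <= x2 -> y1 <= y <= y2 -> inside x1 x2 y1 y2 ->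
  Lam x1 x2 y1 y2 =
    Lam x1 x y1 y + Lam x x2 y1 y + Lam x1 x y y2 + Lam x x2 y y2.

Hypothesis Lam_local : forall x y, A1 <= x <= A2 -> B1 <= y <= B2 ->
  forall e, 0 < e -> exists2 d, 0 < d & forall x1 x2 y1 y2,
    inside x1 x2 y1 y2 -> x1 <= x <= x2 -> y1 <= y <= y2 ->
    x2 - x1 < d -> y2 - y1 < d ->
    modulus (Lam x1 x2 y1 y2) <= e * (x2 - x1 + (y2 - y1)) ^+ 2.

Let rect := (R * R * (R * R))%type.
Let LamR (r : rect) := Lam r.1.1 r.1.2 r.2.1 r.2.2.
Let insideR (r : rect) := inside r.1.1 r.1.2 r.2.1 r.2.2.

Let child (r s : rect) := [/\ insideR s, r.1.1 <= s.1.1, s.1.2 <= r.1.2,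
  r.2.1 <= s.2.1 & s.2.2 <= r.2.2] /\
  [/\ s.1.2 - s.1.1 = (r.1.2 - r.1.1) / 2, s.2.2 - s.2.1 = (r.2.2 - r.2.1) / 2 &
      modulus (LamR r) / 4 <= modulus (LamR s)].

Let child_exists r : exists s, insideR r -> child r s.
Proof.
case: r => [[x1 x2] [y1 y2]].
have [|nin] := pselect (insideR ((x1, x2), (y1, y2))); last first.
  by exists ((x1, x2), (y1, y2)).
case=> /= a1 a2 a3 [b1 b2 b3].
pose x := (x1 + x2) / 2; pose y := (y1 + y2) / 2.
have hx : x1 <= x <= x2 by rewrite /x; apply/andP; split; lra.
have hy : y1 <= y <= y2 by rewrite /y; apply/andP; split; lra.
have [x1x xx2] := andP hx; have [y1y yy2] := andP hy.
have := Lam_split hx hy (And4 a1 a2 a3 (And3 b1 b2 b3)).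
set L := Lam x1 x2 y1 y2 => LE.
have K : [\/ modulus L / 4 <= modulus (Lam x1 x y1 y),
             modulus L / 4 <= modulus (Lam x x2 y1 y),
             modulus L / 4 <= modulus (Lam x1 x y y2) |
             modulus L / 4 <= modulus (Lam x x2 y y2)].
  have : modulus L <= modulus (Lam x1 x y1 y) + modulus (Lam x x2 y1 y) +
      modulus (Lam x1 x y y2) + modulus (Lam x x2 y y2).
    by rewrite LE; do 3 apply: modulusD_le => //.
  case: (lerP (modulus L / 4) (modulus (Lam x1 x y1 y))); first by constructor 1.
  case: (lerP (modulus L / 4) (modulus (Lam x x2 y1 y))); first by constructor 2.
  case: (lerP (modulus L / 4) (modulus (Lam x1 x y y2))); first by constructor 3.
  case: (lerP (modulus L / 4) (modulus (Lam x x2 y y2))); first by constructor 4.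
  by move=> *; exfalso; lra.
have xE : x - x1 = (x2 - x1) / 2 by rewrite /x; field.
have xE' : x2 - x = (x2 - x1) / 2 by rewrite /x; field.
have yE : y - y1 = (y2 - y1) / 2 by rewrite /y; field.
have yE' : y2 - y = (y2 - y1) / 2 by rewrite /y; field.
have [xA Ax] : A1 <= x /\ x <= A2 by split; lra.
have [yB By] : B1 <= y /\ y <= B2 by split; lra.
case: K => K; [exists ((x1, x), (y1, y)) | exists ((x, x2), (y1, y)) |
               exists ((x1, x), (y, y2)) | exists ((x, x2), (y, y2))] => _;
  by split; split.
Qed.

Let next r := sval (cid (child_exists r)).
Let nextP r : insideR r -> child r (next r).
Proof. exact: svalP (cid (child_exists r)). Qed.

Let rk k : rect := iter k next ((A1, A2), (B1, B2)).

Let rk_inside k : insideR (rk k).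
Proof.
elim: k => [|k IH]; first by split => //; split.
by have [[]] := nextP IH.
Qed.

Let rk_dims k : (rk k).1.2 - (rk k).1.1 = (A2 - A1) / 2 ^+ k /\
  (rk k).2.2 - (rk k).2.1 = (B2 - B1) / 2 ^+ k.
Proof.
elim: k => [|k [IH1 IH2]]; first by rewrite expr0 !divr1.
have [_ [/= -> -> _]] := nextP (rk_inside k).
by rewrite IH1 IH2 exprSr !invfM !mulrA.
Qed.

Let rk_Lam k : modulus (LamR (rk 0)) / 4 ^+ k <= modulus (LamR (rk k)).
Proof.
elim: k => [|k IH]; first by rewrite expr0 divr1.
have [_ [_ _ H]] := nextP (rk_inside k).
apply: le_trans H; rewrite exprSr invfM mulrA.
by rewrite ler_pM2r ?invr_gt0.
Qed.

Let rk_nested j k : (j <= k)%N ->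
  [/\ (rk j).1.1 <= (rk k).1.1, (rk k).1.2 <= (rk j).1.2,
      (rk j).2.1 <= (rk k).2.1 & (rk k).2.2 <= (rk j).2.2].
Proof.
elim: k => [|k IH]; first by rewrite leqn0 => /eqP ->.
rewrite leq_eqVlt => /predU1P[->//|/IH[h1 h2 h3 h4]].
have [[_ g1 g2 g3 g4] _] := nextP (rk_inside k).
by split; [exact: le_trans h1 g1 | exact: le_trans g2 h2 |
           exact: le_trans h3 g3 | exact: le_trans g4 h4].
Qed.

Let nested_point (l u : nat -> R) :
  (forall j k, (j <= k)%N -> l j <= l k /\ u k <= u j) ->
  (forall k, l k <= u k) -> exists x, forall k, l k <= x <= u k.
Proof.
move=> mono lu.
have lu' j k : l j <= u k.
  have [jk|/ltnW kj] := leqP j k.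
    exact: le_trans (mono _ _ jk).1 (lu _).
  exact: le_trans (lu _) (mono _ _ kj).2.
have ub : has_sup (range l).
  by split; [exists (l 0); exists 0%N | exists (u 0) => _ [j _ <-]].
exists (sup (range l)) => k; apply/andP; split.
  by apply: sup_upper_bound => //; exists k.
by apply: ge_sup => [|_ [j _ <-]//]; exists (l 0); exists 0%N.
Qed.

(** Goursat's argument: a rectangle on which the additive function is large
    contains a quarter on which it is large relative to the area, and the
    nested quarters shrink to a point that contradicts local smallness. *)
Lemma goursat : Lam A1 A2 B1 B2 = 0.
Proof.
have [//|L0] := eqVneq (Lam A1 A2 B1 B2) 0; exfalso.
have [x hx] : exists x, forall k, (rk k).1.1 <= x <= (rk k).1.2.
  apply: (nested_point (l := fun k => (rk k).1.1) (u := fun k => (rk k).1.2)).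
    by move=> j k /rk_nested[].
  by move=> k; case: (rk_inside k).
have [y hy] : exists y, forall k, (rk k).2.1 <= y <= (rk k).2.2.
  apply: (nested_point (l := fun k => (rk k).2.1) (u := fun k => (rk k).2.2)).
    by move=> j k /rk_nested[].
  by move=> k; case: (rk_inside k) => _ _ _ [].
set c := modulus (Lam A1 A2 B1 B2).
have c0 : 0 < c by rewrite modulus_gt0.
set S := A2 - A1 + (B2 - B1).
have S0 : 0 <= S by rewrite addr_ge0 ?subr_ge0.
pose e := c / (S ^+ 2 + 1) / 2.
have S2 : 0 < S ^+ 2 + 1 by rewrite ltr_wpDl ?sqr_ge0.
have e0 : 0 < e by rewrite !divr_gt0.
have [d d0 H] := Lam_local (hx 0%N) (hy 0%N) e0.
have [k kd] : exists k, S / 2 ^+ k < d.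
  have /cvgrPdist_lt/(_ _ d0)[k _ /(_ k (leqnn k))] :
      geometric S (2^-1 : R) @ \oo --> 0.
    by apply: cvg_geometric; rewrite ger0_norm// invf_lt1// ltr1n.
  rewrite /= sub0r normrN exprVn ger0_norm; first by exists k.
  by rewrite mulr_ge0// invr_ge0 exprn_ge0.
have [Dx Dy] := rk_dims k.
have p2 : 0 < (2 : R) ^+ k by rewrite exprn_gt0.
have Sx : A2 - A1 <= S by rewrite lerDl subr_ge0.
have Sy : B2 - B1 <= S by rewrite lerDr subr_ge0.
have := H _ _ _ _ (rk_inside k) (hx k) (hy k).
rewrite Dx Dy => /(_ (le_lt_trans _ kd) (le_lt_trans _ kd)).
rewrite !ler_pM2r ?invr_gt0// => /(_ Sx Sy).
have := rk_Lam k; rewrite -/c => h1 h2.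
have {h1 h2} := le_trans h1 h2.
rewrite -mulrDl -/S expr_div_n -exprM mulnC exprM mulrA.
have -> : (2 : R) ^+ 2 = 4 by rewrite -natrX.
rewrite ler_pM2r ?invr_gt0 ?exprn_gt0//.
rewrite /e => h; suff : c / (S ^+ 2 + 1) / 2 * S ^+ 2 < c by rewrite ltNge h.
rewrite [ltLHS](_ : _ = c / 2 * (S ^+ 2 / (S ^+ 2 + 1))); last first.
  by field; rewrite gt_eqF.
apply: (@le_lt_trans _ _ (c / 2 * 1)); last by rewrite mulr1; lra.
by rewrite ler_pM2l ?divr_gt0// ler_pdivrMr// mul1r lerDl.
Qed.

End Goursat.

(** * Integrals over the unit circle *)
Section UnitCircle.
Context {R : realType}.
Implicit Types (x y : R) (n : nat).

Definition circ x : R[i] := cos x +i* sin x.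

Lemma modulus_circ x : modulus (circ x) = 1.
Proof. by rewrite modulus_normc /= cos2Dsin2 sqrtr1. Qed.

Lemma circ_neq0 x : circ x != 0.
Proof. by rewrite -modulus_gt0 modulus_circ. Qed.

Lemma circD x y : circ (x + y) = circ x * circ y.
Proof. by rewrite /circ cosD sinD; apply: complex_eqP => /=; ring. Qed.

Lemma circ_expr x n : circ x ^+ n = circ (x *+ n).
Proof.
elim: n => [|n IH]; first by rewrite expr0 mulr0n /circ cos0 sin0.
by rewrite exprS IH -circD mulrS.
Qed.

Lemma circ_2pi : circ (pi *+ 2) = 1.
Proof. by rewrite /circ cos2pi sin2pi. Qed.

Lemma circ_inv x : (circ x)^-1 = conjc (circ x).
Proof.
apply: (mulfI (circ_neq0 x)); rewrite divff ?circ_neq0// mulc_conj.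
by rewrite modulus_circ expr1n.
Qed.

Lemma lipschitz_of_derive (g g' : R -> R) :
  (forall x, is_derive x 1 g (g' x)) ->
  (forall x, `|g' x| <= 1) -> forall x y, `|g y - g x| <= `|y - x|.
Proof.
move=> dg g1 x y; wlog xy : x y / x <= y.
  move=> W; have [|/ltW] := leP x y; first exact: W.
  by move=> /W; rewrite distrC [`|x - y|]distrC.
have cg : continuous (g : R -> R).
  by move=> z; apply: differentiable_continuous; apply/derivable1_diffP.
have [c _ ->] := @MVT_segment _ g g' x y xy (fun z _ => dg z)
  (continuous_subspaceT cg).
by rewrite normrM ler_piMl.
Qed.

Lemma circ_lipschitz x y : modulus (circ y - circ x) <= 2 * `|y - x|.
Proof.
have -> : circ y - circ x = (cos y - cos x)%:C + 'i * (sin y - sin x)%:C.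
  by apply: complex_eqP => /=; ring.
rewrite mulr_natl mulr2n; apply: modulusD_le;
  rewrite ?modulusM ?modulus_i ?mul1r modulus_real.
  apply: (@lipschitz_of_derive cos (fun z => - sin z)) => z.
  by rewrite normrN ler_norml sin_geN1 sin_le1.
apply: (@lipschitz_of_derive sin cos) => z.
by rewrite ler_norml cos_geN1 cos_le1.
Qed.

Lemma is_derive_Ncos x : is_derive x 1 (fun z : R => - cos z) (sin x).
Proof. by rewrite -[sin x]opprK; exact: is_deriveN. Qed.

Lemma seg_circ x y : x <= y -> 'i * seg x y circ = circ y - circ x.
Proof.
move=> xy; have cc : seg_continuous x y circ.
  by apply: (@seg_continuous_lipschitz _ _ _ _ 2) => ? ? _ _; exact: circ_lipschitz.
apply: complex_eqP; rewrite ?Re_mul ?Im_mul /= !(mul0r, mul1r, add0r, addr0).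
  rewrite (Rintegral_FTC xy is_derive_Ncos (@continuous_sin R)).
  by rewrite opprB addrC opprK.
by rewrite (Rintegral_FTC xy (@is_derive_sin R) (@continuous_cos R)).
Qed.

Lemma seg_circX n : seg 0 (pi *+ 2) (fun x => circ x ^+ n.+1) = 0.
Proof.
set N : R := n.+1%:R; have N0 : N != 0 by rewrite pnatr_eq0.
have K (g g' : R -> R) : (forall x, is_derive x 1 g (g' x)) ->
    continuous g' -> g (pi *+ 2 * N) = g 0 ->
    \int[@lebesgue_measure R]_(x in `[0, pi *+ 2]) g' (x * N) = 0.
  move=> dg cg g0.
  have D x : is_derive x 1 (fun y => N^-1 * g (y * N)) (g' (x * N)).
    have dN : is_derive x 1 (fun y : R => y * N) N.
      have := is_deriveM (is_derive_id x (1 : R)) (is_derive_cst N x 1).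
      by rewrite /= !scaler0 add0r => H; apply: is_derive_eq H _; rewrite /GRing.scale /= mulr1.
    have := is_deriveZ N^-1 (@is_derive1_comp _ g (fun y => y * N) x _ _ (dg (x * N)) dN) .
    by move=> H; apply: is_derive_eq H _; rewrite /GRing.scale /=; field.
  have cgN : continuous (fun x => g' (x * N)).
    by move=> x; apply: continuous_comp; [exact: mulrr_continuous|exact: cg].
  rewrite (Rintegral_FTC _ D cgN); first by rewrite mul0r g0 subrr.
  by rewrite mulrn_wge0// pi_ge0.
have cN : circ (pi *+ 2 * N) = circ 0.
  rewrite /N mulr_natr -circ_expr circ_2pi expr1n.
  by rewrite /circ cos0 sin0.
have [cN1 sN1] : cos (pi *+ 2 * N) = cos 0 :> R /\ sin (pi *+ 2 * N) = sin 0 :> R.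
  by case: cN => -> ->.
rewrite (@eq_seg _ _ _ _ (fun x => circ (x * N))); last first.
  by move=> x _; rewrite circ_expr mulr_natr.
apply: complex_eqP => /=.
  exact: (K _ _ (@is_derive_sin R) (@continuous_cos R)).
by apply: (K _ _ is_derive_Ncos (@continuous_sin R)); rewrite cN1.
Qed.

End UnitCircle.

(** * Cauchy's formula without continuity of the derivative *)
Section CauchyFormula.
Context {R : realType}.
Variables (zeta : R[i]) (r : R).
Hypotheses (zeta_r : modulus zeta < r) (r1 : r < 1).
Implicit Types (f g : R[i] -> R[i]) (t s x y a b tau e M : R).

Definition disc_continuous f := forall z, disc z -> forall e, 0 < e ->
  exists2 d, 0 < d & forall w, disc w -> modulus (w - z) < d ->
    modulus (f w - f z) <= e.

(** [t |-> H t x] contracts the circle of radius [r], parametrized by [E], to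
    [zeta]. As [H t x - zeta = t * (E x - zeta)], the form [dz / (z - zeta)] is
    ['i * ker x dx] along the image of a circle and [dt / t] along a ray. *)
Let E x := r%:C * circ x.
Let ker x := E x / (E x - zeta).
Let H t x := zeta + t%:C * (E x - zeta).
Let m := r - modulus zeta.

Let r0 : 0 < r. Proof. exact: le_lt_trans (modulus_ge0 _) zeta_r. Qed.
Let m0 : 0 < m. Proof. by rewrite subr_gt0. Qed.

Let modE x : modulus (E x) = r.
Proof. by rewrite modulusM modulus_real modulus_circ mulr1 ger0_norm// ltW. Qed.

Let E_neq0 x : E x != 0. Proof. by rewrite -modulus_gt0 modE. Qed.

Let E_sub x : m <= modulus (E x - zeta).
Proof.
rewrite /m lerBlDr -(modE x); apply: le_trans (modulusD _ _).
by rewrite subrK.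
Qed.

Let E_sub_neq0 x : E x - zeta != 0.
Proof. by rewrite -modulus_gt0 (lt_le_trans m0). Qed.

Let E_sub2 x : modulus (E x - zeta) <= 2.
Proof.
apply: le_trans (modulusBD _ _) _; rewrite modE.
by move: zeta_r r1; lra.
Qed.

Let E_lipschitz x y : modulus (E y - E x) <= 2 * `|y - x|.
Proof.
rewrite -mulrBr modulusM modulus_real ger0_norm ?(ltW r0)//.
apply: le_trans (circ_lipschitz _ _).
by rewrite ler_piMl ?modulus_ge0// ltW.
Qed.

Let ker_bound x : modulus (ker x) <= m^-1.
Proof.
rewrite /ker modulusM modulusV modE -[leRHS]mul1r ler_pM ?invr_ge0 ?modulus_ge0//.
- exact: ltW.
- exact: ltW.
- by rewrite lef_pV2 ?posrE ?E_sub// modulus_gt0.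
Qed.

Let ker_continuous a b : seg_continuous a b ker.
Proof.
apply: (@seg_continuous_lipschitz _ _ _ _ (2 * m^-1 ^+ 2)) => x y _ _.
have -> : ker y - ker x =
    zeta * (E x - E y) * ((E y - zeta)^-1 * (E x - zeta)^-1).
  by rewrite /ker; field; rewrite !E_sub_neq0.
rewrite modulusM mulrAC ler_pM ?modulus_ge0//.
  rewrite modulusM modulusB; apply: le_trans (E_lipschitz _ _).
  by rewrite ler_piMl ?modulus_ge0// ltW// (lt_trans zeta_r).
rewrite modulusM !modulusV expr2 ler_pM ?invr_ge0 ?modulus_ge0//.
- by rewrite lef_pV2 ?posrE ?E_sub// modulus_gt0.
- by rewrite lef_pV2 ?posrE ?E_sub// modulus_gt0.
Qed.

Let H_disc t x : 0 <= t <= 1 -> disc (H t x).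
Proof.
move=> /andP[t0 t1]; rewrite /disc /=.
have -> : H t x = (1 - t)%:C * zeta + t%:C * E x.
  by rewrite /H rmorphB rmorph1; ring.
apply: le_lt_trans (modulusD _ _) _.
rewrite (modulusM (1 - t)%:C) (modulusM t%:C) !modulus_real modE !ger0_norm ?subr_ge0//.
have : (1 - t) * modulus zeta <= (1 - t) * r.
  by rewrite ler_wpM2l ?subr_ge0// ltW.
by move: r1; lra.
Qed.

Let H_lipschitz t s x y : 0 <= t <= 1 -> 0 <= s <= 1 ->
  modulus (H s y - H t x) <= 2 * (`|s - t| + `|y - x|).
Proof.
move=> /andP[t0 t1] /andP[s0 s1].
have -> : H s y - H t x = (s - t)%:C * (E y - zeta) + t%:C * (E y - E x).
  by rewrite /H rmorphB; ring.
rewrite [leRHS]mulrDr; apply: modulusD_le; rewrite modulusM modulus_real.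
  by rewrite mulrC ler_wpM2r.
rewrite ger0_norm//; apply: le_trans (E_lipschitz _ _).
by rewrite ler_piMl// modulus_ge0.
Qed.

Let H_continuous_x f t a b : 0 <= t <= 1 -> disc_continuous f ->
  seg_continuous a b (fun x => f (H t x)).
Proof.
move=> t01 cf x xab e e0; have [d d0 D] := cf _ (H_disc x t01) _ e0.
exists (d / 2); first by rewrite divr_gt0.
move=> y yab yx; apply: D; first exact: H_disc.
apply: le_lt_trans (H_lipschitz _ _ t01 t01) _.
by rewrite subrr normr0 add0r mulrC -ltr_pdivlMr.
Qed.

Let H_continuous_t f x a b : 0 <= a -> b <= 1 -> disc_continuous f ->
  seg_continuous a b (fun t => f (H t x)).
Proof.
move=> a0 b1 cf t /andP[ta tb] e e0.
have t01 : 0 <= t <= 1 by rewrite (le_trans a0)//= (le_trans tb).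
have [d d0 D] := cf _ (H_disc x t01) _ e0.
exists (d / 2); first by rewrite divr_gt0.
move=> s /andP[sa sb] st.
have s01 : 0 <= s <= 1 by rewrite (le_trans a0)//= (le_trans sb).
apply: D; first exact: H_disc.
apply: le_lt_trans (H_lipschitz _ _ t01 s01) _.
by rewrite subrr normr0 addr0 mulrC -ltr_pdivlMr.
Qed.

Let inv_continuous a b : 0 < a -> seg_continuous a b (fun t => t%:C^-1).
Proof.
move=> a0; apply: (@seg_continuous_lipschitz _ _ _ _ (a^-1 ^+ 2)).
move=> x y /andP[ax _] /andP[ay _].
have x0 : 0 < x by exact: lt_le_trans ax.
have y0 : 0 < y by exact: lt_le_trans ay.
rewrite -!fmorphV -rmorphB modulus_real.
have -> : y^-1 - x^-1 = y^-1 * x^-1 * (x - y) by field; rewrite !gt_eqF.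
rewrite normrM [`|x - y|]distrC; apply: ler_wpM2r => //.
rewrite normrM !normfV (gtr0_norm x0) (gtr0_norm y0) expr2.
by rewrite ler_pM ?invr_ge0 ?(ltW x0) ?(ltW y0)// lef_pV2 ?posrE.
Qed.

(** The boundary integral of [f dz / (z - zeta)] over the image of
    [t1, t2] * [x1, x2] under [H]. *)
Let arcs f t1 t2 x := (f (H t2 x) - f (H t1 x)) * ker x.
Let rays f x1 x2 t := (f (H t x2) - f (H t x1)) * t%:C^-1.
Let Lam f t1 t2 x1 x2 :=
  'i * seg x1 x2 (arcs f t1 t2) - seg t1 t2 (rays f x1 x2).

Let seg_continuousB (u v : R -> R[i]) a b : seg_continuous a b u ->
  seg_continuous a b v -> seg_continuous a b (fun x => u x - v x).
Proof.
move=> cu cv; apply: seg_continuousD cu _.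
have := seg_continuousM (@seg_continuous_cst R a b (-1)) cv.
by under eq_fun do rewrite mulN1r.
Qed.

Let arcs_continuous f t1 t2 a b : 0 <= t1 <= 1 -> 0 <= t2 <= 1 ->
  disc_continuous f -> seg_continuous a b (arcs f t1 t2).
Proof.
move=> ? ? cf; apply: seg_continuousM; last exact: ker_continuous.
by apply: seg_continuousB; exact: H_continuous_x.
Qed.

Let rays_continuous f x1 x2 a b : 0 < a -> b <= 1 ->
  disc_continuous f -> seg_continuous a b (rays f x1 x2).
Proof.
move=> a0 b1 cf; apply: seg_continuousM; last exact: inv_continuous.
by apply: seg_continuousB; exact: H_continuous_t (ltW a0) b1 cf.
Qed.

(** Subtracting the tangent map at a point does not change [Lam]; this is
    where differentiability enters the local estimate for Goursat's lemma. *)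
Let Lam_affine c d z0 t1 t2 x1 x2 : 0 < t1 -> t1 <= t2 -> x1 <= x2 ->
  Lam (fun z => c + d * (z - z0)) t1 t2 x1 x2 = 0.
Proof.
move=> t10 t12 x12; rewrite /Lam.
have cc : seg_continuous x1 x2 circ.
  by apply: (@seg_continuous_lipschitz _ _ _ _ 2) => ? ? _ _; exact: circ_lipschitz.
rewrite (@eq_seg _ x1 x2 _ (fun x => d * (t2 - t1)%:C * r%:C * circ x)); last first.
  move=> x _; rewrite /arcs /ker /H rmorphB.
  rewrite [RHS](_ : _ = d * (t2%:C - t1%:C) * E x); last by rewrite /E; ring.
  by field; rewrite E_sub_neq0.
rewrite segZ// (@eq_seg _ t1 t2 _ (fun=> d * (E x2 - E x1))); last first.
  move=> t /andP[tt1 _]; rewrite /rays /H.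
  have t0 : t%:C != 0.
    by rewrite (inj_eq (@complexI R)) gt_eqF// (lt_le_trans t10).
  by field.
by rewrite seg_cst// mulrCA seg_circ// /E; ring.
Qed.

Let Lam_bound f t1 t2 x1 x2 tau B : 0 < tau -> tau <= t1 -> t1 <= t2 ->
  t2 <= 1 -> x1 <= x2 -> disc_continuous f ->
  (forall t x, t1 <= t <= t2 -> x1 <= x <= x2 -> modulus (f (H t x)) <= B) ->
  modulus (Lam f t1 t2 x1 x2) <=
    2 * B * (m^-1 + tau^-1) * (t2 - t1 + (x2 - x1)).
Proof.
move=> tau0 taut1 t12 t21 x12 cf fB.
have t10 : 0 < t1 by exact: lt_le_trans taut1.
have h1 : 0 <= t1 <= 1 by rewrite ltW//= (le_trans t12).
have h2 : 0 <= t2 <= 1 by rewrite (le_trans _ t12)//= ltW.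
have B0 : 0 <= B.
  by apply: le_trans (modulus_ge0 _) (fB t1 x1 _ _); rewrite lexx.
have b1 : modulus (seg x1 x2 (arcs f t1 t2)) <= 2 * B * m^-1 * (x2 - x1).
  apply: seg_le => //; first exact: arcs_continuous.
  move=> x xx; rewrite modulusM ler_pM ?modulus_ge0//.
  rewrite mulr_natl mulr2n; apply: le_trans (modulusBD _ _) _.
  by apply: lerD; apply: fB; rewrite ?lexx ?t12.
have b2 : modulus (seg t1 t2 (rays f x1 x2)) <= 2 * B * tau^-1 * (t2 - t1).
  apply: seg_le => //; first exact: rays_continuous.
  move=> t tt; have [tt1 _] := andP tt.
  have t0 : 0 < t by exact: lt_le_trans tt1.
  rewrite modulusM ler_pM ?modulus_ge0//.
    rewrite mulr_natl mulr2n; apply: le_trans (modulusBD _ _) _.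
    by apply: lerD; apply: fB; rewrite ?lexx ?x12.
  rewrite modulusV modulus_real ger0_norm ?(ltW t0)//.
  by rewrite lef_pV2 ?posrE// (le_trans taut1).
apply: le_trans (modulusBD _ _) _; rewrite modulusM modulus_i mul1r.
apply: le_trans (lerD b1 b2) _.
rewrite -!mulrA -!mulrDr ler_wpM2l// ler_wpM2l//.
have i1 : 0 <= m^-1 by rewrite invr_ge0 ltW.
have i2 : 0 <= tau^-1 by rewrite invr_ge0 ltW.
have j1 : 0 <= m^-1 * (t2 - t1) by rewrite mulr_ge0// subr_ge0.
have j2 : 0 <= tau^-1 * (x2 - x1) by rewrite mulr_ge0// subr_ge0.
by rewrite mulrDl !mulrDr; lra.
Qed.

Let LamD f g t1 t2 x1 x2 : 0 < t1 -> t1 <= t2 -> t2 <= 1 ->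
  disc_continuous f -> disc_continuous g ->
  Lam (fun z => f z + g z) t1 t2 x1 x2 = Lam f t1 t2 x1 x2 + Lam g t1 t2 x1 x2.
Proof.
move=> t10 t12 t21 cf cg; rewrite /Lam.
have h1 : 0 <= t1 <= 1 by rewrite ltW//= (le_trans t12).
have h2 : 0 <= t2 <= 1 by rewrite (le_trans _ t12)//= ltW.
rewrite (@eq_seg _ x1 x2 _ (fun x => arcs f t1 t2 x + arcs g t1 t2 x)); last first.
  by move=> x _; rewrite /arcs; ring.
rewrite (@eq_seg _ t1 t2 _ (fun t => rays f x1 x2 t + rays g x1 x2 t)); last first.
  by move=> x _; rewrite /rays; ring.
rewrite segD; try exact: arcs_continuous.
rewrite segD; try exact: rays_continuous.
ring.
Qed.

Lemma disc_continuous_affine (c d z0 : R[i]) :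
  disc_continuous (fun z => c + d * (z - z0)).
Proof.
move=> z _ e e0; exists (e / (modulus d + 1)).
  by rewrite divr_gt0// ltr_wpDl// modulus_ge0.
move=> w _; rewrite ltr_pdivlMr ?ltr_wpDl ?modulus_ge0// => /ltW.
apply: le_trans.
rewrite (_ : _ - _ = (w - z) * d); last by ring.
by rewrite modulusM ler_wpM2l ?modulus_ge0// lerDl.
Qed.

Lemma disc_continuousB f g : disc_continuous f -> disc_continuous g ->
  disc_continuous (fun z => f z - g z).
Proof.
move=> cf cg z dz e e0; have e20 : 0 < e / 2 by rewrite divr_gt0.
have [d1 d10 H1] := cf _ dz _ e20; have [d2 d20 H2] := cg _ dz _ e20.
exists (Num.min d1 d2); first by rewrite lt_min d10 d20.
move=> w dw; rewrite lt_min => /andP[/(H1 _ dw) w1 /(H2 _ dw) w2].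
rewrite (_ : _ - _ = (f w - f z) - (g w - g z)); last by ring.
by apply: le_trans (modulusBD _ _) _; rewrite [leRHS](splitr e) lerD.
Qed.

Lemma analytic_disc_continuous f : analytic_on_disc f -> disc_continuous f.
Proof.
move=> af z dz e e0; have /derivable_modulusP[d Hd] := af z dz.
have [del del0 D] := Hd 1 ltr01.
set A := 1 + modulus d; have A0 : 0 < A by rewrite ltr_pwDl// modulus_ge0.
exists (Num.min del (e / A)); first by rewrite lt_min del0 divr_gt0.
move=> w _; rewrite lt_min => /andP[/D h]; rewrite ltr_pdivlMr// => /ltW we.
rewrite -[_ - _](subrK (d * (w - z))); apply: le_trans we.
by rewrite /A [leRHS]mulrC [leRHS]mulrDl; apply: modulusD_le => //; rewrite modulusM.
Qed.

(** The contraction is stopped at [tau > 0], as [dz / (z - zeta)] is singular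
    at [zeta]. *)
Let Lam_eq0 f tau b : analytic_on_disc f -> 0 < tau -> tau <= 1 -> 0 <= b ->
  Lam f tau 1 0 b = 0.
Proof.
move=> af tau0 tau1 b0; have cf := analytic_disc_continuous af.
apply: goursat => //.
- move=> t1 t t2 x1 x x2 /andP[t1t tt2] /andP[x1x xx2].
  move=> [h1 h2 h3 [h4 h5 h6]]; rewrite /Lam.
  have t10 : 0 < t1 by exact: lt_le_trans h1.
  have I1 : 0 <= t1 <= 1 by rewrite ltW//= (le_trans h2).
  have I2 : 0 <= t2 <= 1 by rewrite (le_trans _ h2)//= ltW.
  have I : 0 <= t <= 1.
    by apply/andP; split; [exact: le_trans (ltW t10) t1t|exact: le_trans tt2 h3].
  have t0 : 0 < t by exact: lt_le_trans t1t.
  have t1' := le_trans tt2 h3.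
  rewrite (seg_split x1x xx2 (arcs_continuous I1 I2 cf)).
  rewrite (seg_split t1t tt2 (rays_continuous _ _ t10 h3 cf)).
  have A y1 y2 : seg y1 y2 (arcs f t1 t2) =
      seg y1 y2 (arcs f t1 t) + seg y1 y2 (arcs f t t2).
    rewrite -segD; try exact: arcs_continuous.
    by apply: eq_seg => y _; rewrite /arcs; ring.
  have B s1 s2 : 0 < s1 -> s2 <= 1 -> seg s1 s2 (rays f x1 x2) =
      seg s1 s2 (rays f x1 x) + seg s1 s2 (rays f x x2).
    move=> s10 s21; rewrite -segD; try exact: rays_continuous.
    by apply: eq_seg => y _; rewrite /rays; ring.
  have Q (i a1 a2 b1 b2 r1' r2 s1 s2 : R[i]) :
      i * (a1 + a2 + (b1 + b2)) - (r1' + r2 + (s1 + s2)) =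
      i * a1 - r1' + (i * a2 - s1) + (i * b1 - r2) + (i * b2 - s2).
    by clear; ring.
  by rewrite !A !B//; exact: Q.
- move=> t0 x0 /andP[taut0 t01] x00b e e0.
  have t00 : 0 <= t0 <= 1 by rewrite t01 (le_trans _ taut0)// ltW.
  set z0 := H t0 x0.
  have /derivable_modulusP[d Hd] := af z0 (H_disc x0 t00).
  set C := 4 * (m^-1 + tau^-1).
  have C0 : 0 < C by rewrite mulr_gt0// addr_gt0// invr_gt0.
  have [del del0 D] := Hd (e / C) (divr_gt0 e0 C0).
  exists (del / 4); first by rewrite divr_gt0.
  move=> t1 t2 x1 x2 [h1 h2 h3 [h4 h5 h6]] /andP[t1t0 t0t2] /andP[x1x0 x0x2].
  move=> td xd; pose L z := f z0 + d * (z - z0); pose g z := f z - L z.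
  have t10 : 0 < t1 by exact: lt_le_trans h1.
  have cL : disc_continuous L by exact: disc_continuous_affine.
  have cg : disc_continuous g by exact: disc_continuousB.
  have -> : Lam f t1 t2 x1 x2 = Lam g t1 t2 x1 x2.
    have <- : Lam (fun z => L z + g z) t1 t2 x1 x2 = Lam g t1 t2 x1 x2.
      by rewrite LamD// Lam_affine// add0r.
    apply: (f_equal (fun h => Lam h t1 t2 x1 x2)).
    by apply/funext => z; rewrite /g addrC subrK.
  set S := t2 - t1 + (x2 - x1).
  have S0 : 0 <= S by rewrite addr_ge0// subr_ge0.
  have gB t x : t1 <= t <= t2 -> x1 <= x <= x2 ->
      modulus (g (H t x)) <= e / C * (2 * S).
    move=> /andP[t1t tt2] /andP[x1x xx2].
    have tI : 0 <= t <= 1.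
      by apply/andP; split; [exact: le_trans (ltW t10) t1t|exact: le_trans tt2 h3].
    have Hz : modulus (H t x - z0) <= 2 * S.
      apply: le_trans (H_lipschitz _ _ t00 tI) _.
      rewrite ler_wpM2l// lerD// ler_norml; apply/andP; split; lra.
    rewrite /g /L opprD addrA; apply: le_trans (D _ _) _.
      by apply: le_lt_trans Hz _; rewrite /S; lra.
    by rewrite ler_wpM2l// divr_ge0// ltW.
  apply: le_trans (Lam_bound tau0 h1 h2 h3 h5 cg gB) _.
  rewrite le_eqVlt; apply/orP; left; apply/eqP; rewrite -/S /C.
  field; rewrite !gt_eqF//= addr_gt0//.
Qed.

(** Cauchy's formula: the contraction of the circle of radius [r] to [zeta]
    leaves the integral unchanged. *)
Lemma cauchy_formula f : analytic_on_disc f ->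
  seg 0 (pi *+ 2) (fun x => f (E x) * ker x) =
  f zeta * seg 0 (pi *+ 2) ker.
Proof.
move=> af; have cf := analytic_disc_continuous af.
have pi2 : 0 <= pi *+ 2 :> R by rewrite mulrn_wge0// pi_ge0.
set c := f zeta * _.
pose J t := seg 0 (pi *+ 2) (fun x => f (H t x) * ker x).
have cJ t : 0 <= t <= 1 -> seg_continuous 0 (pi *+ 2) (fun x => f (H t x) * ker x).
  by move=> tI; apply: seg_continuousM; [exact: H_continuous_x|exact: ker_continuous].
have J1 tau : 0 < tau <= 1 -> J 1 = J tau.
  move=> /andP[tau0 tau1]; have := Lam_eq0 af tau0 tau1 pi2.
  have E2 : E (pi *+ 2) = E 0 by rewrite /E circ_2pi /circ cos0 sin0.
  rewrite /Lam [seg tau 1 _](@eq_seg _ _ _ _ (fun=> 0)); last first.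
    by move=> t _; rewrite /rays /H E2 subrr mul0r.
  rewrite seg_cst// mulr0 subr0 => /eqP.
  rewrite mulf_eq0 -modulus_eq0 modulus_i oner_eq0 /= => /eqP A0.
  apply/eqP; rewrite -subr_eq0 -A0; apply/eqP; rewrite /J.
  rewrite -[- seg _ _ _]mulN1r -segZ; last first.
    by apply: cJ; rewrite tau1 ltW.
  rewrite -segD.
  - by apply: eq_seg => x _; rewrite /arcs; ring.
  - by apply: cJ; rewrite ler01 lexx.
  - by apply: seg_continuousM; [exact: seg_continuous_cst|
      apply: cJ; rewrite tau1 ltW].
have -> : seg 0 (pi *+ 2) (fun x => f (E x) * ker x) = J 1.
  by apply: eq_seg => x _; rewrite /H mul1r addrC subrK.
apply/eqP; rewrite -subr_eq0 -modulus_eq0 eq_le modulus_ge0 andbT.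
apply/ler_addgt0Pl => e e0; rewrite addr0.
have dz : disc zeta by rewrite /disc /= (lt_trans zeta_r).
pose P : R := m^-1 * (pi *+ 2) + 1.
have P0 : 0 < P by rewrite ltr_wpDl// mulr_ge0// invr_ge0 ltW.
have [d d0 D] := cf _ dz (e / P) (divr_gt0 e0 P0).
pose tau := Num.min 1 (d / 4).
have tau0 : 0 < tau by rewrite lt_min ltr01 divr_gt0.
have tau1 : tau <= 1 by rewrite ge_min lexx.
have taud : tau <= d / 4 by rewrite ge_min lexx orbT.
have tauI : 0 <= tau <= 1 by rewrite tau1 ltW.
rewrite (J1 tau) ?tau0// /J /c.
rewrite -mulNr -segZ; last exact: ker_continuous.
rewrite -segD; [|exact: cJ|apply: seg_continuousM; [exact: seg_continuous_cst|
  exact: ker_continuous]].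
have le_e : e / P * m^-1 * (pi *+ 2 - 0) <= e.
  rewrite subr0 -mulrA -[leRHS]mulr1 -[leLHS]mulrA ler_pM2l// mulrC.
  by rewrite ler_pdivrMr// mul1r lerDl.
apply: le_trans le_e; apply: seg_le => //.
  apply: seg_continuousD; first exact: cJ.
  by apply: seg_continuousM; [exact: seg_continuous_cst|exact: ker_continuous].
move=> x _; rewrite -mulrDl modulusM ler_pM ?modulus_ge0//.
apply: D; first exact: H_disc.
rewrite /H addrC addKr modulusM modulus_real ger0_norm ?(ltW tau0)//.
have := E_sub2 x; have := modulus_ge0 (E x - zeta) => h1 h2.
apply: (@le_lt_trans _ _ (d / 4 * 2)); last by lra.
by rewrite ler_pM// ltW.
Qed.

Let w x := zeta / r%:C * conjc (circ x).

Let wE x : w x = zeta / E x.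
Proof. by rewrite /w /E -circ_inv invfM mulrA. Qed.

Let mod_w x : modulus (w x) = modulus zeta / r.
Proof. by rewrite wE modulusM modulusV modE. Qed.

Let circ_continuous a b n : seg_continuous a b (fun x => conjc (circ x) ^+ n).
Proof.
elim: n => [|n IH]; first exact: seg_continuous_cst.
under eq_fun do rewrite exprS; apply: seg_continuousM IH.
apply: (@seg_continuous_lipschitz _ _ _ _ 2) => x y _ _.
by rewrite -(rmorphB conjc) modulus_conj circ_lipschitz.
Qed.

Let ker_expansion x N :
  ker x = \sum_(n < N) w x ^+ n + w x ^+ N * ker x.
Proof.
have w1 : ker x * (1 - w x) = 1.
  by rewrite /ker wE; field; rewrite E_neq0 E_sub_neq0.
elim: N => [|N IH]; first by rewrite big_ord0 expr0 mul1r add0r.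
rewrite big_ord_recr /= -addrA {1}IH; congr (_ + _).
rewrite -[X in _ = X + _]mulr1 -w1 exprSr; ring.
Qed.

(** [ker x] is the sum of the geometric series with ratio [w x]; the remainder
    is explicit, so the integral can be taken term by term. *)
Lemma seg_ker_expansion (g : R -> R[i]) M N : 0 <= M ->
  seg_continuous 0 (pi *+ 2) g ->
  (forall x, 0 <= x <= pi *+ 2 -> modulus (g x) <= M) ->
  modulus (seg 0 (pi *+ 2) (fun x => g x * ker x) -
    \sum_(n < N) (zeta / r%:C) ^+ n *
      seg 0 (pi *+ 2) (fun x => g x * conjc (circ x) ^+ n)) <=
  (modulus zeta / r) ^+ N * (M * m^-1 * (pi *+ 2)).
Proof.
move=> M0 cg gM; have pi2 : 0 <= pi *+ 2 :> R by rewrite mulrn_wge0// pi_ge0.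
pose S K x := \sum_(n < K) w x ^+ n.
have cwX n : seg_continuous 0 (pi *+ 2) (fun x => w x ^+ n).
  rewrite (_ : (fun _ => _) =
      fun x => (zeta / r%:C) ^+ n * conjc (circ x) ^+ n); last first.
    by apply/funext => x; rewrite /w exprMn.
  by apply: seg_continuousM; [exact: seg_continuous_cst|exact: circ_continuous].
have cS K : seg_continuous 0 (pi *+ 2) (S K).
  elim: K => [|K IH].
    by rewrite /S; under eq_fun do rewrite big_ord0; exact: seg_continuous_cst.
  by rewrite /S; under eq_fun do rewrite big_ord_recr; exact: seg_continuousD.
have -> : \sum_(n < N) (zeta / r%:C) ^+ n *
      seg 0 (pi *+ 2) (fun x => g x * conjc (circ x) ^+ n) =
    seg 0 (pi *+ 2) (fun x => g x * S N x).
  elim: (N) => [|K IH].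
    rewrite big_ord0 (@eq_seg _ _ _ _ (fun=> 0)) ?seg_cst ?mulr0//.
    by move=> x _; rewrite /S big_ord0 mulr0.
  rewrite big_ord_recr /= IH -segZ; last first.
    by apply: seg_continuousM => //; exact: circ_continuous.
  rewrite -segD; first last.
  - apply: seg_continuousM; first exact: seg_continuous_cst.
    by apply: seg_continuousM => //; exact: circ_continuous.
  - exact: seg_continuousM.
  apply: eq_seg => x _; rewrite /S big_ord_recr /= mulrDr; congr (_ + _).
  by rewrite /w [in RHS]exprMn; ring.
rewrite -[- seg _ _ _]mulN1r -segZ; last exact: seg_continuousM.
rewrite -segD; first last.
- by apply: seg_continuousM; [exact: seg_continuous_cst|exact: seg_continuousM].
- by apply: seg_continuousM => //; exact: ker_continuous.
rewrite (@eq_seg _ _ _ _ (fun x => g x * (w x ^+ N * ker x))); last first.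
  by move=> x _; rewrite {1}(ker_expansion x N) -/(S N x); ring.
rewrite [leRHS](_ : _ = (M * ((modulus zeta / r) ^+ N * m^-1)) * (pi *+ 2 - 0));
  last by rewrite subr0; ring.
apply: seg_le => //.
  by do 2 apply: seg_continuousM => //; exact: ker_continuous.
move=> x xI; rewrite modulusM ler_pM ?modulus_ge0// ?gM//.
by rewrite modulusM modulusX mod_w ler_wpM2l// exprn_ge0// mulr_ge0//
  ?modulus_ge0// invr_ge0 ltW.
Qed.

Let geom0 C e : 0 < e -> exists n0, forall N, (n0 <= N)%N ->
  (modulus zeta / r) ^+ N * C <= e.
Proof.
move=> e0; set q := modulus zeta / r.
have q0 : 0 <= q by rewrite mulr_ge0 ?modulus_ge0// invr_ge0 ltW.
have /cvgrPdist_le/(_ _ e0)[n0 _ Hn] : geometric C q @ \oo --> 0.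
  by apply: cvg_geometric; rewrite ger0_norm// ltr_pdivrMr// mul1r.
exists n0 => N /Hn; rewrite /= sub0r normrN => /(le_trans (ler_norm _)).
by rewrite mulrC.
Qed.

(** Only the constant term of the geometric series has a nonzero integral. *)
Lemma seg_ker : seg 0 (pi *+ 2) ker = (pi *+ 2)%:C.
Proof.
have pi2 : 0 <= pi *+ 2 :> R by rewrite mulrn_wge0// pi_ge0.
have c1 := @seg_continuous_cst R 0 (pi *+ 2) 1.
have K N := @seg_ker_expansion (fun=> 1) 1 N ler01 c1.
have sX n : seg 0 (pi *+ 2) (fun x => 1 * conjc (circ x) ^+ n.+1) = 0.
  rewrite (@eq_seg _ _ _ _ (fun x => conjc (circ x ^+ n.+1))); last first.
    by move=> x _; rewrite mul1r rmorphXn.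
  have cX : seg_continuous 0 (pi *+ 2) (fun x => circ x ^+ n.+1).
    rewrite (_ : (fun _ => _) = fun x => circ (x *+ n.+1)); last first.
      by apply/funext => x; rewrite circ_expr.
    apply: (@seg_continuous_lipschitz _ _ _ _ (2 * n.+1%:R)) => x y _ _.
    apply: le_trans (circ_lipschitz _ _) _.
    by rewrite -mulrnBl normrMn -[X in _ * X <= _]mulr_natr mulrA mulrAC.
  rewrite /seg cint_conj//; last exact: seg_continuous_integrable.
  by rewrite -/(seg _ _ _) seg_circX conjc0.
apply/eqP; rewrite -subr_eq0 -modulus_eq0 eq_le modulus_ge0 andbT.
apply/ler_addgt0Pl => e e0; rewrite addr0.
have [n0 Hn] := geom0 (1 * m^-1 * (pi *+ 2)) e0.
have m1 (x : R) (_ : 0 <= x <= pi *+ 2) : modulus (1 : R[i]) <= 1 by rewrite modulus1.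
have := K n0.+1 m1; rewrite big_ord_recl big1 => [|i _]; last first.
  by rewrite sX mulr0.
rewrite addr0 expr0 mul1r (@eq_seg _ _ _ (fun x => 1 * ker x) ker); last first.
  by move=> x _; rewrite mul1r.
rewrite (@eq_seg _ _ _ (fun x => 1 * _) (fun=> 1)); last first.
  by move=> x _; rewrite expr0 mulr1.
rewrite seg_cst// subr0 mulr1 => /le_trans; apply.
exact: Hn.
Qed.

Definition cauchy_coef f n : R[i] := (pi *+ 2)%:C^-1 * r%:C ^- n *
  seg 0 (pi *+ 2) (fun x => f (r%:C * circ x) * conjc (circ x) ^+ n).

Lemma cauchy_series f : analytic_on_disc f -> forall e, 0 < e ->
  exists n0, forall N, (n0 <= N)%N ->
    modulus (\sum_(n < N) cauchy_coef f n * zeta ^+ n - f zeta) <= e.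
Proof.
move=> af e e0; have cf := analytic_disc_continuous af.
have pi20 : 0 < pi *+ 2 :> R by rewrite pmulrn_rgt0// pi_gt0.
have E_H x : E x = H 1 x by rewrite /H mul1r addrC subrK.
have I1 : 0 <= (1 : R) <= 1 by rewrite ler01 lexx.
have cE : seg_continuous 0 (pi *+ 2) (fun x => f (E x)).
  by under eq_fun do rewrite E_H; exact: H_continuous_x.
have [M M0 fM] := seg_continuous_bounded cE.
set P := (pi *+ 2)%:C : R[i].
have P0 : P != 0 by rewrite (inj_eq (@complexI R)) gt_eqF.
have [n0 Hn] := geom0 (M * m^-1 * (pi *+ 2)) (mulr_gt0 e0 pi20).
exists n0 => N nN; have := seg_ker_expansion N M0 cE fM.
rewrite cauchy_formula// seg_ker -/P => /le_trans/(_ (Hn _ nN)).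
rewrite -ler_pdivrMr// -[leLHS]mulrC.
have -> : (pi *+ 2)^-1 = modulus (- P^-1).
  by rewrite modulusN modulusV modulus_real ger0_norm// ltW.
rewrite -modulusM; congr (modulus _ <= e).
rewrite mulrBr mulNr mulrCA mulVf// mulr1 mulNr opprK addrC; congr (_ + _).
rewrite mulr_sumr; apply: eq_bigr => i _; rewrite /cauchy_coef -/P.
by rewrite exprMn exprVn; ring.
Qed.

End CauchyFormula.

(** * Power series on the disc *)

Section PowerSeries.
Context {R : realType}.
Implicit Types (a b : nat -> R[i]) (z s : R[i]) (f : R[i] -> R[i]) (rho e : R).

Definition pseries_sum a z s := forall e, 0 < e -> exists n0, forall N,
  (n0 <= N)%N -> modulus (\sum_(n < N) a n * z ^+ n - s) <= e.

Lemma taylor_expansionP f a :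
  taylor_expansion f a <-> forall z, disc z -> pseries_sum a z (f z).
Proof.
split=> h z dz; have := h z dz.
  move=> /cvg_modulusP h' e e0; have [n0 H] := h' e e0; exists n0 => N /H.
  by rewrite /series /= big_mkord.
move=> h'; apply/cvg_modulusP => e e0; have [n0 H] := h' e e0; exists n0 => N /H.
by rewrite /series /= big_mkord.
Qed.

Lemma pseries_sumB a b z s t : pseries_sum a z s -> pseries_sum b z t ->
  pseries_sum (fun n => a n - b n) z (s - t).
Proof.
move=> ha hb e e0; have e20 : 0 < e / 2 by rewrite divr_gt0.
have [n1 H1] := ha _ e20; have [n2 H2] := hb _ e20.
exists (maxn n1 n2) => N; rewrite geq_max => /andP[/H1 h1 /H2 h2].
rewrite (eq_bigr (fun n : 'I_N => a n * z ^+ n - b n * z ^+ n)); last first.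
  by move=> i _; rewrite mulrBl.
rewrite sumrB [leRHS](splitr e).
set A := \sum_(n < N) a n * _; set B := \sum_(n < N) b n * _.
have -> : A - B - (s - t) = (A - s) - (B - t) by ring.
by apply: le_trans (modulusBD _ _) _; apply: lerD.
Qed.

Lemma pseries_coef_bound a z s : pseries_sum a z s ->
  exists2 C, 0 <= C & forall n, modulus (a n) * modulus z ^+ n <= C.
Proof.
move=> h; have [n0 H] := h 1 ltr01.
pose C : R := 2 + \sum_(n < n0) modulus (a n) * modulus z ^+ n.
have S0 : 0 <= \sum_(n < n0) modulus (a n) * modulus z ^+ n.
  by apply: sumr_ge0 => i _; rewrite mulr_ge0 ?exprn_ge0 ?modulus_ge0.
exists C => [|n]; first by rewrite addr_ge0.
have [n0n|nn0] := leqP n0 n.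
  have := H n.+1 (leqW n0n); rewrite big_ord_recr /= => h1.
  have h2 := H n n0n; rewrite -modulusX -modulusM.
  rewrite (_ : a n * z ^+ n = (\sum_(i < n) a i * z ^+ i + a n * z ^+ n - s) -
    (\sum_(i < n) a i * z ^+ i - s)); last by ring.
  apply: le_trans (modulusBD _ _) _; apply: (@le_trans _ _ 2).
    by rewrite -[2]/(1 + 1) lerD.
  by rewrite lerDl.
rewrite /C (bigD1 (Ordinal nn0)) //= addrCA lerDl addr_ge0//.
by apply: sumr_ge0 => i _; rewrite mulr_ge0 ?exprn_ge0 ?modulus_ge0.
Qed.

Lemma sum_expr_le rho N : 0 <= rho -> rho <= 1 / 2 ->
  \sum_(n < N) rho ^+ n <= 2.
Proof.
move=> rho0 rho2; have := subrX1 rho N => E.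
have r1 : 0 < 1 - rho by move: rho2; lra.
rewrite -(ler_pM2l r1); apply: (@le_trans _ _ 1); last by move: rho2; lra.
have -> : (1 - rho) * \sum_(n < N) rho ^+ n = 1 - rho ^+ N.
  by rewrite -opprB mulNr -E opprB.
by rewrite lerBlDl lerDr exprn_ge0.
Qed.

(** The first nonzero coefficient would dominate the series near the origin. *)
Lemma pseries_eq0 a rho : 0 < rho ->
  (forall z, modulus z < rho -> pseries_sum a z 0) -> forall n, a n = 0.
Proof.
move=> rho0 h n; elim/ltn_ind: n => n IH; pose z0 : R[i] := (rho / 2)%:C.
have q0 : 0 < rho / 2 by rewrite divr_gt0.
have mz0 : modulus z0 = rho / 2 by rewrite modulus_real gtr0_norm.
have [|C C0] := @pseries_coef_bound a z0 0 (h _ _).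
  by rewrite mz0; lra.
rewrite mz0 => HC; set q := rho / 2 in q0 mz0 HC.
apply/eqP; rewrite -modulus_eq0 eq_le modulus_ge0 andbT.
apply/ler_addgt0Pl => e e0; rewrite addr0.
pose D := C / q ^+ n.+1 * 2 + 1.
have D0 : 0 < D by rewrite ltr_wpDl// !mulr_ge0// invr_ge0 exprn_ge0// ltW.
pose t := Num.min (q / 2) (e / 2 / D).
have t0 : 0 < t by rewrite lt_min !divr_gt0.
have tq : t <= q / 2 by rewrite ge_min lexx.
have te : t <= e / 2 / D by rewrite ge_min lexx orbT.
have mt : modulus (t%:C : R[i]) = t by rewrite modulus_real gtr0_norm.
have tr : modulus (t%:C : R[i]) < rho by rewrite mt (le_lt_trans tq)// /q; lra.
have et : 0 < e / 2 * t ^+ n by rewrite mulr_gt0 ?exprn_gt0// divr_gt0.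
have [n0 Hn] := h _ tr _ et.
have := Hn (n.+1 + n0)%N (leq_addl _ _); rewrite subr0.
rewrite big_split_ord /= big_ord_recr /= big1 ?add0r; last first.
  by move=> i _; rewrite IH// mul0r.
set S := \sum_(i < n0) _ => hS.
have HS : modulus S <= t ^+ n.+1 * (C / q ^+ n.+1 * 2).
  apply: le_trans (modulus_sum _ _ _) _.
  apply: (@le_trans _ _ (\sum_(i < n0) t ^+ n.+1 * (C / q ^+ n.+1) * (t / q) ^+ i)).
    apply: ler_sum => i _; rewrite modulusM modulusX mt.
    rewrite [leRHS](_ : _ = t ^+ (n.+1 + i) * (C / q ^+ (n.+1 + i))); last first.
      by rewrite (expr_div_n t q i) (exprD t) (exprD q) invfM; ring.
    by rewrite mulrC ler_pM2l ?exprn_gt0// ler_pdivlMr ?exprn_gt0.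
  rewrite -mulr_sumr !mulrA ler_wpM2l ?sum_expr_le//.
  - by rewrite !mulr_ge0 ?invr_ge0 ?exprn_ge0// ltW.
  - by rewrite divr_ge0// ltW.
  - by rewrite ler_pdivrMr// mul1r mulrC.
have : modulus (a n) * t ^+ n <= e / 2 * t ^+ n + t ^+ n.+1 * (C / q ^+ n.+1 * 2).
  rewrite [leLHS](_ : _ = modulus (a n * t%:C ^+ n + S - S)); last first.
    by rewrite addrK modulusM modulusX mt.
  by apply: le_trans (modulusBD _ _) _; apply: lerD.
rewrite exprSr -[X in _ + X]mulrA [X in _ + X]mulrC -mulrDl ler_pM2r ?exprn_gt0//.
move=> /le_trans; apply; rewrite [leRHS](splitr e) lerD2l.
move: te; rewrite ler_pdivlMr// /D mulrDr mulr1 => te'.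
by apply: le_trans te'; rewrite lerDl ltW.
Qed.

(** Cauchy's formula on the circle of radius [r] gives a power series for
    [|z| < r]; by uniqueness the coefficients do not depend on [r]. *)
Theorem analytic_taylor f :
  analytic_on_disc f -> exists a, taylor_expansion f a.
Proof.
move=> af; exists (cauchy_coef 2^-1 f); apply/taylor_expansionP => z dz.
pose r := (1 + modulus z) / 2.
have dz' : modulus z < 1 by exact: dz.
have z0 := modulus_ge0 z.
have r1 : r < 1 by rewrite /r; lra.
have zr : modulus z < r by rewrite /r; lra.
have r2 : 2^-1 <= r by rewrite /r; lra.
suff <- : cauchy_coef r f = cauchy_coef 2^-1 f.
  by move=> e e0; exact: cauchy_series.
have h2 : 0 < (2^-1 : R) by rewrite invr_gt0.
apply/funext => n; apply/eqP; rewrite -subr_eq0; apply/eqP.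
apply: (@pseries_eq0 (fun k => cauchy_coef r f k - cauchy_coef 2^-1 f k) _ h2).
move=> w w2; rewrite -(subrr (f w)); apply: pseries_sumB => e e0.
  by apply: cauchy_series => //; exact: lt_le_trans r2.
by apply: cauchy_series => //; rewrite invf_lt1// ltr1n.
Qed.

End PowerSeries.

(** * Area integrals over discs *)

Notation pt := Defs.point.

Section Moments.
Context {R : realType}.
Local Notation T2 := (measurableTypeR R * measurableTypeR R)%type.
Local Notation mu := (@lebesgue_measure R).
Local Notation nu := ((mu \x mu)%E : {measure set T2 -> \bar R}).
Implicit Types (rho : R) (i j : nat) (w : T2).

Definition rdisc rho : set T2 := [set w | modulus (pt w) < rho].

Lemma cmeasurable_pt (D : set T2) : cmeasurable D (@Defs.point R).
Proof.
split; rewrite /Defs.point /=.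
  by apply: measurable_funTS; exact: measurable_fst.
by apply: measurable_funTS; exact: measurable_snd.
Qed.

Lemma measurable_rdisc rho : measurable (rdisc rho).
Proof.
have := measurable_modulus (cmeasurable_pt setT).
move=> /(_ measurableT _ (measurable_itv `]-oo, rho[)); rewrite setTI.
by congr measurable; apply/seteqP; split => w /=; rewrite in_itv.
Qed.
Hint Resolve measurable_rdisc : core.

Lemma nu_rdisc rho : (nu (rdisc rho) < +oo)%E.
Proof.
apply: (@le_lt_trans _ _ (nu ([set` `[- rho, rho]%R] `*` [set` `[- rho, rho]%R]))).
  apply: le_measure; rewrite ?inE//.
    by apply: measurableX; exact: measurable_itv.
  move=> w /= wr; rewrite !in_itv /=; split; rewrite -ler_norml.
    exact: le_trans (normr_Re_le (pt w)) (ltW wr).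
  exact: le_trans (normr_Im_le (pt w)) (ltW wr).
set A := [set` `[- rho, rho]%R].
rewrite (_ : nu _ = mu A * mu A)%E; last first.
  by apply: product_measure1E; exact: measurable_itv.
rewrite /A.
by rewrite lebesgue_measure_itv /=; case: ifP => _; rewrite ?mul0e// -EFinM ltry.
Qed.

Lemma sigma_rdisc rho : (sigma (rdisc rho) < +oo)%E.
Proof.
by rewrite /sigma /mscale /=; apply: lte_mul_pinfty => //; exact: nu_rdisc.
Qed.

Lemma seg_poly (P : {poly R[i]}) (a b : R) : a <= b ->
  [/\ seg_continuous a b (fun x => P.[x%:C]),
      seg_continuous a b (fun x => P^`().[x%:C]) &
      seg a b (fun x => P^`().[x%:C]) = P.[b%:C] - P.[a%:C]].
Proof.
move=> ab.
have c1 : seg_continuous a b (fun x => x%:C).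
  apply: (@seg_continuous_lipschitz _ _ _ _ 1) => x y _ _.
  by rewrite -rmorphB modulus_real mul1r.
have cX n : seg_continuous a b (fun x => x%:C ^+ n).
  elim: n => [|n IH]; first exact: seg_continuous_cst.
  by under eq_fun do rewrite exprS; exact: seg_continuousM.
have cP (Q : {poly R[i]}) : seg_continuous a b (fun x => Q.[x%:C]).
  elim/poly_ind: Q => [|Q c IH].
    by under eq_fun do rewrite horner0; exact: seg_continuous_cst.
  under eq_fun do rewrite hornerMXaddC.
  by apply: seg_continuousD; [exact: seg_continuousM|exact: seg_continuous_cst].
split=> //.
have dX n : seg a b (fun x => n.+1%:R * x%:C ^+ n) = b%:C ^+ n.+1 - a%:C ^+ n.+1.
  have D (x : R) : is_derive x 1 (fun y : R => y ^+ n.+1) (n.+1%:R * x ^+ n).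
    have H : is_derive x 1 ((id : R -> R) ^+ n.+1) ((n.+1%:R * x ^+ n) *: 1).
      exact: is_deriveX.
    by move: H; rewrite /GRing.scale /= mulr1; congr is_derive;
      apply/funext => y; elim: n.+1 => // k IH; rewrite !exprS -IH.
  have cD : continuous (fun x : R => n.+1%:R * x ^+ n).
    by move=> x; apply: cvgM; [exact: cvg_cst|exact: exprn_continuous].
  have E x : n.+1%:R * x%:C ^+ n = (n.+1%:R * x ^+ n)%:C :> R[i].
    by rewrite rmorphM rmorph_nat rmorphXn.
  rewrite -!rmorphXn -rmorphB /=; apply: complex_eqP => /=.
    rewrite -(Rintegral_FTC ab D cD).
    by apply: eq_Rintegral => x _; rewrite E.
  transitivity (\int[mu]_(x in `[a, b]) (0 : R)).
    by apply: eq_Rintegral => x _; rewrite E.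
  by rewrite Rintegral_cst// mul0r.
pose good (Q : {poly R[i]}) :=
  seg a b (fun x => Q^`().[x%:C]) = Q.[b%:C] - Q.[a%:C].
rewrite -/(good P) -[P]coefK poly_def.
elim/big_rec: _ => [|i Q _ IH]; rewrite /good.
  rewrite (@eq_seg _ _ _ _ (fun=> 0)) ?seg_cst// ?horner0 ?mulr0 ?subrr//.
  by move=> x _; rewrite linear0 horner0.
rewrite (@eq_seg _ _ _ _ (fun x => P`_i * ('X^i)^`().[x%:C] + Q^`().[x%:C]));
  last by move=> x _; rewrite derivD hornerD derivZ hornerZ.
have cXi := cP ('X^i)^`(); have cQ := cP Q^`().
rewrite segD//; last by apply: seg_continuousM => //; exact: seg_continuous_cst.
rewrite segZ// IH !hornerD !hornerZ !hornerXn.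
suff -> : seg a b (fun x => ('X^i)^`().[x%:C]) = b%:C ^+ i - a%:C ^+ i by ring.
case: (nat_of_ord i) => [|n].
  rewrite !expr0 subrr (@eq_seg _ _ _ _ (fun=> 0)) ?seg_cst// ?mulr0//.
  by move=> x _; rewrite -polyC1 derivC horner0.
rewrite -dX; apply: eq_seg => x _.
by rewrite derivXn /= hornerMn hornerXn mulr_natl.
Qed.

Let rdisc_sections rho y : exists s : R, 0 <= s /\ (forall x, x ^+ 2 + y ^+ 2 < rho ^+ 2 <-> - s < x < s) /\
  (0 < s -> s ^+ 2 + y ^+ 2 = rho ^+ 2).
Proof.
exists (Num.sqrt (rho ^+ 2 - y ^+ 2)); split; first exact: sqrtr_ge0.
split=> [x|]; last by rewrite sqrtr_gt0 => /ltW h; rewrite sqr_sqrtr// subrK.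
have [h|h] := lerP (rho ^+ 2 - y ^+ 2) 0.
  rewrite ler0_sqrtr// oppr0; split=> [|/andP[]]; last by move=> /lt_trans h' /h'; rewrite ltxx.
  by have := sqr_ge0 x; move: h; lra.
rewrite -ltr_norml -[in X in _ <-> X]ltr_sqr ?nnegrE ?sqrtr_ge0//.
by rewrite sqr_sqrtr ?(ltW h)// real_normK ?num_real// ltrBrDr.
Qed.

Let in_rdiscP rho w : 0 <= rho -> rdisc rho w <-> w.1 ^+ 2 + w.2 ^+ 2 < rho ^+ 2.
Proof.
move=> rho0; rewrite /rdisc /= -ltr_sqr ?nnegrE ?modulus_ge0//.
by rewrite sqr_modulus.
Qed.

Lemma bounded_cintegrable (m : {measure set T2 -> \bar R}) D (u : T2 -> R[i]) M :
  measurable D -> (m D < +oo)%E -> cmeasurable D u ->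
  (forall w, D w -> modulus (u w) <= M) -> cintegrable m D u.
Proof.
move=> mD mDoo mu uM; apply: (@cintegrable_le _ _ _ _ _ _ (fun=> M)) => //.
apply/integrableP; split; first exact: measurable_cst.
by rewrite /comp integral_cst//= lte_mul_pinfty.
Qed.

Let chord rho (y : R) : set R := [set x | x ^+ 2 + y ^+ 2 < rho ^+ 2].

Let chord_zero rho (y : R) (h : R -> R) :
  (forall s : R, 0 < s -> s ^+ 2 + y ^+ 2 = rho ^+ 2 ->
     mu.-integrable `[- s, s] (EFin \o h) /\
     \int[mu]_(x in `[- s, s]) h x = 0) ->
  (\int[mu]_x ((EFin \o h) \_ (chord rho y)) x = 0)%E.
Proof.
move=> h0; have [s [s0 [hs ss]]] := rdisc_sections rho y.
rewrite -integral_mkcond.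
have -> : chord rho y = [set` `]- s, s[].
  by apply/seteqP; split => x /=; rewrite in_itv /=; apply hs.
have [s00|sN] := ltP 0 s; last first.
  rewrite set_itv_ge ?integral_set0// bnd_simp -leNgt.
  by rewrite (le_trans sN)// oppr_ge0.
have [ih ih0] := h0 s s00 (ss s00).
have mh : measurable_fun `]- s, s[ (EFin \o h).
  apply: measurable_funS (measurable_int mu ih) => //.
  exact: subset_itv_oo_cc.
rewrite -(@integral_itv_bndoo _ _ _ _ true false mh).
rewrite -[LHS]fineK ?integrable_fin_num//; congr (_%:E); exact: ih0.
Qed.

(** A function on the disc whose integrals over all horizontal (or all vertical)
    chords vanish has integral zero, by Fubini. *)
Let chords_zero rho (h : T2 -> R) (vert : bool) : 0 <= rho ->
  nu.-integrable (rdisc rho) (EFin \o h) ->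
  (forall y s : R, 0 < s -> s ^+ 2 + y ^+ 2 = rho ^+ 2 ->
     let h1 x := if vert then h (y, x) else h (x, y) in
     mu.-integrable `[- s, s] (EFin \o h1) /\
     \int[mu]_(x in `[- s, s]) h1 x = 0) ->
  \int[nu]_(w in rdisc rho) h w = 0.
Proof.
move=> rho0 ih h0; rewrite /Rintegral.
pose g := ((EFin \o h) \_ (rdisc rho) : T2 -> \bar R).
have ig : nu.-integrable setT g by rewrite /g -integrable_mkcond.
have -> : (\int[nu]_(w in rdisc rho) (h w)%:E = 0)%E; last by [].
rewrite integral_mkcond; case: vert h0 => h0.
  rewrite -[LHS](integral12_prod_meas1 ig) integral0_eq// => y _.
  rewrite /fubini_F -[RHS](chord_zero (h0 y)); apply: eq_integral => x _.
  rewrite /g !patchE; congr (if _ then _ else _).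
  by apply/idP/idP; rewrite !inE in_rdiscP//= addrC.
rewrite -[LHS](integral21_prod_meas1 ig) integral0_eq// => y _.
rewrite /fubini_G -[RHS](chord_zero (h0 y)); apply: eq_integral => x _.
rewrite /g !patchE; congr (if _ then _ else _).
by apply/idP/idP; rewrite !inE in_rdiscP.
Qed.

(** The integral over the disc of a derivative along the chords vanishes when
    the primitive vanishes at the endpoints. *)
Let green rho (u : T2 -> R[i]) (vert : bool) : 0 <= rho ->
  cintegrable nu (rdisc rho) u ->
  (forall y : R, exists P : {poly R[i]},
     (forall x, (if vert then u (y, x) else u (x, y)) = P^`().[x%:C]) /\
     (forall s : R, s ^+ 2 + y ^+ 2 = rho ^+ 2 -> P.[s%:C] = 0)) ->
  cint nu (rdisc rho) u = 0.
Proof.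
move=> rho0 [iu1 iu2] H.
have K y s : 0 < s -> s ^+ 2 + y ^+ 2 = rho ^+ 2 ->
    let u1 x := if vert then u (y, x) else u (x, y) in
    cintegrable mu `[- s, s] u1 /\ seg (- s) s u1 = 0.
  move=> s0 sy u1; have [P [uP P0]] := H y.
  have ss : - s <= s by rewrite ge0_cp// ltW.
  have [_ cP' IP] := seg_poly P ss.
  have -> : u1 = fun x => P^`().[x%:C] by apply/funext => x; rewrite -uP.
  split; first exact: seg_continuous_integrable.
  by rewrite IP !P0 ?subrr// sqrrN.
apply: complex_eqP; apply: (@chords_zero _ _ vert) => // y s s0 sy.
  have [[i1 _] e] := K y s s0 sy.
  split; first by apply: eq_integrable i1 => // x _; case: (vert).
  have /(f_equal (@complex.Re R)) := e; rewrite /seg /cint /= => <-.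
  by apply: eq_Rintegral => x _; case: (vert).
have [[_ i1] e] := K y s s0 sy.
split; first by apply: eq_integrable i1 => // x _; case: (vert).
have /(f_equal (@complex.Im R)) := e; rewrite /seg /cint /= => <-.
by apply: eq_Rintegral => x _; case: (vert).
Qed.

Definition cbounded (D : set T2) (u : T2 -> R[i]) :=
  cmeasurable D u /\ exists M, forall w, D w -> modulus (u w) <= M.

Lemma cboundedD D u v :
  cbounded D u -> cbounded D v -> cbounded D (fun w => u w + v w).
Proof.
move=> [mu1 [M uM]] [mv [N vN]]; split; first exact: cmeasurableD.
by exists (M + N) => w Dw; rewrite modulusD_le ?uM ?vN.
Qed.

Lemma cboundedM D u v :
  cbounded D u -> cbounded D v -> cbounded D (fun w => u w * v w).
Proof.
move=> [mu1 [M uM]] [mv [N vN]]; split; first exact: cmeasurableM.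
by exists (M * N) => w Dw; rewrite modulusM ler_pM ?modulus_ge0 ?uM ?vN.
Qed.

Lemma cbounded_cst D c : cbounded D (fun=> c).
Proof. by split; [exact: cmeasurable_cst|exists (modulus c)]. Qed.

Lemma cboundedN D u : cbounded D u -> cbounded D (fun w => - u w).
Proof.
by move=> bu; have := cboundedM (cbounded_cst D (-1)) bu; under eq_fun do rewrite mulN1r.
Qed.

Lemma cboundedX D u n : cbounded D u -> cbounded D (fun w => u w ^+ n).
Proof.
move=> bu; elim: n => [|n IH]; first exact: cbounded_cst.
by under eq_fun do rewrite exprS; exact: cboundedM.
Qed.

Lemma cbounded_conj D u : cbounded D u -> cbounded D (fun w => conjc (u w)).
Proof.
move=> [mu1 [M uM]]; split; first exact: cmeasurable_conj.
by exists M => w Dw; rewrite modulus_conj uM.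
Qed.

Lemma cbounded_sum D n (u : nat -> T2 -> R[i]) : (forall i, cbounded D (u i)) ->
  cbounded D (fun w => \sum_(i < n) u i w).
Proof.
move=> bu; elim: n => [|n IH].
  by under eq_fun do rewrite big_ord0; exact: cbounded_cst.
by under eq_fun do rewrite big_ord_recr; exact: cboundedD.
Qed.

Lemma cbounded_pt rho : cbounded (rdisc rho) (@Defs.point R).
Proof.
split; first exact: cmeasurable_pt.
by exists rho => w; exact: ltW.
Qed.

Lemma cbounded_cintegrable (m : {measure set T2 -> \bar R}) D u :
  measurable D -> (m D < +oo)%E -> cbounded D u -> cintegrable m D u.
Proof. by move=> mD Doo [mu1 [M uM]]; exact: bounded_cintegrable uM. Qed.

(** The derivative of [z^i zb^j (rho^2 - z zb)] in a direction in which [z]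
    has derivative [a] and [zb] has derivative [b]: [a = b = 1] for the first
    coordinate, [a = 'i] and [b = - 'i] for the second. *)
Let G rho i j (a b z zb : R[i]) : R[i] :=
  a * (i%:R * z ^+ i.-1 * zb ^+ j * ((rho ^+ 2)%:C - z * zb)) +
  b * (j%:R * z ^+ i * zb ^+ j.-1 * ((rho ^+ 2)%:C - z * zb)) -
  z ^+ i * zb ^+ j * (a * zb + b * z).

Let deriv_G rho i j (A B : {poly R[i]}) a b x :
  A^`() = a%:P -> B^`() = b%:P ->
  (A ^+ i * B ^+ j * ((rho ^+ 2)%:C%:P - A * B))^`().[x] =
  G rho i j a b A.[x] B.[x].
Proof.
move=> dA dB.
have dX (C : {poly R[i]}) c n : C^`() = c%:P ->
    (C ^+ n)^`().[x] = n%:R * c * C.[x] ^+ n.-1.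
  by move=> dC; rewrite deriv_exp dC hornerMn hornerM hornerC horner_exp
    -mulrA mulr_natl.
rewrite !derivM derivB derivC derivM.
rewrite !(hornerD, hornerM, hornerN) (dX _ _ _ dA) (dX _ _ _ dB) dA dB.
by rewrite !horner_exp !hornerC /G; ring.
Qed.

Let cboundedG rho i j a b :
  cbounded (rdisc rho) (fun w => G rho i j a b (pt w) (conjc (pt w))).
Proof.
have b1 := cbounded_pt rho; have b2 := cbounded_conj b1.
have C c := @cbounded_cst (rdisc rho) c.
have bX n := cboundedX n b1; have bY n := cboundedX n b2.
have bC : cbounded (rdisc rho) (fun w => (rho ^+ 2)%:C - pt w * conjc (pt w)).
  by apply: cboundedD => //; apply: cboundedN; exact: cboundedM.
apply: cboundedD; first apply: cboundedD.
- by do 4 apply: cboundedM => //.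
- by do 4 apply: cboundedM => //.
- apply: cboundedN; apply: cboundedM; first exact: cboundedM.
  by apply: cboundedD; exact: cboundedM.
Qed.

Let intG rho i j : 0 <= rho ->
  cint nu (rdisc rho) (fun w => G rho i j 1 1 (pt w) (conjc (pt w))) = 0 /\
  cint nu (rdisc rho) (fun w => G rho i j 'i (- 'i) (pt w) (conjc (pt w))) = 0.
Proof.
move=> rho0; split.
  apply: (@green _ _ false) => // [|y].
    by apply: cbounded_cintegrable => //; exact: nu_rdisc.
  pose A : {poly R[i]} := 'X + ('i * y%:C)%:P.
  pose B : {poly R[i]} := 'X - ('i * y%:C)%:P.
  exists (A ^+ i * B ^+ j * ((rho ^+ 2)%:C%:P - A * B)); split => [x|s sy].
    rewrite (@deriv_G _ _ _ _ _ 1 1) /A /B ?derivD ?derivX ?derivN ?derivC ?oppr0 ?addr0 //.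
    by congr (G _ _ _ _ _ _); rewrite !hornerE /Defs.point /=; apply: complex_eqP => /=; ring.
  rewrite hornerM [X in _ * X](_ : _ = 0) ?mulr0//.
  rewrite /A /B !hornerE -sy; apply: complex_eqP => /=; ring.
apply: (@green _ _ true) => // [|y].
  by apply: cbounded_cintegrable => //; exact: nu_rdisc.
pose A : {poly R[i]} := 'i *: 'X + (y%:C)%:P.
pose B : {poly R[i]} := (- 'i) *: 'X + (y%:C)%:P.
exists (A ^+ i * B ^+ j * ((rho ^+ 2)%:C%:P - A * B)); split => [x|s sy].
  rewrite (@deriv_G _ _ _ _ _ 'i (- 'i)) /A /B ?derivD ?derivZ ?derivX ?derivC ?addr0 ?alg_polyC //.
  by congr (G _ _ _ _ _ _); rewrite !hornerE /Defs.point /=; apply: complex_eqP => /=; ring.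
rewrite hornerM [X in _ * X](_ : _ = 0) ?mulr0//.
rewrite /A /B !hornerE -sy; apply: complex_eqP => /=; ring.
Qed.

Definition moment rho i j :=
  cint nu (rdisc rho) (fun w => pt w ^+ i * conjc (pt w) ^+ j).

Lemma cbounded_monomial rho i j :
  cbounded (rdisc rho) (fun w => pt w ^+ i * conjc (pt w) ^+ j).
Proof.
have b1 := cbounded_pt rho.
by apply: cboundedM; apply: cboundedX => //; exact: cbounded_conj.
Qed.

(** Green's formula for [d/dz (z^i zb^j (rho^2 - z zb))], which vanishes on the
    boundary circle. *)
Lemma moment_rec rho i j : 0 <= rho ->
  i%:R * (rho ^+ 2)%:C * moment rho i.-1 j = i.+1%:R * moment rho i j.+1.
Proof.
move=> rho0; have [I1 I2] := intG i j rho0.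
have mD := measurable_rdisc rho.
have iB u : cbounded (rdisc rho) u -> cintegrable nu (rdisc rho) u.
  by move=> bu; apply: cbounded_cintegrable => //; exact: nu_rdisc.
have K w : G rho i j 1 1 (pt w) (conjc (pt w)) -
    'i * G rho i j 'i (- 'i) (pt w) (conjc (pt w)) =
    2 * (i%:R * (rho ^+ 2)%:C) * (pt w ^+ i.-1 * conjc (pt w) ^+ j) -
    2 * i.+1%:R * (pt w ^+ i * conjc (pt w) ^+ j.+1).
  have I2i : 'i * 'i = -1 :> R[i] by rewrite -expr2 sqr_i.
  set z := pt w; set zb := conjc z.
  have E (I a b : R[i]) : G rho i j 1 1 a b - I * G rho i j I (- I) a b =
     (1 - I * I) * (i%:R * a ^+ i.-1 * b ^+ j * ((rho ^+ 2)%:C - a * b)) +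
     (1 + I * I) * (j%:R * a ^+ i * b ^+ j.-1 * ((rho ^+ 2)%:C - a * b)) -
     a ^+ i * b ^+ j * ((1 - I * I) * b + (1 + I * I) * a).
    by rewrite /G; ring.
  rewrite E I2i addrN !mul0r !addr0 opprK -natr1 exprS.
  by case: (i) => [|n] /=; rewrite ?exprS; ring.
have := cintB mD (iB _ (cboundedG rho i j 1 1))
  (cintegrableZ 'i mD (iB _ (cboundedG rho i j 'i (- 'i)))).
rewrite cintZ//; last exact/iB/cboundedG.
rewrite I1 I2 mulr0 subr0 (eq_cint _ (fun w _ => K w)).
rewrite cintB//; try by apply: cintegrableZ => //; exact/iB/cbounded_monomial.
rewrite !cintZ//; try exact/iB/cbounded_monomial.
rewrite -/(moment rho i.-1 j) -/(moment rho i j.+1) -!mulrA -mulrBr => /eqP.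
by rewrite mulf_eq0 pnatr_eq0 /= subr_eq0 => /eqP.
Qed.

Lemma moment_conj rho i j : moment rho j i = conjc (moment rho i j).
Proof.
rewrite /moment -cint_conj//; last first.
  apply: cbounded_cintegrable => //; first exact: nu_rdisc.
  exact: cbounded_monomial.
have E (x : R[i]) : conjc (x ^+ i * conjc x ^+ j) = x ^+ j * conjc x ^+ i.
  by rewrite rmorphM !rmorphXn /= conjcK mulrC.
by apply: eq_cint => w _; rewrite E.
Qed.

(** The recurrence, with its conjugate, lowers the smaller exponent to 0 and
    then shows that the moment vanishes. *)
Lemma moment_offdiag rho i j : 0 <= rho -> i != j -> moment rho i j = 0.
Proof.
move=> rho0; wlog ij : i j / (i < j)%N.
  move=> W ne; have := ne; rewrite neq_ltn => /orP[h|h]; first exact: W.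
  by rewrite moment_conj W ?conjc0// eq_sym.
move=> _; elim: i j ij => [|i IH] [|j] // ij.
  have /esym/eqP := moment_rec 0 j rho0.
  by rewrite !mul0r mul1r => /eqP.
have /esym/eqP := moment_rec i.+1 j rho0.
by rewrite IH// mulr0 mulf_eq0 pnatr_eq0 /= => /eqP.
Qed.

Lemma moment_diag rho i : 0 <= rho ->
  moment rho i i = (rho ^+ i.*2)%:C / i.+1%:R * moment rho 0 0.
Proof.
move=> rho0; elim: i => [|i IH]; first by rewrite expr0 divr1 mul1r.
have := moment_rec i.+1 i rho0; rewrite /= IH => E.
apply: (@mulfI _ i.+2%:R); first by rewrite pnatr_eq0.
have -> : rho ^+ i.+1.*2 = rho ^+ i.*2 * rho ^+ 2 by rewrite -exprD addn2.
rewrite -E rmorphM.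
have n1 : i.+1%:R != 0 :> R[i] by rewrite pnatr_eq0.
have n2 : i.+2%:R != 0 :> R[i] by rewrite pnatr_eq0.
by move: n1 n2; move: (i.+1%:R) (i.+2%:R) => a b a0 b0; field; rewrite a0 b0.
Qed.

End Moments.

(** * Parseval's formula on the disc *)

Section Parseval.
Context {R : realType}.
Local Notation T2 := (measurableTypeR R * measurableTypeR R)%type.
Local Notation mu := (@lebesgue_measure R).
Local Notation nu := ((mu \x mu)%E : {measure set T2 -> \bar R}).
Local Notation sig := (@sigma R).
Implicit Types (rho : R) (i j k l m n N M : nat) (w : T2) (f g : R[i] -> R[i])
  (a b : nat -> R[i]).
Hint Resolve measurable_rdisc : core.

Definition area rho : R := fine (sig (rdisc rho)).

Lemma area_ge0 rho : 0 <= area rho.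
Proof. by rewrite fine_ge0. Qed.

Lemma areaE rho : sig (rdisc rho) = (area rho)%:E.
Proof. by rewrite fineK// ge0_fin_numE// sigma_rdisc. Qed.

Lemma area_le r s : r <= s -> area r <= area s.
Proof.
move=> rs; rewrite -lee_fin -!areaE; apply: le_measure; rewrite ?inE//.
by move=> w /= /lt_le_trans; apply.
Qed.

Lemma Rintegral_sigma (D : set T2) (h : T2 -> R) : measurable D ->
  nu.-integrable D (EFin \o h) ->
  \int[sig]_(w in D) h w = pi^-1 * \int[nu]_(w in D) h w.
Proof.
move=> mD ih; have mh := measurable_int nu ih.
rewrite /Rintegral integralE [in RHS]integralE.
rewrite !ge0_integral_mscale//;
  [|exact: measurable_funeneg|exact: measurable_funepos].
have := integrable_fin_num mD (integrable_funepos mD ih).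
have := integrable_fin_num mD (integrable_funeneg mD ih).
case: (\int[nu]_(x in D) _)%E => // x _.
case: (\int[nu]_(x in D) _)%E => // y _ /=.
by rewrite -mulrBr.
Qed.

Lemma cint_sigma (D : set T2) u : measurable D -> cintegrable nu D u ->
  cint sig D u = (pi^-1)%:C * cint nu D u.
Proof.
move=> mD [u1 u2]; apply: complex_eqP.
  by rewrite Re_realM /= Rintegral_sigma.
by rewrite Im_realM /= Rintegral_sigma.
Qed.

Lemma cbounded_sigma rho u : cbounded (rdisc rho) u ->
  cintegrable sig (rdisc rho) u.
Proof. by move=> bu; apply: cbounded_cintegrable => //; exact: sigma_rdisc. Qed.

Lemma cint_monomial rho i j : 0 <= rho ->
  cint sig (rdisc rho) (fun w => pt w ^+ i * conjc (pt w) ^+ j) =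
  if i == j then (area rho * rho ^+ i.*2 / i.+1%:R)%:C else 0.
Proof.
move=> rho0; have E k l : cint sig (rdisc rho)
    (fun w => pt w ^+ k * conjc (pt w) ^+ l) = (pi^-1)%:C * moment rho k l.
  apply: cint_sigma => //; apply: cbounded_cintegrable => //.
    exact: nu_rdisc.
  exact: cbounded_monomial.
rewrite E; case: eqVneq => [<-|ij]; last by rewrite moment_offdiag// mulr0.
rewrite moment_diag// mulrCA -E (eq_cint _ (v := fun=> 1)); last first.
  by move=> w _; rewrite !expr0 mulr1.
have -> : cint sig (rdisc rho) (fun=> 1) = (area rho)%:C.
  apply: complex_eqP.
    by rewrite -[LHS]/(\int[sig]_(w in rdisc rho) 1) Rintegral_cst// mul1r.
  by rewrite -[LHS]/(\int[sig]_(w in rdisc rho) 0) Rintegral_cst// mul0r.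
by rewrite !rmorphM fmorphV rmorph_nat /=; ring.
Qed.

Lemma cint_sum rho n (u : nat -> T2 -> R[i]) :
  (forall i, cbounded (rdisc rho) (u i)) ->
  cint sig (rdisc rho) (fun w => \sum_(i < n) u i w) =
  \sum_(i < n) cint sig (rdisc rho) (u i).
Proof.
move=> bu; elim: n => [|n IH].
  rewrite big_ord0 (eq_cint _ (v := fun=> 0)); last by move=> w _; rewrite big_ord0.
  by apply: complex_eqP; rewrite -[LHS]/(\int[sig]_(w in rdisc rho) 0) Rintegral_cst// mul0r.
rewrite big_ord_recr /= -IH -cintD//; try exact: cbounded_sigma.
  by apply: eq_cint => w _; rewrite big_ord_recr.
exact/cbounded_sigma/cbounded_sum.
Qed.

Definition poly_part a N (z : R[i]) := \sum_(n < N) a n * z ^+ n.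

Lemma cbounded_poly_part rho a N : cbounded (rdisc rho) (fun w => poly_part a N (pt w)).
Proof.
apply: (@cbounded_sum _ _ N (fun n w => a n * pt w ^+ n)) => n.
by apply: cboundedM; [exact: cbounded_cst|apply: cboundedX; exact: cbounded_pt].
Qed.

(** The mean of [|f|^2] over the disc of radius [rho], for the polynomial [f]
    with the first [N] coefficients of [a]. *)
Definition wnorm a rho N : R :=
  \sum_(n < N) modulus (a n) ^+ 2 * rho ^+ n.*2 / n.+1%:R.

Lemma cint_poly_part rho a N : 0 <= rho ->
  \int[sig]_(w in rdisc rho) modulus (poly_part a N (pt w)) ^+ 2 =
  area rho * wnorm a rho N.
Proof.
move=> rho0; set p := poly_part a N.
have -> : \int[sig]_(w in rdisc rho) modulus (p (pt w)) ^+ 2 =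
    complex.Re (cint sig (rdisc rho) (fun w => p (pt w) * conjc (p (pt w)))).
  by apply: eq_Rintegral => w _; rewrite mulc_conj.
pose t i j w := a i * conjc (a j) * (pt w ^+ i * conjc (pt w) ^+ j).
have bt i j : cbounded (rdisc rho) (t i j).
  by apply: cboundedM; [exact: cbounded_cst|exact: cbounded_monomial].
have tE i j : cint sig (rdisc rho) (t i j) = a i * conjc (a j) *
    cint sig (rdisc rho) (fun w => pt w ^+ i * conjc (pt w) ^+ j).
  by apply: cintZ => //; exact/cbounded_sigma/cbounded_monomial.
rewrite (eq_cint _ (v := fun w => \sum_(i < N) \sum_(j < N) t i j w)); last first.
  move=> w _; rewrite /p /poly_part rmorph_sum mulr_suml; apply: eq_bigr => i _.
  rewrite mulr_sumr; apply: eq_bigr => j _.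
  by rewrite rmorphM rmorphXn /t /=; ring.
rewrite (cint_sum _ (u := fun i w => \sum_(j < N) t i j w)); last first.
  by move=> i; apply: (@cbounded_sum _ _ N (t i)).
rewrite (eq_bigr (fun i : 'I_N =>
    (area rho * (modulus (a i) ^+ 2 * rho ^+ i.*2 / i.+1%:R))%:C)); last first.
  move=> i _; rewrite (cint_sum _ (u := t i))// (bigD1 i)//= big1 => [|j ji].
    rewrite addr0 tE cint_monomial// eqxx mulc_conj -rmorphM /=.
    by congr (_%:C); ring.
  by rewrite tE cint_monomial// eq_sym (inj_eq val_inj) (negbTE ji) mulr0.
by rewrite -rmorph_sum /= /wnorm mulr_sumr.
Qed.

Lemma poly_part_unif f a rho : taylor_expansion f a -> 0 <= rho -> rho < 1 ->
  forall e : R, 0 < e -> exists n0, forall N w, (n0 <= N)%N -> rdisc rho w ->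
    modulus (poly_part a N (pt w) - f (pt w)) <= e.
Proof.
move=> /taylor_expansionP fa rho0 rho1 e e0.
pose r := (1 + rho) / 2; have r0 : 0 < r by rewrite /r; lra.
have r1 : r < 1 by rewrite /r; lra.
have rr : rho < r by rewrite /r; lra.
have mr : modulus (r%:C : R[i]) = r by rewrite modulus_real gtr0_norm.
have dr : disc (r%:C : R[i]) by rewrite /disc /= mr.
have [C C0 HC] := pseries_coef_bound (fa _ dr); rewrite mr in HC.
pose q := rho / r; have q0 : 0 <= q by rewrite divr_ge0// ltW.
have q1 : q < 1 by rewrite ltr_pdivrMr// mul1r.
have Q0 : 0 < 1 - q by rewrite subr_gt0.
have tail N M z : modulus z <= rho -> (N <= M)%N ->
    modulus (poly_part a M z - poly_part a N z) <= C / (1 - q) * q ^+ N.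
  move=> zr NM; rewrite -(subnK NM) addnC; set K := (M - N)%N.
  rewrite /poly_part big_split_ord /= addrAC subrr add0r.
  apply: le_trans (modulus_sum _ _ _) _.
  apply: (@le_trans _ _ (\sum_(i < K) C * q ^+ N * q ^+ i)).
    apply: ler_sum => i _; rewrite modulusM modulusX -mulrA -exprD /q expr_div_n.
    apply: (@le_trans _ _ (modulus (a (N + i)%N) * rho ^+ (N + i))).
      by rewrite ler_wpM2l ?modulus_ge0// lerXn2r ?nnegrE ?modulus_ge0.
    rewrite mulrA ler_pdivlMr ?exprn_gt0// mulrAC.
    by rewrite ler_wpM2r ?exprn_ge0.
  rewrite -mulr_sumr [leRHS]mulrAC; apply: ler_wpM2l.
    by rewrite mulr_ge0 ?exprn_ge0.
  have := subrX1 q K => E; rewrite -(ler_pM2l Q0) divff ?gt_eqF//.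
  have -> : (1 - q) * \sum_(n < K) q ^+ n = 1 - q ^+ K.
    by rewrite -opprB mulNr -E opprB.
  by rewrite lerBlDl lerDr exprn_ge0.
have /cvgrPdist_le/(_ _ e0)[n0 _ Hn] : geometric (C / (1 - q)) q @ \oo --> 0.
  by apply: cvg_geometric; rewrite ger0_norm.
exists n0 => N w n0N wr; set z := pt w.
have zr : modulus z <= rho by exact: ltW.
have dz : disc z by rewrite /disc /= (le_lt_trans zr).
have geo : C / (1 - q) * q ^+ N <= e.
  have := Hn N n0N; rewrite /= sub0r normrN ger0_norm//.
  by rewrite !mulr_ge0// ?invr_ge0 ?exprn_ge0// ltW.
apply: le_trans geo; apply/ler_addgt0Pl => d d0.
have [n1 H1] := fa _ dz _ d0.
have := H1 (maxn N n1) (leq_maxr _ _).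
have := tail N (maxn N n1) z zr (leq_maxl _ _).
rewrite -/(poly_part a (maxn N n1) z) modulusB => h1 h2.
rewrite (_ : _ - _ = (poly_part a (maxn N n1) z - f z) +
  (poly_part a N z - poly_part a (maxn N n1) z)); last by ring.
exact: modulusD_le.
Qed.

Lemma cmeasurable_taylor f a : taylor_expansion f a ->
  cmeasurable (rdisc 1) (fun w => f (pt w)).
Proof.
move=> /taylor_expansionP fa.
have bp N : cmeasurable (rdisc 1) (fun w => poly_part a N (pt w)).
  by have [] := cbounded_poly_part 1 a N.
split.
  apply: (@measurable_fun_cvg _ _ _ _
      (fun N w => complex.Re (poly_part a N (pt w)))); first by move=> N; case: (bp N).
  move=> w dw; apply/cvgrPdist_le => e e0; have [n0 H] := fa _ dw _ e0.
  exists n0 => // N /H h; rewrite /= distrC; apply: le_trans h.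
  by rewrite -Re_opp -Re_add normr_Re_le.
apply: (@measurable_fun_cvg _ _ _ _
    (fun N w => complex.Im (poly_part a N (pt w)))); first by move=> N; case: (bp N).
move=> w dw; apply/cvgrPdist_le => e e0; have [n0 H] := fa _ dw _ e0.
exists n0 => // N /H h; rewrite /= distrC; apply: le_trans h.
by rewrite -Im_opp -Im_add normr_Im_le.
Qed.

End Parseval.

(** * Square integrable functions on the disc *)
Section ParsevalDisc.
Context {R : realType}.
Local Notation T2 := (measurableTypeR R * measurableTypeR R)%type.
Local Notation sig := (@sigma R).
Local Notation D := (@rdisc R 1).
Implicit Types (rho e B : R) (i j k l m n N M : nat) (w : T2) (f g : R[i] -> R[i])
  (a b : nat -> R[i]).

Lemma measurable_D : measurable D.
Proof. exact: measurable_rdisc. Qed.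
Hint Resolve measurable_D : core.

Definition sqint f : \bar R :=
  (\int[sig]_(w in D) ((modulus (f (pt w)) ^+ 2)%:E))%E.

Lemma sqint_ge0 f : (0 <= sqint f)%E.
Proof. by apply: integral_ge0 => w _; rewrite lee_fin sqr_ge0. Qed.

Lemma measurable_sqmod f a rho : taylor_expansion f a -> rho <= 1 ->
  measurable_fun (rdisc rho) (fun w => modulus (f (pt w)) ^+ 2).
Proof.
move=> fa r1; apply: measurable_funX.
apply: measurable_funS (measurable_modulus (cmeasurable_taylor fa)) => //.
by move=> w /lt_le_trans; exact.
Qed.

Lemma wnorm_nondecreasing a rho : {homo wnorm a rho : N M / (N <= M)%N >-> N <= M}.
Proof.
apply/nondecreasing_seqP => N; rewrite /wnorm big_ord_recr /= lerDl.
by rewrite divr_ge0// mulr_ge0 ?sqr_ge0// -mul2n exprM exprn_ge0// sqr_ge0.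
Qed.

Lemma wnorm_ge0 a rho N : 0 <= wnorm a rho N.
Proof.
have := @wnorm_nondecreasing a rho 0%N N (leq0n _).
by rewrite {1}/wnorm big_ord0.
Qed.

Lemma wnorm_rho_le a rho N : 0 <= rho -> rho <= 1 -> wnorm a rho N <= wnorm a 1 N.
Proof.
move=> r0 r1; apply: ler_sum => i _; rewrite expr1n ler_wpM2r ?invr_ge0//.
by rewrite ler_wpM2l ?sqr_ge0// exprn_ile1.
Qed.

Let small_disc_cvg f a rho : taylor_expansion f a -> 0 <= rho -> rho < 1 ->
  forall e, 0 < e -> exists n0, forall N, (n0 <= N)%N ->
    sig.-integrable (rdisc rho) (EFin \o (fun w => modulus (f (pt w)) ^+ 2)) /\
    `|\int[sig]_(w in rdisc rho) modulus (f (pt w)) ^+ 2 -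
      area rho * wnorm a rho N| <= e.
Proof.
move=> fa r0 r1 e e0.
have [n1 H1] := poly_part_unif fa r0 r1 ltr01.
have [_ [K HK]] := cbounded_poly_part rho a n1.
pose K1 := `|K| + 1.
have fK w : rdisc rho w -> modulus (f (pt w)) <= K1.
  move=> wr; rewrite -[f _](subrK (poly_part a n1 (pt w))) addrC.
  apply: modulusD_le; first exact: le_trans (HK _ wr) (ler_norm _).
  by rewrite modulusB; exact: H1.
have K0 : 0 < 2 * K1 + 1 by rewrite /K1; have := normr_ge0 K; lra.
pose d := Num.min 1 (e / (2 * K1 + 1) / (area rho + 1)).
have A0 : 0 < area rho + 1 by rewrite ltr_wpDl ?area_ge0.
have d0 : 0 < d by rewrite lt_min ltr01 !divr_gt0.
have d1 : d <= 1 by rewrite ge_min lexx.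
have de : d <= e / (2 * K1 + 1) / (area rho + 1) by rewrite ge_min lexx orbT.
have [n0 H] := poly_part_unif fa r0 r1 d0.
have bI (h : T2 -> R) (C : R) : measurable_fun (rdisc rho) h ->
    (forall w, rdisc rho w -> `|h w| <= C) ->
    sig.-integrable (rdisc rho) (EFin \o h).
  move=> mh hC.
  apply: (@le_integrable _ _ _ _ _ _ _ (EFin \o (fun=> C))).
  - exact: measurable_rdisc.
  - exact/measurable_EFinP.
  - by move=> w /hC hw /=; rewrite lee_fin (le_trans hw)// ler_norm.
  apply/integrableP; split; first exact: measurable_cst.
  rewrite /comp integral_cst/=; last exact: measurable_rdisc.
  by rewrite lte_mul_pinfty// sigma_rdisc.
have mf := measurable_sqmod fa (ltW r1).
have If : sig.-integrable (rdisc rho) (EFin \o (fun w => modulus (f (pt w)) ^+ 2)).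
  apply: (bI _ (K1 ^+ 2)) => // w wr; rewrite ger0_norm ?sqr_ge0//.
  by rewrite lerXn2r ?nnegrE ?modulus_ge0 ?fK//; rewrite /K1 addr_ge0.
exists n0 => N nN; split=> //; set p := poly_part a N.
have pf w : rdisc rho w -> `|modulus (f (pt w)) ^+ 2 - modulus (p (pt w)) ^+ 2| <=
    d * (2 * K1 + 1).
  move=> wr; have h1 := H N w nN wr; have h2 := fK w wr.
  set x := modulus (f _) in h2 *; set y := modulus (p _).
  have x0 : 0 <= x by exact: modulus_ge0.
  have y0 : 0 <= y by exact: modulus_ge0.
  have xy : `|x - y| <= d.
    have h3 := modulusD (f (pt w) - p (pt w)) (p (pt w)).
    have h4 := modulusD (p (pt w) - f (pt w)) (f (pt w)).
    move: h3 h4; rewrite !subrK (modulusB (f _)) -/x -/y -/p in h1 *.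
    by move=> h3 h4; rewrite ler_norml; apply/andP; split; lra.
  rewrite subr_sqr normrM ler_pM// ger0_norm ?addr_ge0//.
  by move: xy; rewrite ler_norml => /andP[]; lra.
have mp : measurable_fun (rdisc rho) (fun w => modulus (p (pt w)) ^+ 2).
  apply: measurable_funX; apply: measurable_modulus.
  by have [] := cbounded_poly_part rho a N.
have Ip : sig.-integrable (rdisc rho) (EFin \o (fun w => modulus (p (pt w)) ^+ 2)).
  apply: (bI _ (K1 ^+ 2 + d * (2 * K1 + 1))) => // w wr.
  rewrite ger0_norm ?sqr_ge0//; have := pf w wr; rewrite distrC.
  move=> /(le_trans (ler_norm _)); rewrite lerBlDl => /le_trans; apply.
  by rewrite lerD2r lerXn2r ?nnegrE ?modulus_ge0 ?fK//; rewrite /K1 addr_ge0.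
rewrite -cint_poly_part// -RintegralB//; last exact: measurable_rdisc.
apply: le_trans (le_normr_Rintegral _ _) _; first exact: measurable_rdisc.
  by apply: (bI _ (d * (2 * K1 + 1))) => //; exact: measurable_funB.
apply: (@le_trans _ _ (\int[sig]_(w in rdisc rho) (d * (2 * K1 + 1)))).
  apply: le_Rintegral => //; first exact: measurable_rdisc.
  - apply: (bI _ (d * (2 * K1 + 1))).
      by apply: measurableT_comp => //; exact: measurable_funB.
    by move=> w wr; rewrite normr_id pf.
  - by apply: (bI _ `|d * (2 * K1 + 1)|).
rewrite Rintegral_cst; last exact: measurable_rdisc.
rewrite -/(area rho); move: de; rewrite ler_pdivlMr// ler_pdivlMr// => de.
apply: le_trans de; rewrite mulrAC ler_wpM2r ?(ltW K0)// ler_wpM2l ?(ltW d0)//.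
by rewrite lerDl.
Qed.

Let rk k : R := k.+1%:R / k.+2%:R.

Let rk01 k : 0 <= rk k /\ rk k < 1.
Proof.
by split; [rewrite divr_ge0|rewrite ltr_pdivrMr// mul1r ltr_nat].
Qed.

Let rkE k : rk k = 1 - k.+2%:R^-1.
Proof.
have n2 : k.+2%:R != 0 :> R by rewrite pnatr_eq0.
by apply: (mulIf n2); rewrite /rk mulrBl mul1r mulVf// divfK// -[k.+2%:R]natr1 addrK.
Qed.

Let rk_nd : {homo rk : k l / (k <= l)%N >-> k <= l}.
Proof.
move=> k l kl; rewrite !rkE lerD2l lerN2 lef_pV2 ?posrE//.
by rewrite ler_nat.
Qed.

Let rk_cvg : rk @ \oo --> (1 : R).
Proof.
rewrite (_ : rk = fun k => 1 - k.+2%:R^-1); last by apply/funext => k; rewrite rkE.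
rewrite -[X in _ --> X](subr0 (1 : R)); apply: cvgB; first exact: cvg_cst.
by have := @cvg_harmonic R; rewrite -(cvg_shiftS).
Qed.

Let bigcup_rk : \bigcup_k rdisc (rk k) = D.
Proof.
apply/seteqP; split => w [].
  by move=> k _ /lt_trans; apply; case: (rk01 k).
move=> w1; have e0 : 0 < 1 - modulus (pt w) by rewrite subr_gt0.
have /cvgrPdist_lt/(_ _ e0)[k _ /(_ k (leqnn k))] := rk_cvg.
have [_ /ltW h] := rk01 k.
rewrite ger0_norm ?subr_ge0// => h'; exists k => //.
by rewrite /rdisc /=; lra.
Qed.

(** Integrals over the whole disc are reached from smaller discs, on which
    the Taylor series converges uniformly. *)
Let small_discs (h : T2 -> R) : measurable_fun D h -> (forall w, 0 <= h w) ->
  (\int[sig]_(w in rdisc (rk k)) (h w)%:E)%E @[k --> \oo] -->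
  (\int[sig]_(w in D) (h w)%:E)%E.
Proof.
move=> mh h0; rewrite -bigcup_rk; apply: ge0_nondecreasing_set_cvg_integral.
- move=> k l kl; apply/subsetPset => w /lt_le_trans; apply.
  exact: rk_nd.
- by move=> k; exact: measurable_rdisc.
- move=> k; apply/measurable_EFinP; apply: measurable_funS mh => //.
  by move=> w /lt_trans; apply; case: (rk01 k).
- by move=> k w _; rewrite lee_fin.
Qed.

Let area_cvg : area (rk k) @[k --> \oo] --> area 1.
Proof.
have /= := @small_discs (fun=> 1) (measurable_cst _) (fun=> ler01).
rewrite (_ : (fun k => _) = fun k => (area (rk k))%:E); last first.
  apply/funext => k; rewrite integral_cst; last exact: measurable_rdisc.
  by rewrite mul1e areaE.
rewrite integral_cst// mul1e areaE => H.
exact: (fine_cvg H).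
Qed.

Lemma wnorm_le_sqint f a N : taylor_expansion f a ->
  ((area 1 * wnorm a 1 N)%:E <= sqint f)%E.
Proof.
move=> fa; have := sqint_ge0 f; case E : (sqint f) => [s| |] // _; last exact: leey.
rewrite lee_fin.
have H k : area (rk k) * wnorm a (rk k) N <= s.
  have [r0 r1] := rk01 k; apply/ler_addgt0Pl => e e0.
  have [n0 Hn] := small_disc_cvg fa r0 r1 e0.
  have [I1] := Hn (maxn n0 N) (leq_maxl _ _).
  rewrite ler_norml => /andP[_ _].
  have [_] := Hn (maxn n0 N) (leq_maxl _ _).
  rewrite distrC => /(le_trans (ler_norm _)); rewrite lerBlDr => h.
  apply: (@le_trans _ _ (area (rk k) * wnorm a (rk k) (maxn n0 N))).
    by rewrite ler_wpM2l ?area_ge0// wnorm_nondecreasing// leq_maxr.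
  apply: le_trans h _; rewrite lerD2l -lee_fin.
  rewrite /Rintegral fineK; last first.
    by apply: integrable_fin_num => //; exact: measurable_rdisc.
  rewrite -E; apply: ge0_subset_integral => //; first exact: measurable_rdisc.
  - by have /measurable_EFinP := measurable_sqmod fa (lexx _).
  - by move=> w _; rewrite lee_fin sqr_ge0.
  - by move=> w /lt_trans; apply.
have cw M : wnorm a (rk k) M @[k --> \oo] --> wnorm a 1 M.
  elim: M => [|M IH].
    rewrite /wnorm big_ord0 (_ : (fun _ => _) = fun=> 0); first exact: cvg_cst.
    by apply/funext => k; rewrite big_ord0.
  rewrite {2}/wnorm big_ord_recr /= -/(wnorm a 1 M).
  rewrite (_ : (fun _ => _) = fun k => wnorm a (rk k) M +
      modulus (a M) ^+ 2 * rk k ^+ M.*2 / M.+1%:R); last first.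
    by apply/funext => k; rewrite /wnorm big_ord_recr.
  apply: cvgD => //; apply: cvgM; last exact: cvg_cst.
  apply: cvgM; first exact: cvg_cst.
  exact: (continuous_cvg _ (@exprn_continuous R M.*2 1) rk_cvg).
have c : area (rk k) * wnorm a (rk k) N @[k --> \oo] --> area 1 * wnorm a 1 N.
  exact: cvgM area_cvg (cw N).
by rewrite -(cvg_lim _ c)//; apply: limr_le; [exact: cvgP c|exact: nearW].
Qed.

Lemma sqint_le_wnorm f a B : taylor_expansion f a ->
  (forall N, wnorm a 1 N <= B) -> (sqint f <= (area 1 * B)%:E)%E.
Proof.
move=> fa aB; have B0 : 0 <= B := le_trans (wnorm_ge0 a 1 0) (aB 0%N).
have mf := measurable_sqmod fa (lexx 1).
have c := small_discs mf (fun w => sqr_ge0 _).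
rewrite /sqint -(cvg_lim _ c)//; apply: lime_le; first exact: cvgP c.
apply: nearW => k; have [r0 r1] := rk01 k; apply/lee_addgt0Pr => e e0.
have [n0 Hn] := small_disc_cvg fa r0 r1 e0; have [I1] := Hn n0 (leqnn _).
move=> /(le_trans (ler_norm _)); rewrite lerBlDr => h.
rewrite -[X in (X <= _)%E]fineK; last first.
  by apply: integrable_fin_num => //; exact: measurable_rdisc.
rewrite -EFinD lee_fin; apply: le_trans h _; rewrite addrC lerD2r.
apply: ler_pM; rewrite ?area_ge0 ?wnorm_ge0//; first exact/area_le/ltW.
exact: le_trans (wnorm_rho_le _ _ r0 (ltW r1)) (aB n0).
Qed.

Definition square_integrable f := (sqint f < +oo)%E.

Lemma square_integrableP f a : taylor_expansion f a -> square_integrable f ->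
  [/\ (forall N, area 1 * wnorm a 1 N <= fine (sqint f)) &
   forall e, 0 < e -> exists n0, forall N, (n0 <= N)%N ->
     `|area 1 * wnorm a 1 N - fine (sqint f)| <= e].
Proof.
move=> fa foo; have E : sqint f = (fine (sqint f))%:E.
  by rewrite fineK// ge0_fin_numE// sqint_ge0.
have H N : area 1 * wnorm a 1 N <= fine (sqint f).
  by rewrite -lee_fin -E wnorm_le_sqint.
split=> // e e0; have [A0|A0] := eqVneq (area 1) (0 : R).
  exists 0%N => N _.
  rewrite A0 mul0r sub0r normrN /sqint null_set_integral ?normr0 ?ltW//.
    by have /measurable_EFinP := measurable_sqmod fa (lexx _).
  by rewrite areaE A0.
have Apos : 0 < area (1 : R) by rewrite lt0r A0 area_ge0.
have bd N : wnorm a 1 N <= fine (sqint f) / area 1.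
  by rewrite ler_pdivlMr// mulrC.
have hs : has_sup (range (wnorm a 1)).
  split; first by exists (wnorm a 1 0); exists 0%N.
  by exists (fine (sqint f) / area 1) => _ [N _ <-].
have e1 : 0 < e / area 1 by rewrite divr_gt0.
have [_ [n0 _ <-] h0] := sup_adherent e1 hs; exists n0 => N nN.
have hsup : fine (sqint f) <= area 1 * sup (range (wnorm a 1)).
  rewrite -lee_fin -E; apply: sqint_le_wnorm fa _ => M.
  by apply: sup_upper_bound => //; exists M.
rewrite distrC ger0_norm ?subr_ge0// lerBlDr -lerBlDl.
have h1 : wnorm a 1 n0 <= wnorm a 1 N by exact: wnorm_nondecreasing.
apply: (@le_trans _ _ (area 1 * (sup (range (wnorm a 1)) - e / area 1))).
  by rewrite mulrBr [_ * (e / _)]mulrCA divff// mulr1 lerD2r.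
by rewrite ler_wpM2l ?area_ge0// (le_trans (ltW h0)).
Qed.

End ParsevalDisc.

(** * The inner product *)
Section InnerProduct.
Context {R : realType}.
Local Notation T2 := (measurableTypeR R * measurableTypeR R)%type.
Local Notation mu := (@lebesgue_measure R).
Local Notation nu := ((mu \x mu)%E : {measure set T2 -> \bar R}).
Local Notation sig := (@sigma R).
Local Notation D := (@rdisc R 1).
Local Notation A1 := (area (1 : R)).
Implicit Types (e B : R) (i j k l m n N M : nat) (w : T2) (f g : R[i] -> R[i])
  (a b : nat -> R[i]) (lam z : R[i]).
Hint Resolve measurable_D : core.

Lemma area_gt0 : 0 < A1.
Proof.
rewrite lt0r area_ge0 andbT; apply/eqP => A0.
set I := [set` `[- (1 / 4), 1 / 4]%R] : set R.
have mI : mu I = (1 / 2)%:E.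
  rewrite /I lebesgue_measure_itv /= lte_fin ifT; last by lra.
  by rewrite -EFinD; congr (_%:E); lra.
have : (nu (I `*` I) <= nu D)%E.
  apply: le_measure; rewrite ?inE//.
    by apply: measurableX; exact: measurable_itv.
  move=> -[x y]; rewrite /I => -[/=]; rewrite !in_itv /= -!ler_norml => hx hy.
  rewrite /rdisc /= [pt (x, y)]complexE /=.
  apply: (@le_lt_trans _ _ (1 / 4 + 1 / 4)); last by lra.
  by apply: modulusD_le; rewrite ?modulusM ?modulus_i ?mul1r modulus_real -div1r.
rewrite (_ : nu (I `*` I) = mu I * mu I)%E; last first.
  by apply: product_measure1E; exact: measurable_itv.
have := areaE (1 : R); rewrite A0 /sigma /mscale /= => /eqP.
rewrite mule_eq0 => /orP[|/eqP ->].
  by rewrite eqe invr_eq0 gt_eqF// pi_gt0.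
by rewrite mI -EFinM lee_fin; lra.
Qed.

Lemma taylorD f g a b : taylor_expansion f a -> taylor_expansion g b ->
  taylor_expansion (fun z => f z + g z) (fun n => a n + b n).
Proof.
move=> /taylor_expansionP fa /taylor_expansionP gb; apply/taylor_expansionP.
move=> z dz e e0; have e20 : 0 < e / 2 by rewrite divr_gt0.
have [n1 H1] := fa _ dz _ e20; have [n2 H2] := gb _ dz _ e20.
exists (maxn n1 n2) => N; rewrite geq_max => /andP[/H1 h1 /H2 h2].
rewrite (eq_bigr (fun n : 'I_N => a n * z ^+ n + b n * z ^+ n)); last first.
  by move=> i _; rewrite mulrDl.
rewrite big_split /= opprD addrACA [leRHS](splitr e).
exact: modulusD_le.
Qed.

Lemma taylorZ f a (c : R[i]) : taylor_expansion f a ->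
  taylor_expansion (fun z => c * f z) (fun n => c * a n).
Proof.
move=> /taylor_expansionP fa; apply/taylor_expansionP => z dz e e0.
have c0 : 0 < modulus c + 1 by rewrite ltr_wpDl ?modulus_ge0.
have [n0 H] := fa _ dz _ (divr_gt0 e0 c0).
exists n0 => N /H; rewrite ler_pdivlMr// => h; apply: le_trans h.
rewrite (eq_bigr (fun n : 'I_N => c * (a n * z ^+ n))); last first.
  by move=> i _; rewrite mulrA.
by rewrite -mulr_sumr -mulrBr modulusM mulrC ler_wpM2l ?modulus_ge0// lerDl.
Qed.

Arguments taylorZ {f a} c _.

Lemma taylorB f g a b : taylor_expansion f a -> taylor_expansion g b ->
  taylor_expansion (fun z => f z - g z) (fun n => a n - b n).
Proof.
move=> fa gb; have := taylorD fa (taylorZ (-1) gb).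
have -> : (fun z => f z + -1 * g z) = (fun z => f z - g z).
  by apply/funext => z; rewrite mulN1r.
by have -> : (fun n => a n + -1 * b n) = (fun n => a n - b n)
  by apply/funext => n; rewrite mulN1r.
Qed.

Lemma taylor_dilation f a lam : modulus lam <= 1 -> taylor_expansion f a ->
  taylor_expansion (fun z => f (lam * z)) (fun n => a n * lam ^+ n).
Proof.
move=> lam1 /taylor_expansionP fa; apply/taylor_expansionP => z dz e e0.
have dlz : disc (lam * z).
  apply: le_lt_trans dz; rewrite modulusM.
  by rewrite ler_piMl ?modulus_ge0.
have [n0 H] := fa _ dlz _ e0; exists n0 => N /H; apply: le_trans.
rewrite le_eqVlt; apply/orP; left; apply/eqP; congr (modulus (_ - _)).
by apply: eq_bigr => n _; rewrite exprMn mulrA.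
Qed.

Definition shift m a n : R[i] := if (n < m)%N then 0 else a (n - m)%N.

Lemma taylor_shift f a m : taylor_expansion f a ->
  taylor_expansion (fun z => z ^+ m * f z) (shift m a).
Proof.
move=> /taylor_expansionP fa; apply/taylor_expansionP => z dz e e0.
have [n0 H] := fa _ dz _ e0; exists (m + n0)%N => N mN.
have -> : N = (m + (N - m))%N by rewrite subnKC// (leq_trans _ mN)// leq_addr.
rewrite big_split_ord /= big1 ?add0r; last first.
  by move=> i _; rewrite /shift ltn_ord mul0r.
rewrite (eq_bigr (fun n : 'I_(N - m) => z ^+ m * (a n * z ^+ n))); last first.
  by move=> i _; rewrite /shift ltnNge leq_addr /= addKn exprD; ring.
rewrite -mulr_sumr -mulrBr modulusM modulusX.
apply: le_trans (H (N - m)%N _); last by rewrite leq_subRL// (leq_trans _ mN)// leq_addr.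
by rewrite ler_piMl ?modulus_ge0// exprn_ile1 ?modulus_ge0// ltW.
Qed.

Lemma square_integrable_wnorm f a : taylor_expansion f a ->
  square_integrable f <-> exists B, forall N, wnorm a 1 N <= B.
Proof.
move=> fa; split=> [sf|[B HB]].
  have [H _] := square_integrableP fa sf.
  by exists (fine (sqint f) / A1) => N; rewrite ler_pdivlMr ?area_gt0// mulrC.
by apply: le_lt_trans (sqint_le_wnorm fa HB) _; rewrite ltry.
Qed.

Lemma wnormE a N : wnorm a 1 N = \sum_(n < N) modulus (a n) ^+ 2 / n.+1%:R.
Proof. by apply: eq_bigr => n _; rewrite expr1n mulr1. Qed.

Lemma wnorm_comb a b (c d : R[i]) N : wnorm (fun n => c * a n + d * b n) 1 N <=
  2 * modulus c ^+ 2 * wnorm a 1 N + 2 * modulus d ^+ 2 * wnorm b 1 N.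
Proof.
rewrite !wnormE !mulr_sumr -big_split /=; apply: ler_sum => n _.
set x := c * a n; set y := d * b n.
rewrite [leRHS](_ : _ = (2 * modulus x ^+ 2 + 2 * modulus y ^+ 2) / n.+1%:R);
  last by rewrite /x /y !modulusM; ring.
apply: ler_wpM2r; first by rewrite invr_ge0.
have h := modulusD x y; have := modulus_ge0 (x + y).
have := sqr_ge0 (modulus x - modulus y) => h1 h2.
have h3 : modulus (x + y) ^+ 2 <= (modulus x + modulus y) ^+ 2.
  by rewrite lerXn2r ?nnegrE// (le_trans h2).
by apply: le_trans h3 _; move: h1; rewrite sqrrB sqrrD; lra.
Qed.

Lemma square_integrable_comb f g a b (c d : R[i]) :
  taylor_expansion f a -> taylor_expansion g b ->
  square_integrable f -> square_integrable g ->
  square_integrable (fun z => c * f z + d * g z).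
Proof.
move=> fa gb /(square_integrable_wnorm fa)[B HB].
move=> /(square_integrable_wnorm gb)[C HC].
apply/(square_integrable_wnorm (taylorD (taylorZ c fa) (taylorZ d gb))).
exists (2 * modulus c ^+ 2 * B + 2 * modulus d ^+ 2 * C) => N.
apply: le_trans (wnorm_comb _ _ _ _ _) _.
by rewrite lerD// ler_wpM2l// mulr_ge0// sqr_ge0.
Qed.

Arguments square_integrable_comb {f g a b} c d _ _ _ _.

Lemma square_integrable_integrable f a : taylor_expansion f a ->
  square_integrable f ->
  sig.-integrable D (EFin \o (fun w => modulus (f (pt w)) ^+ 2)).
Proof.
move=> fa sf; apply/integrableP; split.
  by have /measurable_EFinP := measurable_sqmod fa (lexx _).
apply: le_lt_trans sf; apply: ge0_le_integral => //.
- by apply: measurableT_comp => //; have /measurable_EFinP := measurable_sqmod fa (lexx _).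
- by have /measurable_EFinP := measurable_sqmod fa (lexx _).
- by move=> w _ /=; rewrite ger0_norm ?sqr_ge0.
Qed.

Definition ip f g : R[i] := disc_integral (fun z => f z * conjc (g z)).

Lemma ip_cint f g : ip f g = cint sig D (fun w => f (pt w) * conjc (g (pt w))).
Proof. by []. Qed.

Lemma ip_integrable f g a b : taylor_expansion f a -> taylor_expansion g b ->
  square_integrable f -> square_integrable g ->
  cintegrable sig D (fun w => f (pt w) * conjc (g (pt w))).
Proof.
move=> fa gb sf sg.
apply: (@cintegrable_le _ _ _ _ _ _
  (fun w => modulus (f (pt w)) ^+ 2 + modulus (g (pt w)) ^+ 2)) => //.
- apply: cmeasurableM; first exact: cmeasurable_taylor fa.
  exact: cmeasurable_conj (cmeasurable_taylor gb).
- have := integrableD measurable_D (square_integrable_integrable fa sf)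
    (square_integrable_integrable gb sg).
  by apply: eq_integrable.
move=> w _; rewrite modulusM modulus_conj.
have := sqr_ge0 (modulus (f (pt w)) - modulus (g (pt w))).
have := mulr_ge0 (modulus_ge0 (f (pt w))) (modulus_ge0 (g (pt w))).
by rewrite sqrrB; lra.
Qed.

Definition wsum a b N : R[i] := \sum_(n < N) a n * conjc (b n) / n.+1%:R.

Let sq_cvg f a : taylor_expansion f a -> square_integrable f ->
  forall e, 0 < e -> exists n0, forall N, (n0 <= N)%N ->
    `|A1 * wnorm a 1 N - \int[sig]_(w in D) modulus (f (pt w)) ^+ 2| <= e.
Proof. by move=> fa sf; have [_] := square_integrableP fa sf. Qed.

Let polar (x y : R[i]) : complex.Re (x * conjc y) =
  (modulus (1 * x + 1 * y) ^+ 2 - modulus (1 * x + (-1) * y) ^+ 2) / 4.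
Proof.
by rewrite !sqr_modulus !mul1r mulN1r !Re_add !Im_add Re_opp Im_opp Re_mul Re_conjc Im_conjc; field.
Qed.

Let natVC n : n%:R^-1 = (n%:R^-1)%:C :> R[i].
Proof. by rewrite fmorphV rmorph_nat. Qed.

Let parseval_Re f g a b : taylor_expansion f a -> taylor_expansion g b ->
  square_integrable f -> square_integrable g ->
  forall e, 0 < e -> exists n0, forall N, (n0 <= N)%N ->
    `|A1 * complex.Re (wsum a b N) - complex.Re (ip f g)| <= e.
Proof.
move=> fa gb sf sg e e0.
have e2 : 0 < 2 * e by rewrite mulr_gt0.
have sp := square_integrable_comb 1 1 fa gb sf sg.
have sm := square_integrable_comb 1 (-1) fa gb sf sg.
have tp := taylorD (taylorZ 1 fa) (taylorZ 1 gb).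
have tm := taylorD (taylorZ 1 fa) (taylorZ (-1) gb).
have [n1 H1] := sq_cvg tp sp e2; have [n2 H2] := sq_cvg tm sm e2.
exists (maxn n1 n2) => N; rewrite geq_max => /andP[/H1 h1 /H2 h2].
have -> : complex.Re (ip f g) =
    (\int[sig]_(w in D) modulus (1 * f (pt w) + 1 * g (pt w)) ^+ 2 -
     \int[sig]_(w in D) modulus (1 * f (pt w) + (-1) * g (pt w)) ^+ 2) / 4.
  have i1 := square_integrable_integrable tp sp.
  have i2 := square_integrable_integrable tm sm.
  rewrite -RintegralB// -RintegralZr//; last first.
    by have := integrableB measurable_D i1 i2; apply: eq_integrable.
  by apply: eq_Rintegral => w _; rewrite polar.
have -> : complex.Re (wsum a b N) = (wnorm (fun n => 1 * a n + 1 * b n) 1 N -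
    wnorm (fun n => 1 * a n + (-1) * b n) 1 N) / 4.
  rewrite !wnormE -sumrB mulr_suml /wsum raddf_sum; apply: eq_bigr => n _.
  rewrite [RHS](_ : _ = complex.Re (a n * conjc (b n)) / n.+1%:R);
    last by rewrite polar; ring.
  rewrite -[LHS]/(complex.Re (a n * conjc (b n) / n.+1%:R)).
  by rewrite natVC [X in complex.Re X]mulrC Re_realM mulrC.
move: h1 h2; set x := wnorm _ _ _; set y := wnorm _ _ _.
set X := \int[sig]_(w in D) _; set Y := \int[sig]_(w in D) _.
by rewrite !ler_norml => /andP[? ?] /andP[? ?]; apply/andP; split; lra.
Qed.

(** Parseval's formula, by polarization of the formula for the norm. *)
Lemma parseval f g a b : taylor_expansion f a -> taylor_expansion g b ->
  square_integrable f -> square_integrable g ->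
  forall e, 0 < e -> exists n0, forall N, (n0 <= N)%N ->
    modulus (A1%:C * wsum a b N - ip f g) <= e.
Proof.
move=> fa gb sf sg e e0; have e20 : 0 < e / 2 by rewrite divr_gt0.
have [n1 H1] := parseval_Re fa gb sf sg e20.
have sig' : square_integrable (fun z => 'i * g z).
  have := square_integrable_comb 'i 0 gb gb sg sg.
  by congr square_integrable; apply/funext => z; rewrite mul0r addr0.
have [n2 H2] := parseval_Re fa (taylorZ 'i gb) sf sig' e20.
exists (maxn n1 n2) => N; rewrite geq_max => /andP[/H1 h1 /H2 h2].
have E (x y : R[i]) : complex.Re (x * conjc ('i * y)) = complex.Im (x * conjc y).
  by rewrite Re_mul Im_mul; case: x => ? ?; case: y => ? ? /=; ring.
have EI : complex.Re (ip f (fun z => 'i * g z)) = complex.Im (ip f g).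
  by apply: eq_Rintegral => w _; rewrite E.
have ES : complex.Re (wsum a (fun n => 'i * b n) N) = complex.Im (wsum a b N).
  rewrite /wsum !raddf_sum; apply: eq_bigr => n _ /=.
  rewrite -[LHS]/(complex.Re (a n * conjc ('i * b n) / n.+1%:R)).
  rewrite -[RHS]/(complex.Im (a n * conjc (b n) / n.+1%:R)).
  rewrite natVC [X in complex.Re X]mulrC Re_realM E.
  by rewrite [in RHS]mulrC Im_realM.
move: h2; rewrite EI ES => h2.
set u := _ - _; rewrite [u]complexE [leRHS](splitr e).
apply: modulusD_le; rewrite ?modulusM ?modulus_i ?mul1r modulus_real.
  by apply: le_trans h1; rewrite /u Re_add Re_opp Re_realM.
by apply: le_trans h2; rewrite /u Im_add Im_opp Im_realM.
Qed.

End InnerProduct.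

(** * Second-order behaviour of the p-th power of the modulus, for p = 2n *)

Section Bregman.

(** [taylor2 n a b] is the quotient of the second Taylor remainder of [x ^+ n]
    by [(b - a) ^+ 2]; its recursion has only positive terms. *)
Fixpoint taylor2 (T : comPzRingType) n (a b : T) : T :=
  if n is m.+1 then b * taylor2 m a b + m%:R * a ^+ m.-1 else 0.

Lemma taylor2E (T : comPzRingType) n (a b : T) :
  b ^+ n - a ^+ n - n%:R * a ^+ n.-1 * (b - a) = (b - a) ^+ 2 * taylor2 n a b.
Proof.
elim: n => [|n IH] /=; first by rewrite !expr0; ring.
rewrite [RHS]mulrDr [X in _ = X + _]mulrCA -IH -natr1 !exprS.
by case: n {IH} => [|n] /=; rewrite ?exprS; ring.
Qed.

Context {R : realType}.
Implicit Types (a b c h s : R[i]) (x y : R) (n : nat).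

Lemma taylor2_ge0 n x y : 0 <= x -> 0 <= y -> 0 <= taylor2 n x y.
Proof.
move=> x0 y0; elim: n => //= n IH.
by rewrite addr_ge0// mulr_ge0// exprn_ge0.
Qed.

Lemma modulus_taylor2 n a b :
  modulus (taylor2 n a b) <= taylor2 n (modulus a) (modulus b).
Proof.
elim: n => [|n IH] /=; first by rewrite modulus0.
apply: modulusD_le; rewrite modulusM; first by rewrite ler_wpM2l ?modulus_ge0.
by rewrite modulusX -(rmorph_nat (real_complex R)) modulus_real ger0_norm.
Qed.

Lemma taylor2_mono n x x' y y' : 0 <= x -> x <= x' -> 0 <= y -> y <= y' ->
  taylor2 n x y <= taylor2 n x' y'.
Proof.
move=> x0 xx' y0 yy'; elim: n => //= n IH; apply: lerD.
  by rewrite ler_pM ?taylor2_ge0.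
by rewrite ler_wpM2l// lerXn2r ?nnegrE// (le_trans x0).
Qed.

Definition remainder n a b := b ^+ n - a ^+ n - n%:R * a ^+ n.-1 * (b - a).

(** The Bregman divergence of [|z|^p], as [|z|^p = |z ^+ n|^2]. *)
Definition bregman n a b : R := modulus (b ^+ n) ^+ 2 - modulus (a ^+ n) ^+ 2 -
  2 * complex.Re (conjc (a ^+ n) * (n%:R * a ^+ n.-1 * (b - a))).

(** The form in which increments of [b ^+ n] appear: an error term for the
    linearization, against a square. *)
Lemma bregmanE n a b : bregman n a b = modulus (b ^+ n - a ^+ n) ^+ 2 +
  2 * complex.Re (conjc (a ^+ n) * remainder n a b).
Proof.
rewrite /bregman /remainder; set L := n%:R * _ * _.
rewrite [conjc _ * (_ - L)]mulrBr Re_add Re_opp.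
have := sqr_modulusD (a ^+ n) (b ^+ n - a ^+ n); rewrite [a ^+ n + _]addrC subrK => ->.
ring.
Qed.

Lemma bregman_scale n s a b : (0 < n)%N ->
  bregman n (s * a) (s * b) = modulus (s ^+ n) ^+ 2 * bregman n a b.
Proof.
case: n => // n _; rewrite /bregman /= -mulrBr !exprMn !(modulusM (s ^+ n.+1)).
have -> : conjc (s ^+ n.+1 * a ^+ n.+1) *
    (n.+1%:R * (s ^+ n * a ^+ n) * (s * (b - a))) =
    (modulus (s ^+ n.+1) ^+ 2)%:C *
    (conjc (a ^+ n.+1) * (n.+1%:R * a ^+ n * (b - a))).
  rewrite -mulc_conj rmorphM /=.
  by move: (conjc (s ^+ _)) (conjc (a ^+ _)) => sc ac; rewrite [s ^+ n.+1]exprSr; ring.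
by rewrite Re_realM; ring.
Qed.

Lemma remainder_scale n s a b : (0 < n)%N ->
  remainder n (s * a) (s * b) = s ^+ n * remainder n a b.
Proof.
by case: n => // n _; rewrite /remainder /= !exprMn [s ^+ n.+1]exprSr; ring.
Qed.

(** Both terms are nonnegative, and the second one bounds [|c - 1|^2]. *)
Let bregman1 n c : bregman n 1 c =
  (modulus c ^+ 2 - 1) ^+ 2 * taylor2 n 1 (modulus c ^+ 2) +
  n%:R * modulus (c - 1) ^+ 2.
Proof.
rewrite /bregman !expr1n !mulr1 conjc1 mul1r -(rmorph_nat (real_complex R)).
rewrite Re_realM Re_add Re_opp /= modulus1 expr1n -taylor2E !expr1n mulr1.
have -> : modulus (c - 1) ^+ 2 = modulus c ^+ 2 - 2 * complex.Re c + 1.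
  by rewrite !sqr_modulus Re_add Im_add Re_opp Im_opp /=; ring.
rewrite modulusX -!exprM [(n * 2)%N]mulnC; ring.
Qed.

(** By homogeneity [a] may be taken equal to 1. If [|b| <= 2], then both sides
    are comparable to [|b - 1|^2]; otherwise the first term of [bregman1]
    dominates the remainder, as [|b - 1| <= |b|^2 - 1] and [|b| <= |b|^2]. *)
Lemma remainder_le_bregman n : (0 < n)%N -> exists2 C : R, 0 < C &
  forall a b, modulus (remainder n a b) * modulus (a ^+ n) <= C * bregman n a b.
Proof.
move=> n0; have s0 : 0 <= taylor2 n 1 (2 : R) by exact: taylor2_ge0.
exists (1 + taylor2 n 1 2); first by rewrite ltr_pwDl.
have K c : modulus (remainder n 1 c) <= (1 + taylor2 n 1 2) * bregman n 1 c.
  have u0 : 0 <= modulus (c - 1) ^+ 2 by rewrite sqr_ge0.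
  have n1 : 1 <= n%:R :> R by rewrite ler1n.
  have y0 : 0 <= modulus c ^+ 2 by rewrite sqr_ge0.
  have t0 : 0 <= (modulus c ^+ 2 - 1) ^+ 2 * taylor2 n 1 (modulus c ^+ 2).
    by rewrite mulr_ge0 ?sqr_ge0// taylor2_ge0.
  have nu : modulus (c - 1) ^+ 2 <= n%:R * modulus (c - 1) ^+ 2.
    by rewrite ler_peMl.
  have -> : remainder n 1 c = (c - 1) ^+ 2 * taylor2 n 1 c.
    by rewrite /remainder taylor2E.
  rewrite modulusM modulusX bregman1; set U := modulus (c - 1) ^+ 2 in u0 nu *.
  have m := modulus_taylor2 n 1 c; rewrite modulus1 in m.
  have c0 := modulus_ge0 c.
  have [c2|c2] := lerP (modulus c) 2.
    apply: (@le_trans _ _ (U * taylor2 n 1 2)).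
      by rewrite ler_wpM2l// (le_trans m)// taylor2_mono.
    rewrite mulrC ler_pM//; first by rewrite lerDr.
    by apply: le_trans nu _; rewrite lerDr.
  apply: (@le_trans _ _ ((modulus c ^+ 2 - 1) ^+ 2 * taylor2 n 1 (modulus c ^+ 2))).
    apply: ler_pM => //; first exact: modulus_ge0.
      have h : modulus (c - 1) <= modulus c ^+ 2 - 1.
        apply: le_trans (modulusBD _ _) _; rewrite modulus1.
        have : 2 * (modulus c + 1) <= modulus c * (modulus c + 1).
          by rewrite ler_wpM2r ?addr_ge0// ltW.
        by rewrite expr2; lra.
      by rewrite lerXn2r ?nnegrE ?modulus_ge0// (le_trans (modulus_ge0 _) h).
    apply: le_trans m _; apply: taylor2_mono => //.
    by rewrite expr2 ler_peMl//; lra.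
  set V := _ * taylor2 n 1 (modulus c ^+ 2) in t0 *.
  apply: (@le_trans _ _ (1 * (V + n%:R * U))).
    by rewrite mul1r lerDl (le_trans u0).
  by rewrite ler_wpM2r ?lerDl// addr_ge0// (le_trans u0).
move=> a b; have [->|a0] := eqVneq a 0.
  have n00 : (0 : R[i]) ^+ n = 0 by rewrite expr0n gtn_eqF.
  have -> : bregman n 0 b = modulus (b ^+ n) ^+ 2.
    by rewrite /bregman n00 rmorph0 mul0r modulus0 /=; ring.
  by rewrite n00 modulus0 mulr0 mulr_ge0 ?sqr_ge0// addr_ge0.
have E : b = a * (b / a) by rewrite mulrCA divff ?mulr1.
rewrite E -[X in remainder n X]mulr1 -[X in bregman n X]mulr1.
rewrite remainder_scale// bregman_scale// modulusM mulrAC -expr2 mulrCA.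
by rewrite ler_wpM2l ?sqr_ge0.
Qed.

Lemma bregman_ge0 n a b : (0 < n)%N -> 0 <= bregman n a b.
Proof.
move=> /remainder_le_bregman[C C0 /(_ a b)] h.
rewrite -(pmulr_rge0 _ C0); apply: le_trans h.
by rewrite mulr_ge0 ?modulus_ge0.
Qed.

Lemma bregman_le n : (0 < n)%N -> exists2 K : R, 0 <= K &
  forall a h (e : R), `|e| <= 1 -> bregman n a (a + e%:C * h) <=
    e ^+ 2 * (K * (modulus (a ^+ n) ^+ 2 + modulus (h ^+ n) ^+ 2)).
Proof.
move=> n0; pose K := (n%:R * 2 ^+ n) ^+ 2 + 2 * taylor2 n 1 2 : R.
have s0 : 0 <= taylor2 n 1 (2 : R) by exact: taylor2_ge0.
have K0 : 0 <= K by rewrite addr_ge0 ?sqr_ge0// mulr_ge0.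
exists K => // a h e e1.
have unit a' h' : modulus a' <= 1 -> modulus h' <= 1 ->
    bregman n a' (a' + e%:C * h') <= e ^+ 2 * K.
  move=> a1 h1; set b := a' + _.
  have b2 : modulus b <= 2.
    rewrite -[2]/(1 + 1); apply: modulusD_le => //.
    by rewrite modulusM modulus_real -[1]mul1r ler_pM ?modulus_ge0.
  have ba : b - a' = e%:C * h' by rewrite /b addrC addKr.
  have mba : modulus (b - a') <= `|e|.
    by rewrite ba modulusM modulus_real ler_piMr.
  rewrite bregmanE /K [leRHS]mulrDr; apply: lerD.
    rewrite -(real_normK (num_real e)) -exprMn.
    rewrite lerXn2r ?nnegrE ?modulus_ge0 ?mulr_ge0 ?exprn_ge0//.
    rewrite subrXX modulusM ler_pM ?modulus_ge0//.
    apply: le_trans (modulus_sum _ _ _) _.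
    apply: (@le_trans _ _ (\sum_(i < n) (2 : R) ^+ n)); last first.
      by rewrite sumr_const card_ord mulr_natl.
    apply: ler_sum => i _; rewrite modulusM !modulusX -[leRHS]mulr1.
    rewrite ler_pM ?exprn_ge0 ?modulus_ge0 ?exprn_ile1 ?modulus_ge0//.
    apply: (@le_trans _ _ (2 ^+ (n.-1 - i))).
      by rewrite lerXn2r ?nnegrE ?modulus_ge0.
    rewrite ler_weXn2l ?ler1n// (leq_trans (leq_subr _ _))//.
    exact: leq_pred.
  rewrite mulrCA ler_wpM2l//; apply: le_trans (Re_le_modulus _) _.
  rewrite modulusM modulus_conj modulusX /remainder taylor2E.
  rewrite -[leRHS]mul1r ler_pM ?exprn_ge0 ?modulus_ge0 ?exprn_ile1 ?modulus_ge0//.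
  rewrite modulusM modulusX ler_pM ?exprn_ge0 ?modulus_ge0//.
    by rewrite -(real_normK (num_real e)) lerXn2r ?nnegrE ?modulus_ge0.
  apply: le_trans (modulus_taylor2 _ _ _) _.
  by apply: taylor2_mono; rewrite ?modulus_ge0.
pose T := Num.max (modulus a) (modulus h).
have aT : modulus a <= T by rewrite le_max lexx.
have hT : modulus h <= T by rewrite le_max lexx orbT.
have T0 : 0 <= T := le_trans (modulus_ge0 a) aT.
have TS : (T ^+ n) ^+ 2 <= modulus (a ^+ n) ^+ 2 + modulus (h ^+ n) ^+ 2.
  rewrite /T !modulusX; case: (leP (modulus a) (modulus h)) => _; first by rewrite lerDr sqr_ge0.
  by rewrite lerDl sqr_ge0.
apply: (@le_trans _ _ (e ^+ 2 * (K * (T ^+ n) ^+ 2))); last first.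
  by rewrite ler_wpM2l ?sqr_ge0// ler_wpM2l.
have [T00|Tn0] := eqVneq T 0.
  have /eqP : modulus a = 0 by apply/le_anti; rewrite modulus_ge0 -{1}T00 aT.
  have /eqP : modulus h = 0 by apply/le_anti; rewrite modulus_ge0 -{1}T00 hT.
  rewrite !modulus_eq0 => /eqP -> /eqP ->; rewrite mulr0 addr0 /bregman.
  rewrite !(subrr, mulr0) /= ?mulr0 ?subr0.
  apply: mulr_ge0; first exact: sqr_ge0.
  by apply: mulr_ge0 => //; exact: sqr_ge0.
have TC : (T%:C : R[i]) != 0 by rewrite (inj_eq (@complexI R)).
have Tp : 0 < T by rewrite lt0r Tn0.
have mT z : modulus z <= T -> modulus (z / T%:C) <= 1.
  by move=> zT; rewrite modulusM modulusV modulus_real ger0_norm// ler_pdivrMr// mul1r.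
have -> : a = T%:C * (a / T%:C) by rewrite mulrCA divff ?mulr1.
have -> : h = T%:C * (h / T%:C) by rewrite mulrCA divff ?mulr1.
rewrite [e%:C * _]mulrCA -mulrDr bregman_scale// modulusX modulus_real ger0_norm//.
rewrite [leRHS]mulrA mulrC ler_wpM2r ?sqr_ge0//.
by apply: unit; exact: mT.
Qed.

End Bregman.

(** * Bergman spaces with exponent [2 n] *)

Section BergmanSpace.
Context {R : realType}.
Local Notation T2 := (measurableTypeR R * measurableTypeR R)%type.
Local Notation sig := (@sigma R).
Local Notation D := (@rdisc R 1).
Implicit Types (e : R) (i j k l m N M : nat) (w : T2) (f g h : R[i] -> R[i])
  (a b : nat -> R[i]) (c lam z : R[i]).
Hint Resolve measurable_D : core.

Lemma analyticD f g : analytic_on_disc f -> analytic_on_disc g ->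
  analytic_on_disc (fun z => f z + g z).
Proof. by move=> af ag z dz; apply: derivableD; [exact: af|exact: ag]. Qed.

Lemma analyticM f g : analytic_on_disc f -> analytic_on_disc g ->
  analytic_on_disc (fun z => f z * g z).
Proof. by move=> af ag z dz; apply: derivableM; [exact: af|exact: ag]. Qed.

Lemma analytic_cst c : analytic_on_disc (fun=> c).
Proof. by move=> z dz; exact: derivable_cst. Qed.

Lemma analytic_id : analytic_on_disc (fun z : R[i] => z).
Proof. by move=> z dz; exact: derivable_id. Qed.

Lemma analyticX f m : analytic_on_disc f -> analytic_on_disc (fun z => f z ^+ m).
Proof.
move=> af; elim: m => [|m IH]; first exact: analytic_cst.
rewrite (_ : (fun _ => _) = fun z => f z * f z ^+ m); first exact: analyticM.
by apply/funext => z; rewrite exprS.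
Qed.

Lemma disc_scale lam z : modulus lam <= 1 -> disc z -> disc (lam * z).
Proof.
move=> l1 dz; apply: le_lt_trans dz.
by rewrite modulusM ler_piMl// modulus_ge0.
Qed.

Lemma analytic_dilation f lam : modulus lam <= 1 -> analytic_on_disc f ->
  analytic_on_disc (fun z => f (lam * z)).
Proof.
move=> l1 af z dz; apply/derivable_modulusP.
have /derivable_modulusP[d Hd] := af _ (disc_scale l1 dz).
exists (d * lam) => e e0; have [del del0 H] := Hd e e0; exists del => // w wz.
have lwz : modulus (lam * w - lam * z) <= modulus (w - z).
  by rewrite -mulrBr modulusM ler_piMl// modulus_ge0.
have := H (lam * w) (le_lt_trans lwz wz).
rewrite -mulrBr mulrA => /le_trans; apply; apply: ler_wpM2l.
  exact: ltW.
by rewrite mulrBr.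
Qed.

Lemma cmeasurable_analytic f : analytic_on_disc f ->
  cmeasurable D (fun w => f (pt w)).
Proof. by move=> /analytic_taylor[a /cmeasurable_taylor]. Qed.

Lemma analytic_sq_integrable f : analytic_on_disc f -> square_integrable f ->
  sig.-integrable D (EFin \o (fun w => modulus (f (pt w)) ^+ 2)).
Proof. by move=> /analytic_taylor[a fa]; exact: square_integrable_integrable fa. Qed.

Lemma square_integrable_le f g h (C : R) : analytic_on_disc f ->
  analytic_on_disc g -> analytic_on_disc h ->
  square_integrable g -> square_integrable h -> 0 <= C ->
  (forall z, disc z -> modulus (f z) ^+ 2 <=
     C * (modulus (g z) ^+ 2 + modulus (h z) ^+ 2)) ->
  square_integrable f.
Proof.
move=> af ag ah sg sh C0 H.
have ig := analytic_sq_integrable ag sg; have ih := analytic_sq_integrable ah sh.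
pose u w := C * (modulus (g (pt w)) ^+ 2 + modulus (h (pt w)) ^+ 2).
have I : sig.-integrable D (EFin \o u).
  have := integrableZl measurable_D C (integrableD measurable_D ig ih).
  by apply: eq_integrable => // w _; rewrite /u /= EFinM EFinD.
rewrite /square_integrable /sqint.
apply: (@le_lt_trans _ _ (\int[sig]_(w in D) ((u w)%:E))%E).
  have mm : measurable_fun D (fun w => (modulus (f (pt w)) ^+ 2)%:E).
    have [a fa] := analytic_taylor af.
    by have /measurable_EFinP := measurable_sqmod fa (lexx _).
  apply: ge0_le_integral => //.
  - by move=> w _; rewrite lee_fin sqr_ge0.
  - by have := measurable_int _ I.
  - by move=> w Dw; rewrite /= lee_fin H.
by have := integrable_fin_num measurable_D I; rewrite fin_numElt => /andP[].
Qed.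

(** The Bergman space with exponent [2 n]: by [|h|^(2 n) = |h ^+ n|^2], only
    square integrability is involved. *)
Definition bergman_space n h :=
  analytic_on_disc h /\ square_integrable (fun z => h z ^+ n).

Lemma bergman_spaceD n g h : bergman_space n g -> bergman_space n h ->
  bergman_space n (fun z => g z + h z).
Proof.
move=> [ag sg] [ah sh]; split; first exact: analyticD.
apply: (@square_integrable_le _ (fun z => g z ^+ n) (fun z => h z ^+ n) ((2 ^+ n) ^+ 2)).
- exact/analyticX/analyticD.
- exact: analyticX.
- exact: analyticX.
- by [].
- by [].
- exact: sqr_ge0.
move=> z _; set T := Num.max (modulus (g z)) (modulus (h z)).
have gT : modulus (g z) <= T by rewrite le_max lexx.
have hT : modulus (h z) <= T by rewrite le_max lexx orbT.
have T0 : 0 <= T := le_trans (modulus_ge0 _) gT.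
apply: (@le_trans _ _ ((2 ^+ n) ^+ 2 * (T ^+ n) ^+ 2)).
  rewrite -exprMn -exprMn modulusX lerXn2r ?nnegrE ?exprn_ge0 ?mulr_ge0 ?modulus_ge0//.
  rewrite lerXn2r ?nnegrE ?mulr_ge0 ?modulus_ge0//.
  by rewrite mulr_natl mulr2n modulusD_le.
rewrite ler_wpM2l ?sqr_ge0// /T !modulusX.
case: (leP (modulus (g z)) (modulus (h z))) => _.
  by rewrite lerDr sqr_ge0.
by rewrite lerDl sqr_ge0.
Qed.

Lemma bergman_spaceM n g h (C : R) : analytic_on_disc g -> 0 <= C ->
  (forall z, disc z -> modulus (g z) <= C) ->
  bergman_space n h -> bergman_space n (fun z => g z * h z).
Proof.
move=> ag C0 gC [ah sh]; split; first exact: analyticM.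
apply: (@square_integrable_le _ (fun z => h z ^+ n) (fun z => h z ^+ n) ((C ^+ n) ^+ 2)).
- exact/analyticX/analyticM.
- exact: analyticX.
- exact: analyticX.
- by [].
- by [].
- exact: sqr_ge0.
move=> z dz; rewrite exprMn modulusM exprMn; apply: ler_pM; rewrite ?sqr_ge0//.
  rewrite modulusX lerXn2r ?nnegrE ?exprn_ge0 ?modulus_ge0//.
  by rewrite lerXn2r ?nnegrE ?modulus_ge0// gC.
by rewrite lerDl sqr_ge0.
Qed.

Lemma bergman_spaceZ n c h : bergman_space n h -> bergman_space n (fun z => c * h z).
Proof.
by apply: (@bergman_spaceM n (fun=> c) h (modulus c)) => //; exact: modulus_ge0.
Qed.

Lemma bergman_space_shift n m h : bergman_space n h ->
  bergman_space n (fun z => z ^+ m * h z).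
Proof.
apply: (@bergman_spaceM n (fun z => z ^+ m) h 1) => //.
  exact/analyticX/analytic_id.
by move=> z dz; rewrite modulusX exprn_ile1 ?modulus_ge0// ltW.
Qed.

Lemma bergman_space_dilation n lam h : modulus lam <= 1 -> bergman_space n h ->
  bergman_space n (fun z => h (lam * z)).
Proof.
move=> l1 [ah sh]; split; first exact: analytic_dilation.
have [a ha] := analytic_taylor (analyticX (m := n) ah).
have [B HB] := (square_integrable_wnorm ha).1 sh.
apply/(square_integrable_wnorm (taylor_dilation l1 ha)); exists B => N.
apply: le_trans (HB N); rewrite !wnormE; apply: ler_sum => i _.
rewrite ler_wpM2r ?invr_ge0// modulusM modulusX exprMn ler_piMr ?sqr_ge0//.
by rewrite -exprM exprn_ile1 ?modulus_ge0.
Qed.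

Lemma taylor_one : taylor_expansion (fun=> 1) (fun i => (i == 0%N)%:R : R[i]).
Proof.
apply/taylor_expansionP => z _ e e0; exists 1%N => -[//|N] _.
rewrite big_ord_recl big1 ?addr0 => [|i _]; last by rewrite mul0r.
by rewrite mul1r expr0 subrr modulus0 ltW.
Qed.

Lemma bergman_space1 n : bergman_space n (fun=> 1).
Proof.
split; first exact: analytic_cst.
have t1 := taylor_one.
have E : (fun _ : R[i] => (1 : R[i]) ^+ n) = fun=> 1.
  by apply/funext => z; rewrite expr1n.
rewrite E; apply/(square_integrable_wnorm t1); exists 1 => N.
rewrite wnormE; case: N => [|N]; first by rewrite big_ord0.
rewrite big_ord_recl big1 ?addr0 => [|i _]; last first.
  by rewrite modulus0 expr0n mul0r.
by rewrite modulus1 expr1n divr1.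
Qed.

Lemma le1_modulusX (x : R[i]) n : (0 < n)%N -> modulus x ^+ 2 <= 1 + modulus (x ^+ n) ^+ 2.
Proof.
move=> n0; rewrite modulusX -exprM mulnC exprM.
have y0 := sqr_ge0 (modulus x); set y := modulus x ^+ 2 in y0 *.
have [y1|y1] := leP y 1; first by rewrite (le_trans y1)// lerDl exprn_ge0.
rewrite (@le_trans _ _ (y ^+ n))// ?lerDr// -[leLHS]expr1.
by rewrite ler_weXn2l// ltW.
Qed.

Lemma bergman_square_integrable n h : (0 < n)%N -> bergman_space n h ->
  square_integrable h.
Proof.
move=> n0 [ah sh].
have [_] := bergman_space1 0.
have -> : (fun _ : R[i] => (1 : R[i]) ^+ 0) = fun=> 1 by apply/funext.
move=> s1.
have H := @square_integrable_le h (fun=> 1) (fun z => h z ^+ n) 1 ah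
  (@analytic_cst 1) (analyticX ah) s1 sh ler01.
by apply: H => z dz; rewrite mul1r modulus1 expr1n le1_modulusX.
Qed.

End BergmanSpace.

(** * The Euler-Lagrange equation of the extremal function *)
Section Extremal.
Context {R : realType}.
Local Notation T2 := (measurableTypeR R * measurableTypeR R)%type.
Local Notation sig := (@sigma R).
Local Notation D := (@rdisc R 1).
Implicit Types (e y : R) (m : nat) (w : T2) (f g h : R[i] -> R[i]) (z : R[i]).
Hint Resolve measurable_D : core.

Variable n : nat.
Hypothesis n0 : (0 < n)%N.

Let p0 : 0 < (n.*2)%:R :> R. Proof. by rewrite ltr0n double_gt0. Qed.

Let psq h := sqint (fun z => h z ^+ n).

Lemma bergman_norm_even h :
  bergman_norm (n.*2)%:R h = (psq h `^ ((n.*2)%:R^-1))%E.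
Proof.
rewrite /bergman_norm /psq /sqint; congr (_ `^ _)%E; apply: eq_integral => w _.
by rewrite powR_mulrn ?modulus_ge0// modulusX -exprM muln2.
Qed.

Lemma bergman_spaceP h : bergman (n.*2)%:R h <-> bergman_space n h.
Proof.
have pV : 0 < (n.*2)%:R^-1 :> R by rewrite invr_gt0.
rewrite /bergman /bergman_space /= bergman_norm_even /square_integrable -/(psq h).
have := sqint_ge0 (fun z => h z ^+ n); rewrite -/(psq h).
by case: (psq h) => [r| |]//= _; rewrite ?gt_eqF// !ltry.
Qed.

Lemma bergman_norm1P h :
  bergman_norm (n.*2)%:R h = 1%E <-> sqint (fun z => h z ^+ n) = 1%E.
Proof.
have pV : 0 < (n.*2)%:R^-1 :> R by rewrite invr_gt0.
rewrite bergman_norm_even /psq; have := sqint_ge0 (fun z => h z ^+ n).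
case: (sqint _) => [r| |]//= r0; last by rewrite gt_eqF.
split=> -[] E; last by rewrite E powR1.
rewrite lee_fin in r0; congr (_%:E).
transitivity ((r `^ (n.*2)%:R^-1) `^ (n.*2)%:R); last by rewrite E powR1.
by rewrite -powRrM mulVf ?lt0r_neq0// powRr1.
Qed.

Variables (k F : R[i] -> R[i]) (c : nat -> R[i]) (K : R).
Hypotheses (kc : taylor_expansion k c) (kK : forall z, disc z -> modulus (k z) <= K).
Hypothesis extremal : extremal_function (n.*2)%:R k F.

Local Notation phi := (functional_of_kernel k).
Let N := complex.Re (phi F).

Lemma extremal_bergman : bergman_space n F.
Proof. by case: extremal => /bergman_spaceP. Qed.

Lemma extremal_norm : sqint (fun z => F z ^+ n) = 1%E.
Proof. by case: extremal => _ /bergman_norm1P. Qed.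

Lemma extremal_sup g : bergman_space n g -> sqint (fun z => g z ^+ n) = 1%E ->
  complex.Re (phi g) <= N.
Proof.
move=> bg g1; rewrite -lee_fin; case: extremal => _ _ ->.
have G : bergman (n.*2)%:R g /\ bergman_norm (n.*2)%:R g = 1%E.
  by split; [apply/bergman_spaceP|apply/bergman_norm1P].
by apply: ereal_sup_ubound; exact: (imageP (fun g => (complex.Re (phi g))%:E) G).
Qed.

Lemma kernel_integrable h : bergman_space n h ->
  cintegrable sig D (fun w => h (pt w) * conjc (k (pt w))).
Proof.
move=> bh; have [ah sh] := bh.
have ih := analytic_sq_integrable (analyticX (m := n) ah) sh.
have K0 : 0 <= K.
  by apply: le_trans (modulus_ge0 (k 0)) (kK _); rewrite /disc /= modulus0.
have i1 : sig.-integrable D (EFin \o (fun=> 1 : R)).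
  apply/integrableP; split; first exact: measurable_cst.
  rewrite (eq_integral (fun=> 1%E)) => [|w _]; last by rewrite /= normr1.
  by rewrite integral_cst// mul1e sigma_rdisc.
apply: (@cintegrable_le _ _ _ _ _ _
    (fun w => K * (1 + (1 + modulus (h (pt w) ^+ n) ^+ 2)))) => //.
- apply: cmeasurableM; first exact: cmeasurable_analytic.
  exact: cmeasurable_conj (cmeasurable_taylor kc).
- have := integrableZl measurable_D K (integrableD measurable_D i1
    (integrableD measurable_D i1 ih)).
  by apply: eq_integrable => // w _ /=; rewrite EFinM !EFinD.
move=> w Dw; rewrite modulusM modulus_conj mulrC ler_pM ?modulus_ge0 ?kK//.
have := le1_modulusX (h (pt w)) n0; set x := modulus (h _) => hx.
apply: le_trans (lerD (lexx 1) hx); have := sqr_ge0 (x - 1 / 2).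
by rewrite sqrrB; have := modulus_ge0 (h (pt w)); rewrite -/x; lra.
Qed.

Lemma phiD g h : bergman_space n g -> bergman_space n h ->
  phi (fun z => g z + h z) = phi g + phi h.
Proof.
move=> bg bh; rewrite -[phi g + _](@cintD _ _ _ sig D)//; try exact: kernel_integrable.
by apply: eq_cint => w _; rewrite mulrDl.
Qed.

Lemma phiZ (a : R[i]) h : bergman_space n h -> phi (fun z => a * h z) = a * phi h.
Proof.
move=> bh; rewrite -[a * phi h](@cintZ _ _ _ sig D)//; last exact: kernel_integrable.
by apply: eq_cint => w _; rewrite mulrA.
Qed.

Lemma extremal_value_ge0 : 0 <= N.
Proof.
have bN := bergman_spaceZ (-1) extremal_bergman.
have h : sqint (fun z => (-1 * F z) ^+ n) = 1%E.
  rewrite -extremal_norm; apply: eq_integral => w _.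
  by rewrite !modulusX mulN1r modulusN.
have := extremal_sup bN h; rewrite phiZ ?mulN1r ?Re_opp; last exact: extremal_bergman.
by rewrite -/N; lra.
Qed.

(** Homogeneity removes the normalization; the power of the norm is then
    linearized by Bernoulli's inequality. *)
Lemma extremal_ineq g y : bergman_space n g -> 0 < y ->
  sqint (fun z => g z ^+ n) = y%:E ->
  complex.Re (phi g) <= N * (1 + (y - 1) / (n.*2)%:R).
Proof.
move=> bg y0 gy; pose t := y `^ ((n.*2)%:R^-1).
have t0 : 0 < t by exact: powR_gt0.
have tn : t ^+ n.*2 = y.
  rewrite -powR_mulrn; last exact: ltW.
  by rewrite /t -powRrM mulVf ?lt0r_neq0// powRr1// ltW.
have tV : modulus (t^-1%:C : R[i]) = t^-1.
  by rewrite modulus_real ger0_norm// invr_ge0 ltW.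
have bs := bergman_spaceZ (t^-1%:C) bg.
have s1 : sqint (fun z => (t^-1%:C * g z) ^+ n) = 1%E.
  transitivity (\int[sig]_(w in D) ((y^-1)%:E * (modulus (g (pt w) ^+ n) ^+ 2)%:E))%E.
    apply: eq_integral => w _; rewrite -EFinM exprMn modulusM exprMn.
    by rewrite (modulusX (t^-1)%:C) tV -exprM muln2 exprVn tn.
  rewrite ge0_integralZl//; first last.
  - by rewrite lee_fin invr_ge0 ltW.
  - by move=> w _; rewrite lee_fin sqr_ge0.
  - have [a ga] := analytic_taylor (analyticX (m := n) bg.1).
    by have /measurable_EFinP := measurable_sqmod ga (lexx _).
  by rewrite -/(sqint (fun z => g z ^+ n)) gy -EFinM mulVf// gt_eqF.
have := extremal_sup bs s1; rewrite phiZ// Re_realM mulrC ler_pdivrMr// => h.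
apply: le_trans h _; rewrite ler_wpM2l ?extremal_value_ge0//.
have := @bregman_ge0 R n 1 t%:C n0; rewrite /bregman !expr1n mulr1 conjc1 mul1r.
rewrite modulus1 modulusX modulus_real ger0_norm ?(ltW t0)// -exprM muln2 tn expr1n.
rewrite -(rmorph_nat (real_complex R)) Re_realM Re_add Re_opp /= => h2.
rewrite -lerBlDl ler_pdivlMr// -muln2 natrM; move: h2; lra.
Qed.

(** The functional that the Euler-Lagrange equation identifies with [phi]. *)
Definition dual_form h := disc_integral (fun z =>
  conjc (F z ^+ n) * (F z ^+ n.-1 * h z)).

Lemma dual_integrable h : bergman_space n h ->
  cintegrable sig D (fun w => conjc (F (pt w) ^+ n) * (F (pt w) ^+ n.-1 * h (pt w))).
Proof.
move=> [ah sh]; have [aF sF] := extremal_bergman.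
have ih := analytic_sq_integrable (analyticX (m := n) ah) sh.
have iF := analytic_sq_integrable (analyticX (m := n) aF) sF.
apply: (@cintegrable_le _ _ _ _ _ _
    (fun w => modulus (F (pt w) ^+ n) ^+ 2 + modulus (h (pt w) ^+ n) ^+ 2)) => //.
- apply: cmeasurableM.
    by apply/cmeasurable_conj/cmeasurableX; exact: cmeasurable_analytic.
  apply: cmeasurableM; last exact: cmeasurable_analytic.
  by apply: cmeasurableX; exact: cmeasurable_analytic.
- have := integrableD measurable_D iF ih.
  by apply: eq_integrable.
move=> w Dw; rewrite modulusM modulus_conj modulusM !modulusX.
set x := modulus (F _); set y := modulus (h _).
have x0 : 0 <= x by exact: modulus_ge0.
have y0 : 0 <= y by exact: modulus_ge0.
have xE : x ^+ n.-1 * x = x ^+ n by rewrite -exprSr prednK.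
have yE : y ^+ n.-1 * y = y ^+ n by rewrite -exprSr prednK.
have [xy|/ltW yx] := leP x y.
  apply: (@le_trans _ _ ((y ^+ n) ^+ 2)); last by rewrite lerDr sqr_ge0.
  rewrite [leRHS]expr2 -[X in _ <= _ * X]yE ler_pM ?mulr_ge0 ?exprn_ge0//.
    by rewrite lerXn2r.
  by rewrite ler_wpM2r// lerXn2r.
apply: (@le_trans _ _ ((x ^+ n) ^+ 2)); last by rewrite lerDl sqr_ge0.
by rewrite [leRHS]expr2 ler_wpM2l ?exprn_ge0// -[leRHS]xE ler_wpM2l ?exprn_ge0.
Qed.

Lemma dual_formZ (a : R[i]) h : bergman_space n h ->
  dual_form (fun z => a * h z) = a * dual_form h.
Proof.
move=> bh; rewrite -[a * dual_form h](@cintZ _ _ _ sig D)//; last exact: dual_integrable.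
by apply: eq_cint => w _; ring.
Qed.

Let bergman_spaceB g h : bergman_space n g -> bergman_space n h ->
  bergman_space n (fun z => g z - h z).
Proof.
move=> bg bh; have := bergman_spaceD bg (bergman_spaceZ (-1) bh).
by under eq_fun do rewrite mulN1r.
Qed.

Definition psqint g : R := \int[sig]_(w in D) modulus (g (pt w) ^+ n) ^+ 2.

Lemma psqintE g : bergman_space n g -> sqint (fun z => g z ^+ n) = (psqint g)%:E.
Proof.
move=> [ag sg]; rewrite -[RHS]/((fine (sqint (fun z => g z ^+ n)))%:E).
by rewrite fineK// ge0_fin_numE ?sqint_ge0.
Qed.

Lemma psqint_integrable g : bergman_space n g ->
  sig.-integrable D (EFin \o (fun w => modulus (g (pt w) ^+ n) ^+ 2)).
Proof. by move=> [ag sg]; exact: analytic_sq_integrable (analyticX (m := n) ag) sg. Qed.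

Lemma psqint_extremal : psqint F = 1.
Proof.
by have := extremal_norm; rewrite psqintE; [case|exact: extremal_bergman].
Qed.

(** The divergence is the gap in the first-order expansion of the power of the
    norm at [F]; its nonnegativity is the convexity of that power. *)
Lemma bregman_integral g : bergman_space n g ->
  sig.-integrable D (EFin \o (fun w => bregman n (F (pt w)) (g (pt w)))) /\
  \int[sig]_(w in D) bregman n (F (pt w)) (g (pt w)) =
  psqint g - 1 - (n.*2)%:R * complex.Re (dual_form (fun z => g z - F z)).
Proof.
move=> bg; have bF := extremal_bergman; have bh := bergman_spaceB bg bF.
set h := (fun z => g z - F z) in bh *.
have [iL _] := dual_integrable bh.
have ig := psqint_integrable bg; have iF := psqint_integrable bF.
set L := (fun w => complex.Re _) in iL.
have E w : bregman n (F (pt w)) (g (pt w)) =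
    modulus (g (pt w) ^+ n) ^+ 2 - modulus (F (pt w) ^+ n) ^+ 2 - (n.*2)%:R * L w.
  rewrite /bregman; congr (_ - _).
  rewrite (_ : conjc _ * _ = (n%:R)%:C *
      (conjc (F (pt w) ^+ n) * (F (pt w) ^+ n.-1 * h (pt w)))); last first.
    by rewrite rmorph_nat /h; ring.
  by rewrite Re_realM [LHS]mulrA -natrM mul2n.
have iE := integrableB measurable_D (integrableB measurable_D ig iF)
  (integrableZl measurable_D (n.*2)%:R iL).
have igF : sig.-integrable D (EFin \o (fun w =>
    modulus (g (pt w) ^+ n) ^+ 2 - modulus (F (pt w) ^+ n) ^+ 2)).
  by have := integrableB measurable_D ig iF; apply: eq_integrable.
have inL : sig.-integrable D (EFin \o (fun w => (n.*2)%:R * L w)).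
  by have := integrableZl measurable_D (n.*2)%:R iL; apply: eq_integrable.
split.
  by apply: eq_integrable iE => // w _ /=; rewrite E !EFinB EFinM.
under eq_Rintegral do rewrite E.
rewrite RintegralB// RintegralB// RintegralZl//.
by rewrite -/(psqint g) -/(psqint F) psqint_extremal.
Qed.

(** The Euler-Lagrange equation: the first variation of
    [Re (phi g) <= N * |g|] at [F] in the directions [h] and ['i * h]. *)
Theorem euler_lagrange h : bergman_space n h ->
  phi h = N%:C * dual_form h.
Proof.
have bF := extremal_bergman.
have ReE : forall h, bergman_space n h ->
    complex.Re (phi h) = N * complex.Re (dual_form h).
  move=> h0 bh; set A := complex.Re (phi h0); set L := complex.Re _.
  have [C C0 HC] := @bregman_le R n n0.
  pose W := C * (1 + psqint h0).
  have S0 : 0 <= psqint h0 by apply: Rintegral_ge0 => w _; exact: sqr_ge0.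
  have W0 : 0 <= W by rewrite mulr_ge0// addr_ge0.
  have p1 := p0.
  have V (e : R) : `|e| <= 1 -> `|e| * ((n.*2)%:R * `|L| + 1) <= 1 / 2 ->
      e * A <= e * (N * L) + e ^+ 2 * (N * W).
    move=> e1 e2; pose g z := F z + e%:C * h0 z.
    have beh := bergman_spaceZ (e%:C) bh.
    have bg : bergman_space n g by exact: bergman_spaceD.
    have [iB] := bregman_integral bg.
    have -> : dual_form (fun z => g z - F z) = e%:C * dual_form h0.
      rewrite -dual_formZ//; congr dual_form; apply/funext => z.
      by rewrite /g addrC addKr.
    rewrite Re_realM -/L => EB.
    have B0 : 0 <= \int[sig]_(w in D) bregman n (F (pt w)) (g (pt w)).
      by apply: Rintegral_ge0 => w _; exact: bregman_ge0.
    have BW : \int[sig]_(w in D) bregman n (F (pt w)) (g (pt w)) <= e ^+ 2 * W.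
      have iF := psqint_integrable bF; have ih := psqint_integrable bh.
      have iS : sig.-integrable D (EFin \o (fun w =>
          modulus (F (pt w) ^+ n) ^+ 2 + modulus (h0 (pt w) ^+ n) ^+ 2)).
        by have := integrableD measurable_D iF ih; apply: eq_integrable.
      have iU : sig.-integrable D (EFin \o (fun w => e ^+ 2 * C *
          (modulus (F (pt w) ^+ n) ^+ 2 + modulus (h0 (pt w) ^+ n) ^+ 2))).
        by have := integrableZl measurable_D (e ^+ 2 * C) iS; apply: eq_integrable.
      have -> : e ^+ 2 * W = \int[sig]_(w in D) (e ^+ 2 * C *
          (modulus (F (pt w) ^+ n) ^+ 2 + modulus (h0 (pt w) ^+ n) ^+ 2)).
        rewrite RintegralZl// RintegralD// -/(psqint F) -/(psqint h0).
        by rewrite psqint_extremal /W mulrA.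
      apply: le_Rintegral => // w _; rewrite -mulrA; exact: HC.
    set y := psqint g in EB.
    have eL : `|(n.*2)%:R * (e * L)| <= 1 / 2.
      apply: le_trans e2; rewrite normrM normr_nat normrM mulrCA.
      by rewrite ler_wpM2l// lerDl.
    have y0 : 0 < y.
      by move: eL; rewrite ler_norml => /andP[eL1 eL2]; move: EB B0; lra.
    have := extremal_ineq bg y0 (psqintE bg); rewrite phiD// phiZ// Re_add Re_realM.
    rewrite -/A -/N => h1.
    have h2 : (y - 1) / (n.*2)%:R <= e * L + e ^+ 2 * W.
      rewrite ler_pdivrMr// mulrDl [e * L * _]mulrC.
      have : e ^+ 2 * W <= e ^+ 2 * W * (n.*2)%:R.
        apply: ler_peMr; first by rewrite mulr_ge0 ?sqr_ge0.
        by rewrite ler1n double_gt0.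
      by move: EB BW; lra.
    have h3 : N * ((y - 1) / (n.*2)%:R) <= N * (e * L + e ^+ 2 * W).
      by rewrite ler_wpM2l// extremal_value_ge0.
    by move: h1; rewrite mulrDr mulr1; move: h3; lra.
  apply/eqP; rewrite -subr_eq0; apply/eqP; set d := A - N * L.
  apply/eqP; apply/negPn/negP => d0.
  have dp : 0 < `|d| by rewrite normr_gt0.
  pose M := (n.*2)%:R * `|L| + 1.
  have M1 : 1 <= M by rewrite /M lerDr mulr_ge0.
  have NW0 : 0 <= N * W by rewrite mulr_ge0// extremal_value_ge0.
  have Z0 : 0 < N * W + `|d| + 1 by rewrite ltr_wpDl// addr_ge0.
  pose t := Num.min (1 / 2 / M) (`|d| / 2 / (N * W + `|d| + 1)).
  have M0 : 0 < M by exact: lt_le_trans M1.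
  have t0 : 0 < t by rewrite lt_min !divr_gt0.
  have t1 : t <= 1 / 2 / M by rewrite ge_min lexx.
  have t2 : t <= `|d| / 2 / (N * W + `|d| + 1) by rewrite ge_min lexx orbT.
  have tM : t * M <= 1 / 2 by rewrite -ler_pdivlMr.
  have t11 : t <= 1.
    apply: le_trans t1 _; rewrite ler_pdivrMr//.
    by move: M1; lra.
  have tW : t * (N * W) <= `|d| / 2.
    apply: (@le_trans _ _ (t * (N * W + `|d| + 1))); last by rewrite -ler_pdivlMr.
    by rewrite ler_wpM2l ?(ltW t0)// -addrA lerDl addr_ge0.
  pose e := Num.sg d * t.
  have ne : `|e| = t by rewrite normrM normr_sg d0 mul1r gtr0_norm.
  have := V e; rewrite ne -/M => /(_ t11 tM).
  have e2 : e ^+ 2 = t ^+ 2 by rewrite -(real_normK (num_real e)) ne.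
  rewrite -lerBlDl -mulrBr -/d e2 /e mulrAC -normrEsg expr2 -mulrA mulrC.
  rewrite ler_pM2l// => h1; have := le_trans h1 tW; lra.
move=> bh; apply: complex_eqP; first by rewrite Re_realM ReE.
have iIm (x : R[i]) : complex.Re ('i * x) = - complex.Im x.
  by case: x => u v /=; ring.
have := ReE _ (bergman_spaceZ 'i bh); rewrite phiZ// dual_formZ// !iIm mulrN.
by move=> /oppr_inj ->; rewrite Im_realM.
Qed.

End Extremal.

(** * Coefficient pairings and rotations near the identity *)

Section Tails.
Context {R : realType}.
Implicit Types (u v : nat -> R) (B e : R).

Lemma sum_nat_nondecreasing u : (forall l, 0 <= u l) ->
  {homo (fun M => \sum_(l < M) u l) : M M' / (M <= M')%N >-> M <= M'}.
Proof.
move=> u0; apply/nondecreasing_seqP => M.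
by rewrite big_ord_recr /= lerDl.
Qed.

Lemma sum_tail u B : (forall l, 0 <= u l) -> (forall M, \sum_(l < M) u l <= B) ->
  forall e, 0 < e -> exists M0, forall M M', (M0 <= M)%N ->
    \sum_(l < M') u (M + l)%N <= e.
Proof.
move=> u0 uB e e0; pose S M := \sum_(l < M) u l.
have hs : has_sup (range S).
  by split; [exists (S 0%N); exists 0%N|exists B => _ [M _ <-]; exact: uB].
have [_ [M0 _ <-] h0] := sup_adherent e0 hs; exists M0 => M M' MM.
have h1 : S (M + M')%N <= sup (range S).
  by apply: sup_upper_bound => //; exists (M + M')%N.
have h2 : S M0 <= S M by exact: sum_nat_nondecreasing.
have : S (M + M')%N = S M + \sum_(l < M') u (M + l)%N by rewrite /S big_split_ord.
by lra.
Qed.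

Lemma sum_shift_le u B m M : (forall l, 0 <= u l) ->
  (forall M, \sum_(l < M) u l <= B) -> \sum_(l < M) u (l + m)%N <= B.
Proof.
move=> u0 uB; apply: le_trans (uB (m + M)%N).
rewrite big_split_ord /= -[leLHS]add0r; apply: lerD; first exact: sumr_ge0.
by apply: ler_sum => i _; rewrite addnC.
Qed.

End Tails.

Section Truncation.
Context {R : realType}.
Local Notation A1 := (area (1 : R)).
Implicit Types (f h : R[i] -> R[i]) (u v : nat -> R[i]) (e B t : R) (m M : nat).

Definition pair_sum m u v M : R[i] :=
  \sum_(l < M) u l * conjc (v (l + m)%N) / (l + m).+1%:R.

Lemma wsum_shift m u v M : wsum (shift m u) v (m + M) = pair_sum m u v M.
Proof.
rewrite /wsum big_split_ord /= big1 ?add0r; last first.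
  by move=> i _; rewrite /shift ltn_ord !mul0r.
apply: eq_bigr => i _; rewrite /shift ltnNge leq_addr /= addKn.
by rewrite addnC.
Qed.

Lemma square_integrable_shift m f u : taylor_expansion f u ->
  square_integrable f -> square_integrable (fun z => z ^+ m * f z).
Proof.
move=> fu /(square_integrable_wnorm fu)[B HB].
apply/(square_integrable_wnorm (taylor_shift (m := m) fu)); exists B => M.
have [Mm|/ltnW mM] := leqP M m.
  rewrite wnormE big1; first exact: le_trans (wnorm_ge0 u 1 0) (HB 0%N).
  by move=> i _; rewrite /shift (leq_trans (ltn_ord i) Mm) modulus0 expr0n mul0r.
rewrite -(subnKC mM); apply: le_trans (HB (M - m)%N); rewrite !wnormE.
rewrite big_split_ord /= big1 ?add0r; last first.
  by move=> i _; rewrite /shift ltn_ord modulus0 expr0n mul0r.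
apply: ler_sum => i _; rewrite /shift ltnNge leq_addr /= addKn.
by rewrite ler_wpM2l ?sqr_ge0// lef_pV2 ?posrE// ler_nat ltnS leq_addl.
Qed.

(** Truncation turns pairings of functions into finite sums, in which limits
    can be taken term by term. *)
Lemma ip_truncation m f h u v M t : taylor_expansion f u -> taylor_expansion h v ->
  square_integrable f -> square_integrable h ->
  (forall M', \sum_(l < M') modulus (u (M + l)%N) * modulus (v (M + l + m)%N) /
     (M + l + m).+1%:R <= t) ->
  modulus (ip (fun z => z ^+ m * f z) h - A1%:C * pair_sum m u v M) <= A1 * t.
Proof.
move=> fu hv sf sh ut; apply/ler_addgt0Pl => e e0.
have [n0 Hn] := parseval (taylor_shift (m := m) fu) hv (square_integrable_shift m fu sf) sh e0.
have := Hn (m + (M + n0))%N; rewrite addnA leq_addl => /(_ isT).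
rewrite -addnA wsum_shift => h1.
rewrite (_ : _ - _ = (ip (fun z => z ^+ m * f z) h - A1%:C * pair_sum m u v (M + n0)) +
  A1%:C * (pair_sum m u v (M + n0) - pair_sum m u v M)); last by ring.
apply: modulusD_le; first by rewrite modulusB.
rewrite modulusM modulus_real (ger0_norm (area_ge0 _)) ler_wpM2l ?area_ge0//.
rewrite /pair_sum big_split_ord /= addrAC subrr add0r.
apply: le_trans (modulus_sum _ _ _) _; apply: le_trans (ut n0).
apply: ler_sum => i _; rewrite !modulusM modulus_conj modulusV.
by rewrite -(rmorph_nat (real_complex R)) modulus_real ger0_norm.
Qed.

Lemma ip_modulus_le m f h u v B : taylor_expansion f u -> taylor_expansion h v ->
  square_integrable f -> square_integrable h ->
  (forall M, \sum_(l < M) modulus (u l) * modulus (v (l + m)%N) /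
     (l + m).+1%:R <= B) ->
  modulus (ip (fun z => z ^+ m * f z) h) <= A1 * B.
Proof.
move=> fu hv sf sh uB.
have := @ip_truncation m f h u v 0 B fu hv sf sh.
rewrite /pair_sum big_ord0 mulr0 subr0; apply => M'.
by under eq_bigr do rewrite add0n; exact: uB.
Qed.

Lemma eq_disc_integral f h : (forall z, disc z -> f z = h z) ->
  disc_integral f = disc_integral h.
Proof. by move=> fh; apply: eq_cint => w; exact: fh. Qed.

End Truncation.

Section UnitCircle.
Context {R : realType}.
Implicit Types (d e : R) (lam : R[i]) (l m M : nat) (u v : nat -> R[i]).

Lemma unimodular_near1 d : 0 < d ->
  exists lam, [/\ modulus lam = 1, lam != 1 & modulus (lam - 1) <= d].
Proof.
move=> d0; pose u : R[i] := 1 + (d / 2)%:C * 'i.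
have u1 : 1 <= modulus u.
  by apply: le_trans (Re_le_modulus u); rewrite /= mul0r mulr0 subr0 addr0.
have u0 : conjc u != 0 by rewrite -modulus_gt0 modulus_conj (lt_le_trans ltr01).
have E : u / conjc u - 1 = d%:C * 'i / conjc u.
  rewrite -[X in _ - X](divff u0) -mulrBl; congr (_ / _).
  by apply: complex_eqP => /=; field.
have m1 : modulus (u / conjc u - 1) = d / modulus u.
  by rewrite E !modulusM modulusV modulus_conj modulus_i modulus_real mulr1 gtr0_norm.
exists (u / conjc u); split.
- by rewrite modulusM modulusV modulus_conj divff// gt_eqF// (lt_le_trans ltr01).
- by rewrite -subr_eq0 -modulus_gt0 m1 divr_gt0// (lt_le_trans ltr01).
- by rewrite m1 ler_pdivrMr ?(lt_le_trans ltr01)// ler_peMr// ltW.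
Qed.

Lemma modulus_expr_sub1 lam l : modulus lam <= 1 ->
  modulus (lam ^+ l - 1) <= l%:R * modulus (lam - 1).
Proof.
move=> l1; rewrite subrX1 modulusM mulrC ler_wpM2r ?modulus_ge0//.
apply: le_trans (modulus_sum _ _ _) _.
rewrite -[l in leRHS]card_ord -sumr_const; apply: ler_sum => i _.
by rewrite modulusX exprn_ile1 ?modulus_ge0.
Qed.

Lemma modulus_geom_sub lam l : modulus lam <= 1 ->
  modulus (\sum_(i < l) lam ^+ i - l%:R) <= l%:R ^+ 2 * modulus (lam - 1).
Proof.
move=> l1; have -> : l%:R = \sum_(i < l) (1 : R[i]).
  by rewrite sumr_const card_ord.
rewrite -sumrB expr2 -mulrA; apply: le_trans (modulus_sum _ _ _) _.
rewrite mulr_natl -[X in _ *+ X]card_ord -sumr_const; apply: ler_sum => i _.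
apply: le_trans (modulus_expr_sub1 _ l1) _.
by rewrite ler_wpM2r ?modulus_ge0// ler_nat ltnW.
Qed.

Lemma pair_tail u v Bu Bv m : (forall M, \sum_(l < M) modulus (u l) ^+ 2 <= Bu) ->
  (forall M, \sum_(l < M) modulus (v l) ^+ 2 <= Bv) ->
  forall e, 0 < e -> exists M0, forall M M', (M0 <= M)%N ->
    \sum_(l < M') modulus (u (M + l)%N) * modulus (v (M + l + m)%N) <= e.
Proof.
move=> HBu HBv e e0.
pose w l := modulus (u l) ^+ 2 + modulus (v (l + m)%N) ^+ 2.
have w0 l : 0 <= w l by rewrite addr_ge0 ?sqr_ge0.
have [M|M0 H] := @sum_tail R w (Bu + Bv) w0 _ e e0.
  rewrite big_split lerD//.
  by apply: (@sum_shift_le R (fun l => modulus (v l) ^+ 2)) => // l; exact: sqr_ge0.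
exists M0 => M M' MM; apply: le_trans (H M M' MM); apply: ler_sum => l _.
rewrite /w; set x := modulus (u _); set y := modulus (v _).
have x0 : 0 <= x by exact: modulus_ge0.
have y0 : 0 <= y by exact: modulus_ge0.
by have := sqr_ge0 (x - y); have := mulr_ge0 x0 y0; rewrite sqrrB; lra.
Qed.

End UnitCircle.

(** * Square summability of the coefficients of [F] and [F ^+ n] *)
Section SquareSummable.
Context {R : realType}.
Local Notation T2 := (measurableTypeR R * measurableTypeR R)%type.
Local Notation sig := (@sigma R).
Local Notation D := (@rdisc R 1).
Local Notation A1 := (area (1 : R)).
Implicit Types (e r t : R) (j l m M : nat) (z lam : R[i]).
Hint Resolve measurable_D : core.

Variable n : nat.
Hypothesis n0 : (0 < n)%N.
Variables (k F : R[i] -> R[i]) (c a g : nat -> R[i]) (K B1 : R).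
Hypotheses (kc : taylor_expansion k c) (kK : forall z, disc z -> modulus (k z) <= K).
Hypothesis extremal : extremal_function (n.*2)%:R k F.
Hypotheses (Fa : taylor_expansion F a) (Gg : taylor_expansion (fun z => F z ^+ n) g).
Hypothesis cB1 : forall M, \sum_(l < M) l.+1%:R * modulus (c l) ^+ 2 <= B1.

Local Notation phi := (functional_of_kernel k).
Let N := complex.Re (phi F).
Let G z := F z ^+ n.

Let bF : bergman_space n F. Proof. exact: (extremal_bergman n0 extremal). Qed.
Let sF : square_integrable F. Proof. exact: (bergman_square_integrable n0 bF). Qed.
Let sG : square_integrable G. Proof. by case: bF. Qed.

Let c_le_w l : modulus (c l) ^+ 2 <= l.+1%:R * modulus (c l) ^+ 2.
Proof. by rewrite ler_peMl ?sqr_ge0// ler1n. Qed.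

Let sk : square_integrable k.
Proof.
apply/(square_integrable_wnorm kc); exists B1 => M; apply: le_trans (cB1 M).
rewrite wnormE; apply: ler_sum => i _; apply: le_trans (c_le_w i).
by rewrite ler_piMr ?sqr_ge0// invf_le1 ?ler1n.
Qed.

Let EL h : bergman_space n h -> phi h = N%:C * dual_form n F h.
Proof. exact: (euler_lagrange n0 kc kK extremal). Qed.

Let pos_le_eps (x : R) : (forall e, 0 < e -> x <= e) -> x <= 0.
Proof. by move=> h; apply/ler_addgt0Pl => e e0; rewrite addr0 h. Qed.

(** By the Euler-Lagrange equation the functional would otherwise annihilate
    all monomials, and then every coefficient of [k] would vanish. *)
Lemma extremal_value_gt0 : (exists2 z, disc z & k z != 0) -> 0 < N.
Proof.
move=> [z dz kz]; have N0 : 0 <= N.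
  exact: (extremal_value_ge0 n0 kc kK extremal).
rewrite lt0r N0 andbT; apply/eqP => N00.
pose u i : R[i] := (i == 0%N)%:R; have t1 := @taylor_one R.
have b1 := @bergman_space1 R n; have s1 := bergman_square_integrable n0 b1.
have c0 l : c l = 0.
  have bl := bergman_space_shift l b1.
  have ip0 : ip (fun z => z ^+ l * 1) k = 0.
    by rewrite -[LHS]/(phi (fun z => z ^+ l * 1)) EL// N00 mul0r.
  apply/eqP; rewrite -modulus_eq0 eq_le modulus_ge0 andbT.
  have h := @ip_truncation R l (fun=> 1) k u c 1 0 t1 kc s1 sk.
  move: h; rewrite ip0 sub0r modulusN mulr0 /pair_sum big_ord_recl big_ord0 addr0.
  rewrite mul1r add0n => /(_ _)/le_trans h.
  have h0 : forall M', \sum_(l0 < M') modulus (u (1 + l0)%N) *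
      modulus (c (1 + l0 + l)%N) / (1 + l0 + l).+1%:R <= 0.
    move=> M'; rewrite big1// => i _.
    by rewrite /u add1n /= modulus0 !mul0r.
  have := h 0 h0 (lexx _); rewrite !modulusM modulus_conj modulusV.
  rewrite -(rmorph_nat (real_complex R)) !modulus_real !gtr0_norm ?area_gt0//.
  by rewrite pmulr_rle0 ?area_gt0// pmulr_lle0// invr_gt0.
have := (taylor_expansionP k c).1 kc z dz => h.
have : modulus (k z) <= 0.
  apply: pos_le_eps => e e0; have [M0 H] := h _ e0.
  have := H M0 (leqnn _); rewrite big1 ?sub0r ?modulusN// => i _.
  by rewrite c0 mul0r.
by move: kz; rewrite -modulus_gt0 => /lt_le_trans h' /h'; rewrite ltxx.
Qed.

Hypothesis N_gt0 : 0 < N.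

Let dual_phi h : bergman_space n h -> dual_form n F h = N^-1%:C * phi h.
Proof.
move=> bh; rewrite EL// mulrA -rmorphM mulVf ?gt_eqF// mul1r//.
Qed.

Let dil lam z := F (lam * z).

(** All regularity of [F] is drawn from this identity: the left-hand side is
    nonnegative, and the last term depends on [F] only through the products of
    its coefficients with those of [k]. *)
Let bergman_dilation lam : modulus lam <= 1 ->
  \int[sig]_(w in D) bregman n (F (pt w)) (dil lam (pt w)) =
  psqint n (dil lam) - 1 +
    (n.*2)%:R / N * complex.Re (ip (fun z => F z - dil lam z) k).
Proof.
move=> l1; have bl := bergman_space_dilation l1 bF.
have [_ ->] := bregman_integral n0 extremal bl.
have bd : bergman_space n (fun z => dil lam z - F z).
  have := bergman_spaceD bl (bergman_spaceZ (-1) bF).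
  by under eq_fun do rewrite mulN1r.
rewrite dual_phi// Re_realM.
have -> : phi (fun z => dil lam z - F z) = - ip (fun z => F z - dil lam z) k.
  have e := phiZ n0 kc kK (-1) bd; rewrite mulN1r in e.
  rewrite -[LHS]opprK -e; congr (- _).
  by apply: eq_disc_integral => z _; ring.
by rewrite Re_opp; ring.
Qed.

Let psqint_cvg lam : modulus lam <= 1 ->
  forall e, 0 < e -> exists M0, forall M, (M0 <= M)%N ->
    `|A1 * wnorm (fun l => g l * lam ^+ l) 1 M - psqint n (dil lam)| <= e.
Proof.
move=> l1; have [al sl] := bergman_space_dilation l1 bF.
by have [_] := square_integrableP (taylor_dilation l1 Gg) sl.
Qed.

Let B0 : R := fine (sqint F) / A1.

Let aB0 M : wnorm a 1 M <= B0.
Proof.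
have [H _] := square_integrableP Fa sF.
by rewrite ler_pdivlMr ?area_gt0// mulrC.
Qed.

Let ac l := modulus (a l) * modulus (c l).

(** Uses [2 x y <= x^2 / (l + 1) + (l + 1) y^2], so that the decay of [c]
    compensates for the mere square integrability of [F]. *)
Let acB M : \sum_(l < M) ac l <= (B0 + B1) / 2.
Proof.
apply: (@le_trans _ _ ((wnorm a 1 M + \sum_(l < M) l.+1%:R * modulus (c l) ^+ 2) / 2)).
  rewrite wnormE -big_split /= mulr_suml; apply: ler_sum => l _.
  set x := modulus (a l); set y := modulus (c l).
  set s : R := l.+1%:R; have s0 : 0 < s by rewrite ltr0n.
  rewrite /ac -/x -/y ler_pdivlMr// -subr_ge0.
  have -> : x ^+ 2 / s + s * y ^+ 2 - x * y * 2 = s * (x / s - y) ^+ 2.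
    by field; rewrite gt_eqF.
  by rewrite mulr_ge0 ?sqr_ge0// ltW.
by rewrite ler_pM2r// lerD.
Qed.

Let acB0 : 0 <= (B0 + B1) / 2.
Proof. by have := acB 0; rewrite big_ord0. Qed.

Let taylor_diff lam : modulus lam <= 1 ->
  taylor_expansion (fun z => F z - dil lam z) (fun l => a l * (1 - lam ^+ l)).
Proof.
move=> l1; rewrite (_ : (fun l => _) = fun l => a l - a l * lam ^+ l).
  exact: (taylorB Fa (taylor_dilation l1 Fa)).
by apply/funext => l; ring.
Qed.

Let square_diff lam : modulus lam <= 1 ->
  square_integrable (fun z => F z - dil lam z).
Proof.
move=> l1; have := bergman_spaceD bF (bergman_spaceZ (-1) (bergman_space_dilation l1 bF)).
under eq_fun do rewrite mulN1r.
exact: bergman_square_integrable.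
Qed.

Let ip_shift0 f h : ip (fun z => z ^+ 0 * f z) h = ip f h.
Proof. by apply: eq_disc_integral => z _; rewrite expr0 mul1r. Qed.

Let bernoulli (x : R) m : 0 <= x -> x <= 1 -> 1 - m%:R * x <= (1 - x) ^+ m.
Proof.
move=> x0 x1; elim: m => [|m IH]; first by rewrite mul0r subr0 expr0.
rewrite exprS; apply: (@le_trans _ _ ((1 - x) * (1 - m%:R * x))).
  rewrite -natr1; have : 0 <= m%:R * x * x by rewrite !mulr_ge0.
  by lra.
by rewrite ler_wpM2l// subr_ge0.
Qed.

Let geom_le (r : R) m : 0 <= r -> r <= 1 -> m%:R * r ^+ m * (1 - r) <= 1 - r ^+ m.
Proof.
move=> r0 r1; have -> : 1 - r ^+ m = (1 - r) * \sum_(i < m) r ^+ i.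
  by rewrite -opprB subrX1 -mulNr opprB.
rewrite mulrC ler_wpM2l ?subr_ge0//.
rewrite mulr_natl -[X in _ *+ X]card_ord -sumr_const; apply: ler_sum => i _.
by rewrite ler_wiXn2l// ltnW.
Qed.

(** Radial dilations [lam = r < 1] decrease the norm: the loss is the sum of
    [|g_l|^2 (1 - r^(2 l)) / (l + 1)], and the divergence being nonnegative
    bounds it by a multiple of [1 - r]. As [r] tends to 1, each weight is
    asymptotic to [2 (1 - r)]. *)
Lemma power_coef_square_summable :
  exists B, forall M, \sum_(l < M) modulus (g l) ^+ 2 <= B.
Proof.
pose Q := (n.*2)%:R / N * ((B0 + B1) / 2).
have Q0 : 0 <= Q by rewrite mulr_ge0// divr_ge0// ltW.
have key M r : 0 <= r -> r < 1 ->
    \sum_(l < M) modulus (g l) ^+ 2 * (1 - r ^+ l.*2) / l.+1%:R <= (1 - r) * Q.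
  move=> r0 r1; have mr : modulus (r%:C : R[i]) = r by rewrite modulus_real ger0_norm.
  have l1 : modulus (r%:C : R[i]) <= 1 by rewrite mr ltW.
  have b0 : 0 <= \int[sig]_(w in D) bregman n (F (pt w)) (dil r%:C (pt w)).
    by apply: Rintegral_ge0 => w _; exact: bregman_ge0.
  rewrite bergman_dilation// in b0.
  have ub : complex.Re (ip (fun z => F z - dil r%:C z) k) <=
      A1 * ((1 - r) * ((B0 + B1) / 2)).
    apply: le_trans (Re_le_modulus _) _; rewrite -ip_shift0.
    apply: (ip_modulus_le (taylor_diff l1) kc (square_diff l1) sk) => M'.
    apply: (@le_trans _ _ ((1 - r) * \sum_(l < M') ac l)); last first.
      by rewrite ler_wpM2l// subr_ge0 ltW.
    rewrite mulr_sumr; apply: ler_sum => l _; rewrite addn0 modulusM.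
    rewrite -rmorphXn -rmorphB modulus_real ger0_norm; last first.
      by rewrite subr_ge0 exprn_ile1// ltW.
    rewrite ler_pdivrMr// /ac.
    have : 1 - r ^+ l <= (1 - r) * l.+1%:R.
      have := @bernoulli (1 - r) l; rewrite subKr subr_ge0 => /(_ (ltW r1)).
      have -> : 1 - r <= 1 by lra.
      by move=> /(_ isT); rewrite -natr1 mulrDr mulr1; have : 0 < 1 - r; lra.
    set y := 1 - r ^+ l; set x := (1 - r) * l.+1%:R => yx.
    rewrite [leLHS](_ : _ = modulus (a l) * modulus (c l) * y); last by ring.
    rewrite [leRHS](_ : _ = modulus (a l) * modulus (c l) * x); last by rewrite /x; ring.
    by rewrite ler_wpM2l// mulr_ge0// modulus_ge0.
  have lb : A1 * \sum_(l < M) modulus (g l) ^+ 2 * (1 - r ^+ l.*2) / l.+1%:R <=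
      1 - psqint n (dil r%:C).
    apply/ler_addgt0Pl => e e0; have e20 : 0 < e / 2 by rewrite divr_gt0.
    have [M1 H1] := psqint_cvg l1 e20.
    have one1 : modulus (1 : R[i]) <= 1 by rewrite modulus1.
    have [M2 H2] := psqint_cvg one1 e20.
    have F1 : psqint n (dil 1) = 1.
      rewrite -(psqint_extremal n0 extremal); apply: eq_Rintegral => w _.
      by rewrite /dil mul1r.
    pose M3 := maxn M (maxn M1 M2).
    have h1 := H1 M3 (leq_trans (leq_maxl _ _) (leq_maxr _ _)).
    have h2 := H2 M3 (leq_trans (leq_maxr _ _) (leq_maxr _ _)).
    rewrite F1 in h2.
    have h3 : A1 * \sum_(l < M) modulus (g l) ^+ 2 * (1 - r ^+ l.*2) / l.+1%:R <=
        A1 * wnorm (fun l => g l * 1 ^+ l) 1 M3 - A1 * wnorm (fun l => g l * r%:C ^+ l) 1 M3.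
      rewrite -mulrBr ler_wpM2l ?area_ge0// !wnormE -sumrB.
      apply: (@le_trans _ _ (\sum_(l < M3) modulus (g l) ^+ 2 * (1 - r ^+ l.*2) / l.+1%:R)).
        apply: (@sum_nat_nondecreasing R (fun l => modulus (g l) ^+ 2 * (1 - r ^+ l.*2) / l.+1%:R)).
          move=> l; rewrite divr_ge0// mulr_ge0 ?sqr_ge0// subr_ge0.
          by rewrite exprn_ile1// ltW.
        exact: leq_maxl.
      apply: ler_sum => l _; rewrite expr1n mulr1 modulusM modulusX mr exprMn -exprM muln2.
      by rewrite -mulrBl mulrBr mulr1.
    apply: le_trans h3 _; move: h1 h2.
    rewrite !ler_norml => /andP[x1 _] /andP[_ x2].
    have := lerB x2 x1; rewrite opprK -splitr => h.
    rewrite -lerBlDr; apply: le_trans h; rewrite le_eqVlt; apply/orP; left.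
    apply/eqP; move: (A1 * _) (A1 * _) (psqint _ _) => x y w.
    by ring.
  rewrite -(ler_pM2l area_gt0); apply: le_trans lb _.
  have nN : 0 < (n.*2)%:R / N by rewrite divr_gt0// ltr0n double_gt0.
  have := ler_wpM2l (ltW nN) ub.
  rewrite [(n.*2)%:R / N * (A1 * _)](_ : _ = A1 * ((1 - r) * Q)); last by rewrite /Q; ring.
  by move: b0; lra.
exists (modulus (g 0%N) ^+ 2 + 2 * Q) => -[|M].
  by rewrite big_ord0 addr_ge0 ?sqr_ge0// mulr_ge0.
rewrite big_ord_recl lerD2l.
(* close enough to 1 that [r ^+ l.*2 >= 1 / 2] for the relevant [l] *)
pose r : R := 1 - (4 * M.+1%:R)^-1.
have d0 : 0 < 4 * M.+1%:R :> R by rewrite mulr_gt0.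
have d1 : (4 * M.+1%:R)^-1 <= (1 : R).
  by rewrite invf_le1// -natrM ler1n.
have r0 : 0 <= r by rewrite subr_ge0.
have r1 : r < 1 by rewrite ltrBlDr ltrDl invr_gt0.
have half l : (l <= M.+1)%N -> 1 / 2 <= r ^+ l.*2.
  move=> lM; have := @bernoulli (4 * M.+1%:R)^-1 l.*2.
  rewrite invr_ge0 (ltW d0) => /(_ isT d1); apply: le_trans.
  suff : (l.*2)%:R * (4 * M.+1%:R)^-1 <= 1 / 2 :> R.
    by rewrite lerBrDr => h; apply: le_trans (lerD (lexx _) h) _; lra.
  rewrite ler_pdivrMr// -muln2 natrM.
  have : l%:R <= M.+1%:R :> R by rewrite ler_nat.
  by lra.
have r10 : 0 < 1 - r by rewrite subr_gt0.
rewrite -(ler_pM2l r10) [leRHS](_ : _ = 2 * ((1 - r) * Q)); last by ring.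
apply: le_trans (ler_wpM2l _ (key M.+1 r r0 r1)); last by [].
rewrite big_ord_recl double0 expr0 subrr mulr0 mul0r add0r !mulr_sumr.
apply: ler_sum => i _; rewrite /= /bump /= ?add1n.
have h1 := @geom_le r i.+1.*2 r0 (ltW r1).
have h2 := half i.+1 (leqW (ltn_ord i)).
set x := modulus (g i.+1) ^+ 2; have x0 : 0 <= x by exact: sqr_ge0.
rewrite [leRHS]mulrA ler_pdivlMr; last by rewrite ltr0n.
rewrite [leRHS](_ : _ = x * (2 * (1 - r ^+ i.+1.*2))); last by ring.
rewrite [leLHS](_ : _ = x * ((1 - r) * i.+2%:R)); last by ring.
rewrite ler_wpM2l//; apply: le_trans (ler_wpM2l _ h1); last by [].
rewrite [leRHS](_ : _ = (1 - r) * (2 * (i.+1.*2)%:R * r ^+ i.+1.*2)); last by ring.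
rewrite ler_wpM2l ?(ltW r10)//.
apply: (@le_trans _ _ (2 * (i.+1.*2)%:R * (1 / 2))); last by rewrite ler_wpM2l// mulr_ge0.
rewrite mulrAC div1r mulfV// mul1r ler_nat -addnn.
by rewrite addSn addnS !ltnS leq_addr.
Qed.

(** The weights [1 / (l + j + 1)] of the coefficients of [z ^+ j * h] are nearly
    constant for [l <= j], so that bounds for [|z ^+ j * h|] as [j] grows
    amount to square summability. *)
Lemma wnorm_shift_le m (b : nat -> R[i]) B M :
  (forall M, \sum_(l < M) modulus (b l) ^+ 2 <= B) ->
  wnorm (shift m b) 1 M <= B / m.+1%:R.
Proof.
move=> HB; have B_ge0 : 0 <= B by have := HB 0%N; rewrite big_ord0.
have [Mm|/ltnW mM] := leqP M m.
  rewrite wnormE big1 ?divr_ge0// => i _.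
  by rewrite /shift (leq_trans (ltn_ord i) Mm) modulus0 expr0n mul0r.
rewrite -(subnKC mM) wnormE big_split_ord /= big1 ?add0r; last first.
  by move=> i _; rewrite /shift ltn_ord modulus0 expr0n mul0r.
apply: (@le_trans _ _ ((\sum_(l < M - m) modulus (b l) ^+ 2) / m.+1%:R)).
  rewrite mulr_suml; apply: ler_sum => i _; rewrite /shift ltnNge leq_addr /= addKn.
  by rewrite ler_wpM2l ?sqr_ge0// lef_pV2 ?posrE// ler_nat ltnS leq_addr.
by rewrite ler_wpM2r ?invr_ge0.
Qed.

(** Follows from the bound for [F ^+ n] by integrating [|F|^2 <= 1 + |F ^+ n|^2]
    against the weight [|z|^(2 M)], which concentrates on the boundary. *)
Lemma coef_square_summable :
  exists B, forall M, \sum_(l < M) modulus (a l) ^+ 2 <= B.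
Proof.
have [B HB] := power_coef_square_summable.
have B_ge0 : 0 <= B by have := HB 0%N; rewrite big_ord0.
exists (2 * (1 + B)) => M.
pose u i : R[i] := (i == 0%N)%:R.
have H1 M' : \sum_(l < M') modulus (u l) ^+ 2 <= 1.
  case: M' => [|M']; first by rewrite big_ord0.
  rewrite big_ord_recl big1 ?addr0 => [|i _]; last by rewrite modulus0 expr0n.
  by rewrite modulus1 expr1n.
have t1 := taylor_shift (m := M) (@taylor_one R).
have tG := taylor_shift (m := M) Gg; have tF := taylor_shift (m := M) Fa.
have s1 := sqint_le_wnorm t1 (fun M' => @wnorm_shift_le M u 1 M' H1).
have sG' := sqint_le_wnorm tG (fun M' => @wnorm_shift_le M g B M' HB).
have mq f b : taylor_expansion f b ->
    measurable_fun D (fun w => (modulus (f (pt w)) ^+ 2)%:E).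
  by move=> fb; have /measurable_EFinP := measurable_sqmod fb (lexx _).
have le_sq : (sqint (fun z => (z ^+ M * F z)%R) <=
    sqint (fun z => (z ^+ M * 1)%R) + sqint (fun z => (z ^+ M * F z ^+ n)%R))%E.
  rewrite /sqint -ge0_integralD//; try by move=> w _; rewrite lee_fin sqr_ge0.
  - apply: ge0_le_integral => //.
    + by move=> w _; rewrite lee_fin sqr_ge0.
    + exact: mq tF.
    + by apply: emeasurable_funD; [exact: mq t1|exact: mq tG].
    + move=> w _; rewrite -EFinD lee_fin !modulusM !exprMn -mulrDr.
      by rewrite ler_wpM2l ?sqr_ge0// modulus1 expr1n le1_modulusX.
  - exact: mq t1.
  - exact: mq tG.
have := le_trans (wnorm_le_sqint (M + M) tF) (le_trans le_sq (leeD s1 sG')).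
rewrite -EFinD lee_fin -mulrDr ler_pM2l ?area_gt0// -mulrDl => h.
have p0 : 0 < (M.+1)%:R :> R by rewrite ltr0n.
have q0 : 0 < (M + M).+1%:R :> R by rewrite ltr0n.
apply: (@le_trans _ _ ((M + M).+1%:R * wnorm (shift M a) 1 (M + M))).
  rewrite wnormE big_split_ord /= [X in _ * (X + _)]big1 ?add0r; last first.
    by move=> i _; rewrite /shift ltn_ord modulus0 expr0n mul0r.
  rewrite mulr_sumr; apply: ler_sum => i _.
  rewrite /shift ltnNge leq_addr /= addKn mulrCA ler_peMr ?sqr_ge0//.
  by rewrite ler_pdivlMr ?ltr0n// mul1r ler_nat ltnS leq_add2l ltnW.
apply: le_trans (ler_wpM2l (ltW q0) h) _.
rewrite mulrCA mulrC ler_wpM2r ?addr_ge0// ler_pdivrMr// -natrM ler_nat.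
by rewrite mul2n -addnn addnS addSn ltnS leqW.
Qed.

(** * Rotations *)

Let dilB_bergman lam : modulus lam <= 1 ->
  bergman_space n (fun z => dil lam z - F z).
Proof.
move=> l1; have := bergman_spaceD (bergman_space_dilation l1 bF) (bergman_spaceZ (-1) bF).
by under eq_fun do rewrite mulN1r.
Qed.

Let taylor_dilB lam : modulus lam <= 1 ->
  taylor_expansion (fun z => dil lam z - F z) (fun l => a l * (lam ^+ l - 1)).
Proof.
move=> l1; rewrite (_ : (fun l => _) = fun l => a l * lam ^+ l - a l).
  exact: (taylorB (taylor_dilation l1 Fa) Fa).
by apply/funext => l; ring.
Qed.

Let taylor_powB lam : modulus lam <= 1 ->
  taylor_expansion (fun z => dil lam z ^+ n - G z) (fun l => g l * (lam ^+ l - 1)).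
Proof.
move=> l1; rewrite (_ : (fun l => _) = fun l => g l * lam ^+ l - g l).
  exact: (taylorB (taylor_dilation l1 Gg) Gg).
by apply/funext => l; ring.
Qed.

Let square_powB lam : modulus lam <= 1 ->
  square_integrable (fun z => dil lam z ^+ n - G z).
Proof.
move=> l1; have [_ sl] := bergman_space_dilation l1 bF.
have := square_integrable_comb 1 (-1) (taylor_dilation l1 Gg) Gg sl sG.
by under eq_fun do rewrite mul1r mulN1r.
Qed.

Let breg lam := \int[sig]_(w in D) bregman n (F (pt w)) (dil lam (pt w)).

Let breg_ge0 lam : 0 <= breg lam.
Proof. by apply: Rintegral_ge0 => w _; exact: bregman_ge0. Qed.

(** A rotation multiplies the coefficients of [F ^+ n] by unimodular numbers. *)
Let psqint_rotation lam : modulus lam = 1 -> psqint n (dil lam) = 1.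
Proof.
move=> l1; have l1' : modulus lam <= 1 by rewrite l1.
have one1 : modulus (1 : R[i]) <= 1 by rewrite modulus1.
have F1 : psqint n (dil 1) = 1.
  rewrite -(psqint_extremal n0 extremal); apply: eq_Rintegral => w _.
  by rewrite /dil mul1r.
apply/eqP; rewrite -subr_eq0 -normr_le0; apply: pos_le_eps => e e0.
have e20 : 0 < e / 2 by rewrite divr_gt0.
have [M1 H1] := psqint_cvg l1' e20; have [M2 H2] := psqint_cvg one1 e20.
have h1 := H1 (maxn M1 M2) (leq_maxl _ _).
have h2 := H2 (maxn M1 M2) (leq_maxr _ _).
have wE : wnorm (fun l => g l * 1 ^+ l) 1 (maxn M1 M2) =
    wnorm (fun l => g l * lam ^+ l) 1 (maxn M1 M2).
  rewrite !wnormE; apply: eq_bigr => l _.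
  by rewrite !modulusM !modulusX l1 modulus1.
rewrite wE F1 in h2; rewrite distrC in h1.
by have := le_trans (ler_distD _ _ _) (lerD h1 h2); rewrite -splitr.
Qed.

(** The linear terms of the inequalities for [lam] and its conjugate cancel;
    what remains carries the weight [|1 - lam ^+ l|^2 / (l + 1)], which is at
    most [2 |1 - lam|] and, for fixed [l], of second order. *)
Lemma bregman_rotation_small e : 0 < e -> exists2 d, 0 < d &
  forall lam, modulus lam = 1 -> modulus (lam - 1) <= d ->
    breg lam <= e * modulus (lam - 1).
Proof.
move=> e0; (* [L] separates the tail of the sum, made small by [eta], from the terms of
   second order, made small by [d] *)
pose C := (n.*2)%:R / N * A1.
have C0 : 0 < C by rewrite mulr_gt0 ?area_gt0// divr_gt0// ltr0n double_gt0.
pose eta := e / (4 * C); have eta0 : 0 < eta by rewrite divr_gt0// mulr_gt0.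
have ac0 l : 0 <= ac l by rewrite mulr_ge0 ?modulus_ge0.
have [L HL] := sum_tail ac0 acB eta0.
pose Q := (B0 + B1) / 2; have Q0 : 0 <= Q by exact: acB0.
pose d := e / (2 * C * (L%:R * Q + 1)).
have LQ0 : 0 < L%:R * Q + 1 by rewrite ltr_wpDl// mulr_ge0.
exists d => [|lam l1 ld]; first by rewrite divr_gt0// mulr_gt0// mulr_gt0.
have l1' : modulus lam <= 1 by rewrite l1.
have lc1 : modulus (conjc lam) <= 1 by rewrite modulus_conj.
set t := modulus (lam - 1) in ld *; have t0 : 0 <= t by exact: modulus_ge0.
apply: (@le_trans _ _ (breg lam + breg (conjc lam))); first by rewrite lerDl breg_ge0.
rewrite /breg !bergman_dilation// !psqint_rotation ?modulus_conj// subrr !add0r.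
rewrite -mulrDr -Re_add.
have -> : ip (fun z => F z - dil lam z) k + ip (fun z => F z - dil (conjc lam) z) k =
    ip (fun z => (F z - dil lam z) + (F z - dil (conjc lam) z)) k.
  have bd mu : modulus mu <= 1 -> bergman_space n (fun z => F z - dil mu z).
    move=> m1; have := bergman_spaceZ (-1) (dilB_bergman m1).
    by under eq_fun do rewrite mulN1r opprB.
  by have := phiD n0 kc kK (bd _ l1') (bd _ lc1) => <-.
have tx := taylorD (taylor_diff l1') (taylor_diff lc1).
have sx : square_integrable
    (fun z => (F z - dil lam z) + (F z - dil (conjc lam) z)).
  have := square_integrable_comb 1 1 (taylor_diff l1') (taylor_diff lc1)
    (square_diff l1') (square_diff lc1).
  by under eq_fun do rewrite !mul1r.
have coefE l : modulus (a l * (1 - lam ^+ l) + a l * (1 - conjc lam ^+ l)) =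
    modulus (a l) * modulus (lam ^+ l - 1) ^+ 2.
  have llc : lam ^+ l * conjc (lam ^+ l) = 1.
    by rewrite mulc_conj modulusX l1 !expr1n.
  rewrite -rmorphXn /= -mulrDr modulusM; congr (_ * _).
  have -> : 1 - lam ^+ l + (1 - conjc (lam ^+ l)) =
      (lam ^+ l - 1) * conjc (lam ^+ l - 1).
    rewrite rmorphB rmorph1 mulrBl !mulrBr llc !mulr1 !mul1r.
    by ring.
  by rewrite modulusM modulus_conj expr2.
have bnd : modulus (ip (fun z => (F z - dil lam z) + (F z - dil (conjc lam) z)) k) <=
    A1 * (t * (L%:R * t * Q + 2 * eta)).
  rewrite -ip_shift0; apply: (ip_modulus_le tx kc sx sk) => M.
  have w_le l : modulus (lam ^+ l - 1) ^+ 2 / l.+1%:R <= 2 * t.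
    have x2 : modulus (lam ^+ l - 1) <= 2.
      apply: le_trans (modulusBD _ _) _.
      by rewrite modulusX l1 expr1n modulus1.
    rewrite ler_pdivrMr// expr2 -mulrA ler_pM ?modulus_ge0//.
    apply: le_trans (modulus_expr_sub1 l l1') _.
    by rewrite mulrC ler_wpM2l// ler_nat.
  have w_le' l : (l < L)%N -> modulus (lam ^+ l - 1) ^+ 2 / l.+1%:R <= L%:R * t ^+ 2.
    move=> lL; have x2 := modulus_expr_sub1 l l1'.
    have l0 : 0 <= l%:R * t by rewrite mulr_ge0.
    apply: (@le_trans _ _ ((l%:R * t) ^+ 2 / l.+1%:R)).
      by rewrite ler_wpM2r ?invr_ge0// lerXn2r// nnegrE modulus_ge0.
    rewrite exprMn mulrAC ler_wpM2r ?sqr_ge0// ler_pdivrMr// -natrX -natrM ler_nat.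
    by rewrite expnS expn1 leq_mul// ltnW// leqW.
  pose w l := ac l * (modulus (lam ^+ l - 1) ^+ 2 / l.+1%:R).
  have w0 l : 0 <= w l by rewrite mulr_ge0// divr_ge0// sqr_ge0.
  apply: (@le_trans _ _ (\sum_(l < L + M) w l)).
    apply: (@le_trans _ _ (\sum_(l < M) w l)).
      apply: ler_sum => l _; rewrite addn0 coefE /w /ac.
      by rewrite le_eqVlt; apply/orP; left; apply/eqP; ring.
    by apply: (sum_nat_nondecreasing w0); exact: leq_addl.
  rewrite big_split_ord /= mulrDr; apply: lerD.
    apply: (@le_trans _ _ (\sum_(l < L) ac l * (L%:R * t ^+ 2))).
      by apply: ler_sum => l _; rewrite ler_wpM2l// w_le'.
    rewrite -mulr_suml; apply: le_trans (ler_wpM2r _ (acB L)) _.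
      by rewrite mulr_ge0// sqr_ge0.
    by rewrite le_eqVlt; apply/orP; left; apply/eqP; rewrite /Q; ring.
  apply: (@le_trans _ _ (\sum_(l < M) ac (L + l)%N * (2 * t))).
    by apply: ler_sum => l _; rewrite ler_wpM2l.
  rewrite -mulr_suml; apply: le_trans (ler_wpM2r _ (HL L M (leqnn _))) _.
    by rewrite mulr_ge0.
  by rewrite le_eqVlt; apply/orP; left; apply/eqP; ring.
have nN : 0 <= (n.*2)%:R / N by rewrite divr_ge0// ltW.
apply: le_trans (ler_wpM2l nN (le_trans (Re_le_modulus _) bnd)) _.
have -> : (n.*2)%:R / N * (A1 * (t * (L%:R * t * Q + 2 * eta))) =
    t * (C * (L%:R * t * Q) + C * (2 * eta)) by rewrite /C; ring.
rewrite [leRHS]mulrC ler_wpM2l// [e]splitr; apply: lerD.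
  have h : t * (2 * C * (L%:R * Q + 1)) <= e by rewrite -ler_pdivlMr// mulr_gt0// mulr_gt0.
  rewrite ler_pdivlMr//; apply: le_trans h.
  have -> : C * (L%:R * t * Q) * 2 = t * (2 * C * (L%:R * Q)) by ring.
  by rewrite ler_wpM2l// ler_wpM2l ?lerDl// mulr_ge0// ltW.
rewrite /eta le_eqVlt; apply/orP; left; apply/eqP.
by field; rewrite gt_eqF.
Qed.

(** Testing the Euler-Lagrange equation on [z ^+ m * (F (lam z) - F z)]
    computes, up to a multiple of the divergence, the increment of [F ^+ n]. *)
Lemma increment_identity : exists2 C, 0 < C & forall m lam, modulus lam = 1 ->
  modulus (ip (fun z => z ^+ m * (dil lam z ^+ n - G z)) G -
    (n%:R / N)%:C * ip (fun z => z ^+ m * (dil lam z - F z)) k) <= C * breg lam.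
Proof.
have [C C0 HC] := @remainder_le_bregman R n n0.
exists C => // m lam l1; have l1' : modulus lam <= 1 by rewrite l1.
have bd := dilB_bergman l1'; have bm := bergman_space_shift m bd.
have tm := taylor_shift (m := m) (taylor_powB l1').
have sm := @square_integrable_shift R m _ _ (taylor_powB l1') (square_powB l1').
have i1 := ip_integrable tm Gg sm sG.
have i2 := dual_integrable n0 extremal bm.
have [iB _] := bregman_integral n0 extremal (bergman_space_dilation l1' bF).
have i3 := cintegrableZ n%:R measurable_D i2.
have -> : (n%:R / N)%:C * ip (fun z => z ^+ m * (dil lam z - F z)) k =
    n%:R * dual_form n F (fun z => z ^+ m * (dil lam z - F z)).
  rewrite dual_phi// rmorphM rmorph_nat mulrA; congr (_ * _).
rewrite -(cintZ n%:R measurable_D i2) ip_cint -(cintB measurable_D i1 i3).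
have -> : C * breg lam = \int[sig]_(w in D) (C * bregman n (F (pt w)) (dil lam (pt w))).
  by rewrite RintegralZl.
apply: modulus_cint_le => //.
- by apply: cintegrableB.
- by have := integrableZl measurable_D C iB; apply: eq_integrable.
move=> w Dw; set x := F (pt w); set y := dil lam (pt w).
have -> : pt w ^+ m * (y ^+ n - G (pt w)) * conjc (G (pt w)) -
    n%:R * (conjc (x ^+ n) * (x ^+ n.-1 * (pt w ^+ m * (y - x)))) =
    pt w ^+ m * (remainder n x y * conjc (x ^+ n)).
  by rewrite /remainder /G -/x; ring.
rewrite modulusM; apply: le_trans (HC x y); rewrite modulusM modulus_conj.
rewrite ler_piMl ?mulr_ge0 ?modulus_ge0// modulusX exprn_ile1 ?modulus_ge0//.
exact: ltW.
Qed.

(** * Autocorrelations of the coefficients of [F ^+ n] *)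

Let Ni : R[i] := N^-1%:C.

Let modulus_Ni : modulus Ni = N^-1.
Proof. by rewrite modulus_real ger0_norm// invr_ge0 ltW. Qed.

Let modulus_nat m : modulus (m%:R : R[i]) = m%:R.
Proof. by rewrite -(rmorph_nat (real_complex R)) modulus_real ger0_norm. Qed.

Let c_square_summable M : \sum_(l < M) modulus (c l) ^+ 2 <= B1.
Proof. by apply: le_trans (cB1 M); apply: ler_sum => l _. Qed.

(** Dividing the identity for increments by [lam - 1] and letting [lam] tend
    to 1 inside truncated sums. *)
Lemma derivative_pairing m e : 0 < e -> exists M0, forall M, (M0 <= M)%N ->
  modulus (\sum_(l < M) l%:R * ((g l * conjc (g (l + m)%N) -
    n%:R * Ni * (a l * conjc (c (l + m)%N))) / (l + m).+1%:R)) <= e.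
Proof.
move=> e0; have [Bg HBg] := power_coef_square_summable.
have [Ba HBa] := coef_square_summable; have [C C0 HC] := increment_identity.
pose r := n%:R / N; have r0 : 0 <= r by rewrite divr_ge0// ltW.
pose eta := e / (4 * (1 + r)); have eta0 : 0 < eta.
  by rewrite divr_gt0// mulr_gt0// ltr_pwDl.
have [Mg Hg] := pair_tail m HBg HBg eta0.
have [Ma Ha] := pair_tail m HBa c_square_summable eta0.
have eps0 : 0 < A1 * e / (4 * C) by rewrite divr_gt0 ?mulr_gt0 ?area_gt0.
have [d d0 Hd] := bregman_rotation_small eps0.
exists (maxn Mg Ma) => M; rewrite geq_max => /andP[gM aM].
pose w l : R[i] := (g l * conjc (g (l + m)%N) -
    n%:R * Ni * (a l * conjc (c (l + m)%N))) / (l + m).+1%:R.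
pose W := \sum_(l < M) modulus (w l) * l%:R ^+ 2.
have W0 : 0 <= W by apply: sumr_ge0 => l _; rewrite mulr_ge0 ?modulus_ge0 ?sqr_ge0.
have W1 : 0 < W + 1 by rewrite ltr_wpDl.
(* [W] bounds the error made by replacing [lam ^+ l - 1] by [l (lam - 1)] *)
have [|lam [l1 ln lt]] := @unimodular_near1 R (Num.min d (e / 2 / (W + 1))).
  by rewrite lt_min d0 !divr_gt0.
have l1' : modulus lam <= 1 by rewrite l1.
move: lt; rewrite le_min => /andP[td tW].
pose t := modulus (lam - 1); have t0 : 0 < t by rewrite modulus_gt0 subr_eq0.
rewrite -/t in td tW.
have tail u v Mx : (forall M M', (Mx <= M)%N ->
      \sum_(l < M') modulus (u (M + l)%N) * modulus (v (M + l + m)%N) <= eta) ->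
    (Mx <= M)%N -> forall M', \sum_(l < M')
      modulus (u (M + l)%N * (lam ^+ (M + l) - 1)) * modulus (v (M + l + m)%N) /
        (M + l + m).+1%:R <= t * eta.
  move=> Huv xM M'; apply: le_trans (ler_wpM2l (ltW t0) (Huv M M' xM)).
  rewrite mulr_sumr; apply: ler_sum => l _; rewrite modulusM ler_pdivrMr//.
  have := modulus_expr_sub1 (M + l) l1'; rewrite -/t.
  set x := modulus (u _); set y := modulus (v _); set q := modulus (_ - 1) => h.
  have -> : x * q * y = x * y * q by ring.
  have -> : t * (x * y) * (M + l + m).+1%:R = x * y * (t * (M + l + m).+1%:R) by ring.
  rewrite ler_wpM2l ?mulr_ge0 ?modulus_ge0//; apply: le_trans h _.
  by rewrite mulrC ler_pM2l// ler_nat leqW// leq_addr.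
have T1 := ip_truncation (taylor_powB l1') Gg (square_powB l1') sG (tail _ _ _ Hg gM).
have sd := bergman_square_integrable n0 (dilB_bergman l1').
have T2 := ip_truncation (taylor_dilB l1') kc sd sk (tail _ _ _ Ha aM).
have T3 := HC m lam l1; have T4 := Hd lam l1 td; rewrite -/t in T4.
set ps1 := pair_sum _ _ _ _ in T1; set ps2 := pair_sum _ _ _ _ in T2.
set i1 := ip _ _ in T1 T3; set i2 := ip _ _ in T2 T3.
have psE : ps1 - n%:R * Ni * ps2 =
    (lam - 1) * \sum_(l < M) w l * \sum_(i < l) lam ^+ i.
  rewrite /ps1 /ps2 /pair_sum !mulr_sumr -sumrB; apply: eq_bigr => l _.
  by rewrite subrX1 /w; ring.
have rC : (n%:R / N)%:C = n%:R * Ni :> R[i] by rewrite rmorphM rmorph_nat.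
have nr : modulus (n%:R * Ni) = r by rewrite modulusM modulus_nat modulus_Ni.
rewrite rC in T3.
set S := \sum_(l < M) w l * _ in psE.
have hS : modulus S <= e / 2.
  have main : A1 * (t * modulus S) <= A1 * (t * eta) + C * breg lam + r * (A1 * (t * eta)).
    have -> : A1 * (t * modulus S) = modulus (A1%:C * (ps1 - n%:R * Ni * ps2)).
      by rewrite psE !modulusM modulus_real ger0_norm ?area_ge0.
    have -> : A1%:C * (ps1 - n%:R * Ni * ps2) = (A1%:C * ps1 - i1) +
       (i1 - n%:R * Ni * i2) + n%:R * Ni * (i2 - A1%:C * ps2) by ring.
    apply: modulusD_le; last by rewrite modulusM nr ler_wpM2l.
    by apply: modulusD_le => //; rewrite modulusB.
  have h4 := ler_wpM2l (ltW C0) T4.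
  have e1 : C * (A1 * e / (4 * C) * t) = A1 * (t * (e / 4)) by field; rewrite gt_eqF.
  have e2 : A1 * (t * eta) + r * (A1 * (t * eta)) = A1 * (t * (e / 4)).
    by rewrite /eta; field; rewrite gt_eqF// ltr_pwDl.
  rewrite e1 in h4.
  have : A1 * (t * modulus S) <= A1 * (t * (e / 2)).
    apply: le_trans main _; rewrite addrAC e2; apply: le_trans (lerD (lexx _) h4) _.
    by rewrite le_eqVlt; apply/orP; left; apply/eqP; field.
  by rewrite ler_pM2l ?area_gt0// ler_pM2l.
rewrite [X in modulus X](_ : _ = S - \sum_(l < M) w l * (\sum_(i < l) lam ^+ i - l%:R)).
  rewrite [e in leRHS]splitr; apply: modulusD_le => //; rewrite modulusN.
  apply: le_trans (modulus_sum _ _ _) _.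
  apply: (@le_trans _ _ (W * t)).
    rewrite mulr_suml; apply: ler_sum => l _; rewrite modulusM -mulrA.
    by rewrite ler_wpM2l ?modulus_ge0// modulus_geom_sub.
  rewrite mulrC; move: tW; rewrite ler_pdivlMr//; apply: le_trans.
  by rewrite ler_pM2l// lerDl.
rewrite -sumrB; apply: eq_bigr => l _; rewrite -/(w l).
by rewrite mulrBr opprB addrC subrK mulrC.
Qed.

(** The Euler-Lagrange equation tested on [z ^+ m * F z]. *)
Lemma value_pairing m e : 0 < e -> exists M0, forall M, (M0 <= M)%N ->
  modulus (\sum_(l < M) (g l * conjc (g (l + m)%N) -
    Ni * (a l * conjc (c (l + m)%N))) / (l + m).+1%:R) <= e.
Proof.
move=> e0; have [Bg HBg] := power_coef_square_summable.
have [Ba HBa] := coef_square_summable.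
have N'0 : 0 < 1 + N^-1 by rewrite ltr_pwDl// invr_ge0 ltW.
pose eta := e / (1 + N^-1); have eta0 : 0 < eta by rewrite divr_gt0.
have [Mg Hg] := pair_tail m HBg HBg eta0.
have [Ma Ha] := pair_tail m HBa c_square_summable eta0.
exists (maxn Mg Ma) => M; rewrite geq_max => /andP[gM aM].
have tail (u v : nat -> R[i]) Mx : (forall M M', (Mx <= M)%N ->
      \sum_(l < M') modulus (u (M + l)%N) * modulus (v (M + l + m)%N) <= eta) ->
    (Mx <= M)%N -> forall M', \sum_(l < M')
      modulus (u (M + l)%N) * modulus (v (M + l + m)%N) / (M + l + m).+1%:R <= eta.
  move=> Huv xM M'; apply: le_trans (Huv M M' xM); apply: ler_sum => l _.
  by rewrite ler_piMr ?mulr_ge0 ?modulus_ge0// invf_le1 ?ler1n.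
have T1 := ip_truncation Gg Gg sG sG (tail _ _ _ Hg gM).
have T2 := ip_truncation Fa kc sF sk (tail _ _ _ Ha aM).
have iE : ip (fun z => z ^+ m * G z) G = Ni * ip (fun z => z ^+ m * F z) k.
  rewrite -[ip (fun z => z ^+ m * F z) k]/(phi _) -dual_phi; last exact: bergman_space_shift.
  apply: eq_disc_integral => z _; rewrite /G.
  have xE : F z ^+ n.-1 * F z = F z ^+ n by rewrite -exprSr prednK.
  by move: (conjc _) => x; rewrite -xE; ring.
set ps1 := pair_sum _ _ _ _ in T1; set ps2 := pair_sum _ _ _ _ in T2.
rewrite iE in T1; set i2 := ip _ _ in T1 T2.
rewrite [X in modulus X](_ : _ = ps1 - Ni * ps2); last first.
  rewrite /ps1 /ps2 /pair_sum mulr_sumr -sumrB; apply: eq_bigr => l _.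
  by ring.
rewrite -(ler_pM2l area_gt0).
have -> : A1 * modulus (ps1 - Ni * ps2) = modulus (A1%:C * (ps1 - Ni * ps2)).
  by rewrite modulusM modulus_real ger0_norm ?area_ge0.
have -> : A1%:C * (ps1 - Ni * ps2) = (A1%:C * ps1 - Ni * i2) +
   Ni * (i2 - A1%:C * ps2) by ring.
have -> : A1 * e = A1 * eta + N^-1 * (A1 * eta).
  by rewrite /eta; field; rewrite gt_eqF// gt_eqF// ltr_pwDl.
apply: modulusD_le; first by rewrite modulusB.
by rewrite modulusM modulus_Ni ler_wpM2l// invr_ge0 ltW.
Qed.

(** The weights combine as [l + (m + 1) = l + m + 1]: on the left they cancel
    the denominator, on the right [n l + (m + 1)] is at most [n] times it. *)
Lemma autocorrelation_le m e : 0 < e -> exists M0, forall M, (M0 <= M)%N ->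
  modulus (\sum_(l < M) g l * conjc (g (l + m)%N)) <=
    n%:R / N * (\sum_(l < M) modulus (a l) * modulus (c (l + m)%N)) + e.
Proof.
move=> e0; have e20 : 0 < e / 2 by rewrite divr_gt0.
have em0 : 0 < e / 2 / m.+1%:R by rewrite divr_gt0.
have [M1 H1] := derivative_pairing m e20; have [M2 H2] := value_pairing m em0.
exists (maxn M1 M2) => M; rewrite geq_max => /andP[/H1 h1 /H2 h2].
set s1 := \sum_(l < M) _ in h1; set s2 := \sum_(l < M) _ in h2.
rewrite [X in modulus X](_ : _ = \sum_(l < M)
    ((n * l + m.+1)%:R / (l + m).+1%:R * Ni * (a l * conjc (c (l + m)%N))) +
    (s1 + m.+1%:R * s2)); last first.
  rewrite /s1 /s2 mulr_sumr -!big_split /=; apply: eq_bigr => l _.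
  have s0 : (l + m).+1%:R != 0 :> R[i] by rewrite pnatr_eq0.
  have -> : (n * l + m.+1)%:R = n%:R * l%:R + m.+1%:R :> R[i] by rewrite natrD natrM.
  have -> : m.+1%:R = (l + m).+1%:R - l%:R :> R[i] by rewrite -addnS natrD addrC addKr.
  move: (conjc (g _)) (conjc (c _)) s0; move: (l + m).+1%:R => s x y s0.
  by move: (Ni) => u; field.
apply: modulusD_le.
  apply: le_trans (modulus_sum _ _ _) _; rewrite mulr_sumr; apply: ler_sum => l _.
  rewrite !modulusM modulusV modulus_Ni !modulus_nat modulus_conj.
  rewrite ler_wpM2r ?mulr_ge0 ?modulus_ge0// ler_wpM2r ?invr_ge0 ?(ltW N_gt0)//.
  rewrite ler_pdivrMr// -natrM ler_nat -addnS mulnDr leq_add2l.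
  by rewrite leq_pmull.
rewrite [e in leRHS]splitr; apply: modulusD_le => //.
by rewrite modulusM modulus_nat mulrC -ler_pdivlMr.
Qed.

End SquareSummable.

(** * Boundedness from summable autocorrelations *)

Section Autocorrelation.
Context {R : realType}.
Implicit Types (e : R) (G : R[i] -> R[i]) (g : nat -> R[i]) (X : nat -> R) (i j l m L M N : nat).

Let sum_skip (V : zmodType) (f : nat -> V) i L : (forall l, (l < i)%N -> f l = 0) ->
  (i <= L)%N -> \sum_(l < L) f l = \sum_(l < L - i) f (i + l)%N.
Proof.
move=> f0 iL; transitivity (\sum_(l < i + (L - i)) f l); first by rewrite subnKC.
by rewrite big_split_ord /= big1 ?add0r// => l _; exact: f0.
Qed.

Let uniform_threshold (Q : nat -> nat -> Prop) N :
  (forall m, exists M0, forall M, (M0 <= M)%N -> Q m M) ->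
  exists M0, forall m M, (m < N)%N -> (M0 <= M)%N -> Q m M.
Proof.
move=> H; elim: N => [|N [M1 H1]]; first by exists 0%N.
have [M2 H2] := H N; exists (maxn M1 M2) => m M.
rewrite ltnS geq_max leq_eqVlt => /orP[/eqP-> /andP[_ /H2//]|mN /andP[MM _]].
exact: H1.
Qed.

(** For [z] in the disc let [v] be the coefficient sequence of
    [w |-> G w / (1 - conjc z * w)], up to truncation. Its l2 norm squared is a
    combination of autocorrelations of [g], hence at most [2 T / (1 - |z|^2)],
    while pairing it with the powers of [z] gives [G z / (1 - |z|^2)]. *)
Lemma bounded_of_autocorrelation G g X T : taylor_expansion G g ->
  (forall m, 0 <= X m) -> (forall M, \sum_(m < M) X m <= T) ->
  (forall m e, 0 < e -> exists M0, forall M, (M0 <= M)%N ->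
    modulus (\sum_(l < M) g l * conjc (g (l + m)%N)) <= X m + e) ->
  forall z, disc z -> modulus (G z) <= T + 3.
Proof.
move=> Gg X0 XT H z dz; have T0 : 0 <= T by have := XT 0%N; rewrite big_ord0.
pose rho := modulus z; have r0 : 0 <= rho by exact: modulus_ge0.
have r1 : rho < 1 by [].
pose q := rho ^+ 2; have q0 : 0 <= q by exact: sqr_ge0.
have q1 : q < 1 by rewrite expr_lt1.
pose sg M := \sum_(i < M) q ^+ i.
have qi0 i : 0 <= q ^+ i by exact: exprn_ge0.
have sgB M : sg M <= (1 - q)^-1.
  rewrite -[leRHS]mul1r ler_pdivlMr ?subr_gt0// mulrC -[1 - q]opprB mulNr.
  by rewrite -subrX1 opprB lerBlDr lerDl.
(* a truncation beyond which the geometric series at most doubles *)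
have [N0 HN0] := sum_tail qi0 sgB ltr01.
pose N := N0.+1.
have sg1 : 1 <= sg N.
  by rewrite /sg big_ord_recl expr0 lerDl sumr_ge0.
have sgL M : sg (N + M)%N <= 2 * sg N.
  rewrite /sg big_split_ord /= mulr_natl mulr2n lerD2l.
  by apply: le_trans sg1; apply: HN0.
pose e : R := (N%:R ^+ 2)^-1.
have NN0 : 0 < N%:R ^+ 2 :> R by rewrite exprn_gt0.
have e0 : 0 < e by rewrite invr_gt0.
have [M0 HM0] := @uniform_threshold (fun m M =>
  modulus (\sum_(l < M) g l * conjc (g (l + m)%N)) <= X m + e) N
  (fun m => H m e e0).
have [n0 Hn0] := (taylor_expansionP G g).1 Gg z dz 1 ltr01.
pose L := (N + (M0 + n0))%N.
have iL (i : 'I_N) : (i <= L)%N by rewrite (leq_trans (ltnW (ltn_ord i)))// leq_addr.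
have iM (i : 'I_N) : (M0 + n0 <= L - i)%N.
  rewrite leq_subRL ?iL//.
  by rewrite leq_add2r ltnW.
pose y := conjc z; have my : modulus y = rho by rewrite modulus_conj.
pose v l := \sum_(i < N) y ^+ i * shift i g l.
pose P := \sum_(l < L) z ^+ l * v l.
have PE : P = \sum_(i < N) (q ^+ i)%:C * \sum_(l < L - i) g l * z ^+ l.
  rewrite /P; under eq_bigr do rewrite mulr_sumr.
  rewrite exchange_big /=; apply: eq_bigr => i _.
  rewrite (@sum_skip _ (fun l => z ^+ l * (y ^+ i * shift i g l)) i L) ?iL//.
    rewrite mulr_sumr; apply: eq_bigr => l _.
    rewrite /shift ltnNge leq_addr /= addKn exprD.
    have -> : (q ^+ i)%:C = z ^+ i * y ^+ i :> R[i].
      by rewrite -exprMn mulc_conj rmorphXn.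
    by ring.
  by move=> l li; rewrite /shift li !mulr0.
have PG : modulus (P - (sg N)%:C * G z) <= sg N.
  rewrite PE rmorph_sum mulr_suml -sumrB; apply: le_trans (modulus_sum _ _ _) _.
  apply: ler_sum => i _; rewrite -mulrBr modulusM modulus_real ger0_norm//.
  rewrite ler_piMr//; apply: Hn0.
  by apply: leq_trans (iM i); exact: leq_addl.
pose C i j := \sum_(l < L) shift i g l * conjc (shift j g l).
have CS i j : C i j = conjc (C j i).
  rewrite /C rmorph_sum; apply: eq_bigr => l _.
  by rewrite rmorphM /= conjcK mulrC.
have C_le (i j : 'I_N) : (j <= i)%N -> modulus (C i j) <= X (i - j)%N + e.
  move=> ji; rewrite /C.
  rewrite (@sum_skip _ (fun l => shift i g l * conjc (shift j g l)) i L) ?iL//; last first.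
    by move=> l li; rewrite /shift li mul0r.
  rewrite (eq_bigr (fun l : 'I_(L - i) => g l * conjc (g (l + (i - j))%N))); last first.
    move=> l _; rewrite /shift ltnNge leq_addr /= addKn.
    by rewrite ltnNge (leq_trans ji) ?leq_addr//= addnC addnBA.
  apply: HM0; first by rewrite (leq_ltn_trans (leq_subr _ _)).
  by apply: leq_trans (iM i); exact: leq_addr.
pose U i j := if (j <= i)%N then X (i - j)%N else 0.
have U0 i j : 0 <= U i j by rewrite /U; case: ifP.
have UT (j : 'I_N) : \sum_(i < N) U i j <= T.
  have Uj l : (l < j)%N -> U l j = 0 by move=> lj; rewrite /U leqNgt lj.
  have E : \sum_(i < N) U i j = \sum_(l < N - j) U (j + l)%N j.
    exact: (@sum_skip R (U^~ j) j N Uj (ltnW (ltn_ord j))).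
  rewrite E; apply: le_trans (XT (N - j)%N); apply: ler_sum => l _.
  by rewrite /U leq_addr addKn.
have C_le' (i j : 'I_N) : rho ^+ (i + j) * modulus (C i j) <=
    q ^+ j * U i j + q ^+ i * U j i + e.
  have rr i' j' : (j' <= i')%N -> rho ^+ (i' + j') <= q ^+ j'.
    by move=> ji; rewrite -exprM ler_wiXn2l// ?ltW// mul2n -addnn leq_add2r.
  have half i' j' : (j' <= i')%N -> forall w, 0 <= w -> w <= X (i' - j')%N + e ->
      rho ^+ (i' + j') * w <= q ^+ j' * U i' j' + e.
    move=> ji w w0 wX; rewrite /U ji.
    apply: le_trans (ler_wpM2l (exprn_ge0 _ r0) wX) _; rewrite mulrDr lerD//.
      by rewrite ler_wpM2r// rr.
    by rewrite ler_piMl ?(ltW e0)// exprn_ile1// ltW.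
  case: (leqP j i) => [ji|/ltnW ij].
    apply: le_trans (half i j ji _ (modulus_ge0 _) (C_le i j ji)) _.
    by rewrite lerD2r lerDl mulr_ge0.
  rewrite CS modulus_conj addnC.
  apply: le_trans (half j i ij _ (modulus_ge0 _) (C_le j i ij)) _.
  by rewrite lerD2r lerDr mulr_ge0.
have vC : (\sum_(l < L) modulus (v l) ^+ 2)%:C =
    \sum_(i < N) \sum_(j < N) y ^+ i * z ^+ j * C i j.
  rewrite rmorph_sum /=; under eq_bigr do rewrite -mulc_conj.
  rewrite (eq_bigr (fun l : 'I_L => \sum_(i < N) \sum_(j < N)
      (y ^+ i * shift i g l) * (z ^+ j * conjc (shift j g l)))); last first.
    move=> l _; rewrite {2}/v rmorph_sum /v big_distrlr /=.
    apply: eq_bigr => i _; apply: eq_bigr => j _; congr (_ * _).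
    by rewrite rmorphM rmorphXn /= conjcK.
  rewrite exchange_big; apply: eq_bigr => i _ /=.
  rewrite exchange_big; apply: eq_bigr => j _ /=.
  by rewrite /C mulr_sumr; apply: eq_bigr => l _; ring.
have v_le : \sum_(l < L) modulus (v l) ^+ 2 <= 2 * sg N * T + 1.
  have v0 : 0 <= \sum_(l < L) modulus (v l) ^+ 2.
    by apply: sumr_ge0 => l _; exact: sqr_ge0.
  rewrite -(ger0_norm v0) -modulus_real vC.
  apply: (@le_trans _ _ (\sum_(i < N) \sum_(j < N)
      (q ^+ j * U i j + q ^+ i * U j i + e))).
    apply: le_trans (modulus_sum _ _ _) _; apply: ler_sum => i _.
    apply: le_trans (modulus_sum _ _ _) _; apply: ler_sum => j _.
    by rewrite !modulusM !modulusX my -exprD.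
  under eq_bigr do rewrite !big_split /=.
  rewrite !big_split /=; apply: lerD; last first.
    rewrite sumr_const card_ord sumr_const card_ord -mulrnA -mulr_natl natrM -expr2.
    by rewrite mulfV// gt_eqF.
  rewrite -mulrA mulr_natl mulr2n; apply: lerD.
    rewrite exchange_big /= /sg mulr_suml; apply: ler_sum => j _.
    by rewrite -mulr_sumr ler_wpM2l.
  rewrite /sg mulr_suml; apply: ler_sum => i _.
  by rewrite -mulr_sumr ler_wpM2l.
have P_le : modulus P <= (2 * sg N + (2 * sg N * T + 1)) / 2.
  apply: (@le_trans _ _ ((\sum_(l < L) (q ^+ l + modulus (v l) ^+ 2)) / 2)).
    apply: le_trans (modulus_sum _ _ _) _; rewrite mulr_suml; apply: ler_sum => l _.
    rewrite modulusM modulusX -/rho /q exprAC; set a := rho ^+ l; set b := modulus (v l).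
    rewrite ler_pdivlMr//; have := sqr_ge0 (a - b); rewrite sqrrB.
    by move=> h; rewrite -subr_ge0; apply: le_trans h _; rewrite le_eqVlt; apply/orP; left; apply/eqP; ring.
  by rewrite ler_pM2r// big_split lerD// sgL.
have : sg N * modulus (G z) <= sg N * (T + 3).
  have -> : sg N * modulus (G z) = modulus ((sg N)%:C * G z).
    by rewrite modulusM modulus_real ger0_norm// (le_trans ler01).
  have -> : (sg N)%:C * G z = P - (P - (sg N)%:C * G z) by ring.
  apply: le_trans (modulusBD _ _) _; apply: le_trans (lerD P_le PG) _.
  move: sg1; set s := sg N => s1; set w := s * T.
  have -> : 2 * s * T = 2 * w by rewrite /w; ring.
  have -> : s * (T + 3) = w + 3 * s by rewrite /w; ring.
  by lra.
by rewrite ler_pM2l// (lt_le_trans ltr01).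
Qed.

End Autocorrelation.

(** * Power decay of the coefficients *)

Section Decay.
Context {R : realType}.
Implicit Types (s x y C alpha : R) (c a : nat -> R[i]) (k : R[i] -> R[i]) (l m M : nat).

Local Notation pw s l := (l.+1%:R `^ (- s)).

Lemma powRN_le s x y : 0 <= s -> 0 < x -> x <= y -> y `^ (- s) <= x `^ (- s).
Proof.
move=> s0 x0 xy; have y0 := lt_le_trans x0 xy.
rewrite !powRN lef_pV2 ?posrE ?powR_gt0//.
by apply: ge0_ler_powR; rewrite ?nnegrE// ltW.
Qed.

(** Cauchy condensation, in the form [S_(2M+1) <= 1 + 2^(1-s) S_M]. *)
Lemma pseries_bounded s : 1 < s ->
  exists P : R, forall M, \sum_(l < M) pw s l <= P.
Proof.
move=> s1; have s0 : 0 <= s by rewrite ltW// (lt_trans ltr01).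
pose S M := \sum_(l < M) pw s l; pose q : R := 2 * 2 `^ (- s).
have q1 : q < 1.
  rewrite /q powRN ltr_pdivrMr ?powR_gt0// mul1r.
  rewrite -(@mulr_powRB1 _ 2 s) ?(lt_trans ltr01)// ltr_pMr//.
  rewrite -[ltLHS](congr1 (@^~ (s - 1)) (powR1 R)) gt0_ltr_powR ?nnegrE//.
    by rewrite subr_gt0.
  by rewrite ltr1n.
have key M : S M.*2.+1 <= 1 + q * S M.
  elim: M => [|M IH].
    by rewrite /S double0 big_ord_recl !big_ord0 addr0 mulr0 addr0 powR1.
  rewrite doubleS /S 2!big_ord_recr /= [in leRHS]big_ord_recr /= mulrDr addrA -addrA.
  apply: lerD; first exact: IH.
  have E : M.*2.+2%:R `^ (- s) = 2 `^ (- s) * pw s M :> R.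
    by rewrite -powRM// -natrM mul2n doubleS.
  rewrite E /q -mulrA mulr_natl mulr2n lerD2l -E.
  by apply: powRN_le => //; rewrite ler_nat.
exists (1 - q)^-1 => M; rewrite -[leRHS]mul1r ler_pdivlMr ?subr_gt0//.
have pw0 l : 0 <= pw s l :> R by exact: powR_ge0.
have : S M <= 1 + q * S M.
  apply: le_trans (key M); apply: (sum_nat_nondecreasing pw0).
  by rewrite -addnn -addSn leq_addl.
by rewrite mulrBr mulr1 lerBlDr mulrC.
Qed.

Lemma bigO_powR_bound c alpha : 0 <= alpha ->
  (fun n => modulus (c n) : R^o) =O_\oo (fun n => n%:R `^ (- alpha) : R^o) ->
  exists2 C, 0 <= C & forall l, modulus (c l) <= C * pw alpha l.
Proof.
move=> a0 /eqO_exP[C C0 [n1 _ H]].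
pose W := \sum_(l < n1.+1) modulus (c l) * l.+1%:R `^ alpha.
have W0 : 0 <= W by apply: sumr_ge0 => l _; rewrite mulr_ge0 ?modulus_ge0 ?powR_ge0.
have C20 : 0 <= C * 2 `^ alpha by rewrite mulr_ge0 ?powR_ge0// ltW.
exists (C * 2 `^ alpha + W) => [|l]; first by rewrite addr_ge0.
have p0 : 0 < l.+1%:R `^ alpha :> R by rewrite powR_gt0.
have [ln|nl] := ltnP l n1.+1.
  rewrite powRN ler_pdivlMr//; apply: (@le_trans _ _ W); last by rewrite lerDr.
  rewrite /W (bigD1 (Ordinal ln))//= lerDl; apply: sumr_ge0 => i _.
  by rewrite mulr_ge0 ?modulus_ge0 ?powR_ge0.
have := H l (ltnW nl); rewrite /= ger0_norm ?modulus_ge0// ger0_norm ?powR_ge0// => h.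
have l0 : 0 < l%:R :> R by rewrite ltr0n (leq_trans _ nl).
apply: le_trans h _; apply: (@le_trans _ _ (C * 2 `^ alpha * pw alpha l)); last first.
  by rewrite ler_wpM2r ?powR_ge0// lerDl.
rewrite -mulrA ler_pM2l//.
have -> : l%:R `^ (- alpha) = 2 `^ alpha * (2 * l%:R) `^ (- alpha) :> R.
  rewrite powRM ?(ltW l0)// mulrA (powRN 2 alpha).
  by rewrite mulfV ?mul1r// gt_eqF// powR_gt0.
rewrite ler_wpM2l ?powR_ge0// powRN_le// -natrM ler_nat mul2n -addnn.
by rewrite -addn1 leq_add2l (leq_trans _ nl).
Qed.

Lemma bounded_of_decay k c C alpha : 1 < alpha -> 0 <= C ->
  taylor_expansion k c -> (forall l, modulus (c l) <= C * pw alpha l) ->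
  exists K, forall z, disc z -> modulus (k z) <= K.
Proof.
move=> a1 C0 kc cC; have [P HP] := pseries_bounded a1.
exists (C * P) => z dz; apply/ler_addgt0Pl => e e0.
have [n0 /(_ n0 (leqnn _)) H] := (taylor_expansionP k c).1 kc z dz e e0.
have -> : k z = - (\sum_(i < n0) c i * z ^+ i - k z) + \sum_(i < n0) c i * z ^+ i by ring.
apply: modulusD_le; first by rewrite modulusN.
apply: le_trans (modulus_sum _ _ _) _; apply: le_trans (ler_wpM2l C0 (HP n0)).
rewrite mulr_sumr; apply: ler_sum => i _; rewrite modulusM modulusX.
apply: le_trans (cC i); rewrite ler_piMr ?modulus_ge0// exprn_ile1 ?modulus_ge0//.
exact: ltW.
Qed.

Let natr_powRD l x y : l.+1%:R `^ (x + y) = l.+1%:R `^ x * l.+1%:R `^ y :> R.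
Proof. by rewrite powRD// pnatr_eq0 implybT. Qed.

Lemma weighted_square_summable c C alpha : 1 < alpha -> 0 <= C ->
  (forall l, modulus (c l) <= C * pw alpha l) ->
  exists B, forall M, \sum_(l < M) l.+1%:R * modulus (c l) ^+ 2 <= B.
Proof.
move=> a1 C0 cC; have a2 : 1 < alpha + alpha - 1 by lra.
have [P HP] := pseries_bounded a2.
exists (C ^+ 2 * P) => M; apply: le_trans (ler_wpM2l (sqr_ge0 C) (HP M)).
rewrite mulr_sumr; apply: ler_sum => l _.
have -> : - (alpha + alpha - 1) = 1 + (- alpha + - alpha) by ring.
rewrite 2!natr_powRD powRr1// -expr2 [leRHS]mulrCA ler_wpM2l// -exprMn.
by rewrite lerXn2r ?nnegrE ?modulus_ge0// mulr_ge0 ?powR_ge0.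
Qed.

(** The exponent splits as [alpha = beta + (alpha - beta)] with [beta > 1],
    for summability in [m], and [alpha - beta > 1/2], for square summability
    in [l]; such a [beta] exists if and only if [alpha > 3/2]. *)
Lemma cross_correlation_decay a c C B alpha : 3 / 2 < alpha -> 0 <= C ->
  (forall M, \sum_(l < M) modulus (a l) ^+ 2 <= B) ->
  (forall l, modulus (c l) <= C * pw alpha l) ->
  exists X : nat -> R, exists T : R, [/\ forall m, 0 <= X m,
    forall M, \sum_(m < M) X m <= T &
    forall m M, \sum_(l < M) modulus (a l) * modulus (c (l + m)%N) <= X m].
Proof.
move=> a32 C0 aB cC; have B0 : 0 <= B by have := aB 0%N; rewrite big_ord0.
pose beta := (alpha + 1 / 2) / 2; pose gam := alpha - beta.
have b1 : 1 < beta by rewrite /beta; lra.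
have g1 : 1 < gam + gam by rewrite /gam /beta; lra.
have g0 : 0 <= gam by lra.
have [P HP] := pseries_bounded b1; have [Q HQ] := pseries_bounded g1.
have Q0 : 0 <= Q by have := HQ 0%N; rewrite big_ord0.
have W0 : 0 <= C * ((B + Q) / 2) by rewrite mulr_ge0// divr_ge0// addr_ge0.
exists (fun m => C * ((B + Q) / 2) * pw beta m); exists (C * ((B + Q) / 2) * P).
split=> [m|M|m M].
- by rewrite mulr_ge0 ?powR_ge0.
- by rewrite -mulr_sumr ler_wpM2l.
apply: (@le_trans _ _ (\sum_(l < M) C * pw beta m * (modulus (a l) * pw gam l))).
  apply: ler_sum => l _; rewrite mulrCA ler_wpM2l ?modulus_ge0//.
  apply: le_trans (cC _) _; rewrite -mulrA ler_wpM2l//.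
  have -> : - alpha = - beta + - gam by rewrite /gam; ring.
  rewrite natr_powRD ler_pM ?powR_ge0//; apply: powRN_le => //; try lra.
    by rewrite ler_nat ltnS leq_addl.
  by rewrite ler_nat ltnS leq_addr.
rewrite -mulr_sumr mulrAC ler_wpM2r ?powR_ge0// ler_wpM2l//.
apply: (@le_trans _ _ ((\sum_(l < M) (modulus (a l) ^+ 2 + pw (gam + gam) l)) / 2)).
  rewrite mulr_suml; apply: ler_sum => l _; rewrite (opprD gam gam) (natr_powRD l (- gam) (- gam)) -expr2.
  set x := modulus _; set y := _ `^ _; rewrite ler_pdivlMr// -subr_ge0.
  have -> : x ^+ 2 + y ^+ 2 - x * y * 2 = (x - y) ^+ 2 by ring.
  exact: sqr_ge0.
by rewrite ler_pM2r// big_split lerD.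
Qed.

End Decay.

(** * Boundedness of the extremal function *)
Section Conclusion.
Context {R : realType}.

Lemma extremal_bounded (n : nat) (n0 : (0 < n)%N) (k F : R[i] -> R[i]) (c : nat -> R[i])
    (alpha : R) : (exists2 z, disc z & k z != 0) -> taylor_expansion k c ->
  extremal_function (n.*2)%:R k F -> 3 / 2 < alpha ->
  (fun m => modulus (c m) : R^o) =O_\oo (fun m => m%:R `^ (- alpha) : R^o) ->
  hardy_infty F.
Proof.
move=> k_neq0 kc extremal a32 cO.
have a1 : 1 < alpha by lra.
have [C C0 cC] := bigO_powR_bound (ltW (lt_trans ltr01 a1)) cO.
have [K kK] := bounded_of_decay a1 C0 kc cC.
have [B1 cB1] := weighted_square_summable a1 C0 cC.
have bF := extremal_bergman n0 extremal.
have [a Fa] := analytic_taylor bF.1.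
have [g Gg] := analytic_taylor (analyticX (m := n) bF.1).
have N0 := extremal_value_gt0 n0 kc kK extremal cB1 k_neq0.
have [Ba aB] := coef_square_summable n0 kc kK extremal Fa Gg cB1 N0.
have [X [T [X0 XT acX]]] := cross_correlation_decay a32 C0 aB cC.
have corr := autocorrelation_le n0 kc kK extremal Fa Gg cB1 N0.
set r := _ / _ in corr; have r0 : 0 <= r by rewrite divr_ge0// ltW.
have bG := @bounded_of_autocorrelation R _ g (fun m => r * X m) (r * T) Gg _ _ _.
split; first exact: bF.1.
exists (1 + (r * T + 3)) => z dz.
have : modulus (F z ^+ n) <= r * T + 3.
  apply: bG => // [m|M|m e e0]; first by rewrite mulr_ge0.
    by rewrite -mulr_sumr ler_wpM2l.
  have [M0 H] := corr m e e0; exists M0 => M /H h; apply: le_trans h _.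
  by rewrite lerD2r ler_wpM2l.
rewrite modulusX; have x0 := modulus_ge0 (F z); set x := modulus (F z) in x0 *.
have [x1 h|/ltW x1] := leP x 1; first by rewrite (le_trans x1)// lerDl (le_trans _ h)// exprn_ge0.
move=> h; apply: (@le_trans _ _ (x ^+ n)); first by rewrite -[leLHS]expr1 ler_weXn2l.
by apply: le_trans h _; rewrite lerDr.
Qed.

End Conclusion.

Unset Implicit Arguments.
Set Strict Implicit.
Set Printing Implicit Defensive.

Theorem corollary3p3 (R : realType) (p : nat) (hp0 : (0 < p)%N) (hp : ~~ odd p)
    (q : R) (hq : q = p%:R / (p%:R - 1))
    (k : R[i] -> R[i]) (hk : bergman q k)
    (hk0 : exists2 z, disc z & k z != 0)
    (c : nat -> R[i]) (hc : taylor_expansion k c)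
    (F : R[i] -> R[i]) (hF : extremal_function p%:R k F)
    (alpha : R) (halpha : 3 / 2 < alpha)
    (hO : (fun n => modulus (c n) : R^o) =O_\oo (fun n => n%:R `^ (- alpha) : R^o)) :
  hardy_infty F.
Proof.
have pE : p = p./2.*2 by rewrite -[LHS]odd_double_half (negbTE hp).
have n0 : (0 < p./2)%N by rewrite -double_gt0 -pE.
rewrite pE in hF.
exact: (extremal_bounded n0 hk0 hc hF halpha hO).
Qed.
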